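(* Let $I$ be an interval and let $(\Omega_\varepsilon)_{\varepsilon\in I}$ be an analytic family of strictly convex planar domains with analytic boundary. Let $(m,n)\in\mathbb{Z}\times\mathbb{N}^{*}$ be coprime integers with $m/n\in(0,1)$. Then the set of $\varepsilon\in I$ such that the billiard map inside $\Omega_\varepsilon$ has an $(m,n)$-periodic invariant curve is either discrete or equal to the whole of $I$.
   Context: Analytic family: the boundaries $\partial\Omega_\varepsilon$ admit (regular) parametrizations $\gamma_\varepsilon$, periodic in the parameter, with $(\varepsilon,s)\mapsto\gamma_\varepsilon(s)$ analytic; the domains are bounded. Billiard map (classical Birkhoff billiard): let $\Omega$ be a strictly convex bounded domain with boundary of perimeter $L$, oriented and parametrized by arc-length $s\in\mathbb{R}$ ($L$-periodically) by $\gamma$. For $s\in\mathbb{R}$ and $\varphi\in(0,\pi)$, let $\ell$ be the line through $\gamma(s)$ making angle $\varphi$ with the oriented tangent line at $\gamma(s)$; let $\gamma(s_1)$, $s<s_1<s+L$, be its second intersection point with $\partial\Omega$, and $\varphi_1\in(0,\pi)$ the angle $\ell$ makes with the tangent line at $\gamma(s_1)$ (angle of reflection equals angle of incidence). The billiard map is $F(s,\sigma)=(s_1,\sigma_1)$ with $\sigma=-\cos\varphi$, $\sigma_1=-\cos\varphi_1$, acting on $\mathbb{R}\times(-1,1)$; it commutes with $(s,\sigma)\mapsto(s+L,\sigma)$. $(m,n)$-periodic invariant curve: the graph $\Gamma=\{(s,\eta(s))\}$ of an $L$-periodic Lipschitz continuous function $\eta:\mathbb{R}\to(-1,1)$ such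 that $F(\Gamma)\subseteq\Gamma$ and $F^n(s,\eta(s))=(s+mL,\eta(s))$ for all $s$ (after rescaling the perimeter to $1$, the translation is by $m$). *)

(* Defs.v *)
(* The plane is [R * R] for an arbitrary [R : realType].
   The library norm on [R * R] is the max norm: it is used for topological
   notions only, Euclidean quantities are written out in coordinates. *)
From HB Require Import structures.
From mathcomp Require Import all_boot all_order all_algebra.
From mathcomp Require Import all_classical all_reals all_analysis.

Set Implicit Arguments.
Unset Strict Implicit.
Unset Printing Implicit Defensive.

Import Order.TTheory GRing.Theory Num.Theory.
Import numFieldNormedType.Exports.

Local Open Scope classical_set_scope.
Local Open Scope ring_scope.

Section Plane.
Context {R : realType}.
Implicit Types (u v p q : R * R) (A : set (R * R)).

Definition boundary A : set (R * R) := closure A `\` interior A.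

Definition segment_point (t : R) p q : R * R :=
  (t * p.1 + (1 - t) * q.1, t * p.2 + (1 - t) * q.2).

(* The boundary contains no segment, but its curvature may vanish at isolated
   points. *)
Definition strictly_convex A :=
  forall p q, closure A p -> closure A q -> p != q ->
  forall t : R, 0 < t < 1 -> interior A (segment_point t p q).

Definition strictly_convex_bounded_domain A :=
  [/\ open A, connected A, A !=set0, bounded_set (A : set (R^o * R^o)%type)
    & strictly_convex A].

Definition det2 u v : R := u.1 * v.2 - u.2 * v.1.

Definition rotate (phi : R) v : R * R :=
  (cos phi * v.1 - sin phi * v.2, sin phi * v.1 + cos phi * v.2).

(* [f] is, near every point of [D], the restriction to [D] of the sum of an
   absolutely convergent double power series.  Since the series converges on
   a full neighbourhood, [D] need not be open: on [I `*` setT], this means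
   analyticity up to the endpoints of [I] that belong to [I]. *)
Definition analytic_on (D : set (R * R)) (f : R * R -> R) :=
  forall p, D p -> exists (c : nat -> nat -> R) (r : R),
  [/\ 0 < r,
      forall h k : R, `|h| < r -> `|k| < r ->
        summable [set: nat * nat]
          (fun ij => (c ij.1 ij.2 * h ^+ ij.1 * k ^+ ij.2)%:E)
    & forall q, D q -> `|q.1 - p.1| < r -> `|q.2 - p.2| < r ->
        series (fun d : nat => \sum_(i < d.+1)
          c i (d - i)%N * (q.1 - p.1) ^+ i * (q.2 - p.2) ^+ (d - i)) @ \oo
        --> f q].

End Plane.

Section Curves.
Context {R : realType}.
Implicit Types (g : R -> R * R) (A : set (R * R)).

Definition velocity g (s : R) : R * R :=
  ((fst \o g)^`()%classic s, (snd \o g)^`()%classic s).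

Definition C1_curve g :=
  (forall s : R, derivable (fst \o g) s 1 /\ derivable (snd \o g) s 1) /\
  (continuous (fst \o g)^`()%classic /\ continuous (snd \o g)^`()%classic).

(* [T] is thus the least positive period. *)
Definition closed_parametrization A g (T : R) :=
  [/\ 0 < T, periodic g T, {in `[0, T[ &, injective g}
    & range g = boundary A].

(* The period of [gamma e] may depend on [e].  Regularity is [velocity != 0];
   differentiability is part of the analyticity of [gamma]. *)
Definition analytic_family (I : set R) (Omega : R -> set (R * R)) :=
  (forall e, I e -> strictly_convex_bounded_domain (Omega e)) /\
  exists gamma : R -> R -> R * R,
  [/\ analytic_on (I `*` setT) (fun p => (gamma p.1 p.2).1),
      analytic_on (I `*` setT) (fun p => (gamma p.1 p.2).2)
    & forall e, I e ->
        (exists T, closed_parametrization (Omega e) (gamma e) T) /\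
        (forall s, velocity (gamma e) s != 0)].

(* Counterclockwise arc-length parametrization, so that [L] is the perimeter:
   the last clause says that the domain lies to the left of the tangent. *)
Definition arclength_parametrization A g (L : R) :=
  [/\ closed_parametrization A g L, C1_curve g,
      forall s, (velocity g s).1 ^+ 2 + (velocity g s).2 ^+ 2 = 1
    & forall s p, A p ->
        0 < det2 (velocity g s) (p.1 - (g s).1, p.2 - (g s).2)].

(* [u] directs the line [l] through [g s] making the angle [phi] with the
   oriented tangent at [g s]; it points into the domain.  At the second
   intersection point it points out of the domain, and makes the angle
   [- phi1] with the oriented tangent there; the reflected line then makes the
   angle [phi1] with this tangent. *)
Definition billiard_step g (L : R) (p q : R * R) :=
  exists phi phi1 : R,
  let u := rotate phi (velocity g p.1) in
  [/\ 0 < phi < pi, 0 < phi1 < pi,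
      p.2 = - cos phi, q.2 = - cos phi1
    & [/\ p.1 < q.1 < p.1 + L,
          exists t : R, g q.1 = ((g p.1).1 + t * u.1, (g p.1).2 + t * u.2)
        & u = rotate (- phi1) (velocity g q.1)]].

(* Significant on [setT `*` `]-1, 1[] only, where [billiard_step] determines
   [q] from [p]; the default value [p] is never used there. *)
Definition billiard_map g (L : R) (p : R * R) : R * R :=
  xget p [set q | billiard_step g L p q].

Definition graph (eta : R -> R) : set (R * R) := [set (s, eta s) | s in setT].

Definition periodic_invariant_curve g (L : R) (m : int) (n : nat)
    (eta : R -> R) :=
  [/\ periodic eta L, lipschitz (eta : R^o -> R^o),
      forall s, -1 < eta s < 1,
      billiard_map g L @` graph eta `<=` graph eta
    & forall s, iter n (billiard_map g L) (s, eta s) = (s + m%:~R * L, eta s)].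

(* The counterclockwise arc-length parametrization is unique up to the choice
   of the base point, which does not affect the existence of the curve. *)
Definition has_periodic_invariant_curve A (m : int) (n : nat) :=
  exists g (L : R) eta,
    arclength_parametrization A g L /\ periodic_invariant_curve g L m n eta.

End Curves.

Definition discrete_set {T : topologicalType} (A : set T) := A `<=` isolated A.

(* Main.v *)
Require Import Defs.
From HB Require Import structures.
From mathcomp Require Import all_boot all_order all_algebra.
From mathcomp Require Import all_classical all_reals all_analysis.
From mathcomp Require Import ring lra zify.

Set Implicit Arguments.
Unset Strict Implicit.
Unset Printing Implicit Defensive.

Import Order.TTheory GRing.Theory Num.Theory.
Import numFieldNormedType.Exports.

Local Open Scope classical_set_scope.
Local Open Scope ring_scope.

(** On an invariant curve whose n-th iterate is the translation by m turns, the
    billiard map is described by an increasing map [G] of the parameter: the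
    orbit of [s] is [s], [G s], [G (G s)], and so on, it closes up after [n]
    steps, and it obeys the reflection law at each vertex. Written as the
    vanishing of [law], the reflection law does not depend on the choice of a
    parametrization; it is polynomial in the curve and its velocity, hence
    analytic in the parameters of the family. The theorem is thus about the set of the
    parameters [e] for which [gam e] has such a [closing_map].

    The heart is [closing_local]: if parameters with a closing map accumulate at
    [e0], then all the parameters of [I] near [e0] have one.

    - Taking limits along an ultrafilter, [limit_closing_map] gives a closing
      map at [e0]. In the limit the points of an orbit could collide; but then
      the limit orbit would never move, or would move by one full turn at each
      step, against [0 < m < n].
    - The closed orbits near an orbit of the limit map solve [n] equations in
      [n] unknowns. The derivative of the orbits of the limit map with respect
      to their first point is a positive solution of the linearized equations,
      by [positive_jacobi]. By the discrete form of Sturm's theorem,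
      [tridiagonal_inj], the equations at the vertices [1 .. n-1] determine the
      vertices [1 .. n-1] from the vertex [0], to first order.
    - The implicit function theorem therefore solves these [n - 1] equations,
      with solutions analytic in [e]. The last equation, evaluated at these
      solutions, is an analytic function of [e] that vanishes at the parameters
      with a closing map. As these accumulate at [e0], it is identically zero
      ([ps_zero]), so that every point starts a closed orbit, for every [e] near
      [e0] ([chart_exists]).
    - Closed orbits near the limit ones are unique, and they depend on their
      first point in a Lipschitz way, uniformly by compactness
      ([uniform_unique]): for each [e] the second vertex as a function of the
      first one is a closing map.

    The implicit function theorem is proved by Newton iteration with a fixed
    inverse of the linear part, in a normed algebra of functions of [h = e - e0]
    given by its relation [norm f <= C] ([fnorm]). Convergent power series give
    the analytic solution, and the values at a single [h] give its uniqueness.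

    By [invariant_curve_closing] closing maps are the same thing as periodic
    invariant curves. From a curve to a map one has to see that [G] is
    continuous. From a map to a curve one needs an arc-length parametrization,
    and the function [eta] has to be Lipschitz. This last point follows from the
    monotonicity of [G]: the outgoing chord bounds the increments of the
    cotangent of the exit angle from above, and the incoming one from below
    ([exit_cotan_step]).

    Finally, consider the points of [I] near which every parameter in [I] has an
    invariant curve. By [closing_local] they form an open and closed part of the
    interval [I], nonempty as soon as the set of the theorem has a point that is
    not isolated ([discrete_or_full]). *)

(** * Neighbourhoods and ultrafilters on the line *)

Section Near.
Context {R : realType}.

Lemma nearE_dist (a : R) (P : R -> Prop) :
  (\forall x \near a, P x) <->
  (exists2 d, 0 < d & forall x, `|x - a| < d -> P x).
Proof.
split=> [/nbhs_ballP[d /= d0 H]|[d d0 H]].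
  by exists d => // x xa; apply: H; rewrite /ball /= distrC.
by apply/nbhs_ballP; exists d => //= x; rewrite /ball /= distrC => /H.
Qed.

Lemma near_dist (a d : R) : 0 < d -> \forall x \near a, `|x - a| < d.
Proof. by move=> d0; apply/nearE_dist; exists d. Qed.

End Near.

Section UltraLimits.
Context {R : realType} {X : Type} (U : set_system X).
Hypothesis UU : UltraFilter U.

(** Bounded closed intervals are compact, so that along an ultrafilter every
    bounded quantity has a limit. *)
Lemma ultra_bounded_cvg (f : X -> R) (B : R) :
  U [set x | `|f x| <= B] -> exists l : R, f @ U --> l.
Proof.
move=> fB.
have cpt : compact (`[- B, B] : set R) by exact: segment_compact.
have [l [_ ll]] : `[- B, B]%classic `&` cluster (f @ U) !=set0.
  apply: cpt; rewrite /fmap /=; apply: filterS fB => x /=.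
  by rewrite in_itv /= ler_norml.
exists l => V Vl.
have [//|UV] := in_ultra_setVsetC (f @^-1` V) UU.
by have [y []] := ll (~` V) V UV Vl.
Qed.

End UltraLimits.

Lemma cvg_sumr {R : realType} {X J : Type} {F : set_system X} {FF : Filter F}
    (s : seq J) (f : J -> X -> R) (l : J -> R) :
  (forall j, f j @ F --> l j) ->
  (fun x => \sum_(j <- s) f j x) @ F --> \sum_(j <- s) l j.
Proof.
move=> fl; elim: s => [|j s IH].
  rewrite big_nil; under eq_fun do rewrite big_nil; exact: cvg_cst.
rewrite big_cons; under eq_fun do rewrite big_cons.
by apply: cvgD.
Qed.

(** * Power series of bounded weighted norm *)

Section PowerSeriesNorm.
Context {R : realType}.
Implicit Types (a b : nat -> R) (f g : R -> R) (r C h : R).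

Definition wnorm r a N := \sum_(k < N) `|a k| * r ^+ k.
Definition psum1 a h N := \sum_(k < N) a k * h ^+ k.

(** The bound [C] serves both for the weighted norm of the coefficients and for
    the remainders; [ps_intro] recovers the sharp remainders from any geometric
    ones. *)
Definition ps r C f := exists a : nat -> R,
  (forall N, wnorm r a N <= C) /\
  (forall h, `|h| < r -> forall N, `|f h - psum1 a h N| <= C * (`|h| / r) ^+ N).

Lemma sum_triangle (F : nat -> nat -> R) N :
  \sum_(k < N) \sum_(i < k.+1) F i (k - i)%N = \sum_(i < N) \sum_(j < N - i) F i j.
Proof.
elim: N => [|N IH]; first by rewrite !big_ord0.
rewrite big_ord_recr /= IH [RHS]big_ord_recr /= subSnn big_ord1.
rewrite [X in _ + X]big_ord_recr /= subnn addrA; congr (_ + _).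
rewrite -big_split /=; apply: eq_bigr => i _.
by rewrite subSn ?(ltnW (ltn_ord i)) // big_ord_recr.
Qed.

Lemma wnorm_ge0 r a N : 0 <= r -> 0 <= wnorm r a N.
Proof. by move=> r0; apply: sumr_ge0 => k _; rewrite mulr_ge0 ?exprn_ge0. Qed.

Lemma pow_ratio r h k : 0 < r -> `|h| ^+ k = r ^+ k * (`|h| / r) ^+ k.
Proof.
by move=> r0; rewrite -exprMn mulrC divfK // gt_eqF.
Qed.

Lemma ratio_lt1 r h : `|h| < r -> 0 <= `|h| / r < 1.
Proof.
move=> hr; have r0 : 0 < r by apply: le_lt_trans hr.
by rewrite divr_ge0 ?(ltW r0) //= ltr_pdivrMr // mul1r.
Qed.

(** Each term of the tail gains the factor [(|h| / r) ^ N] over its weight in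
    the norm. *)
Lemma psum1_tail r a h N M C : `|h| < r -> (forall N, wnorm r a N <= C) ->
  (N <= M)%N -> `|psum1 a h M - psum1 a h N| <= C * (`|h| / r) ^+ N.
Proof.
move=> hr aC NM; have r0 : 0 < r by apply: le_lt_trans hr.
have /andP[q0 q1] := ratio_lt1 hr.
rewrite /psum1 -!(big_mkord xpredT (fun k => a k * h ^+ k)).
rewrite (big_cat_nat (leq0n N) NM) //= addrAC subrr add0r.
apply: (le_trans (ler_norm_sum _ _ _)).
have W := aC M; rewrite /wnorm -(big_mkord xpredT (fun k => `|a k| * r ^+ k)) in W.
rewrite (big_cat_nat (leq0n N) NM) //= in W.
have W2 : \sum_(N <= i < M) `|a i| * r ^+ i <= C.
  apply: le_trans W; rewrite lerDr; apply: sumr_ge0 => i _.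
  by rewrite mulr_ge0 ?exprn_ge0 // ltW.
apply: le_trans (_ : (\sum_(N <= i < M) `|a i| * r ^+ i) * (`|h| / r) ^+ N <= _).
  rewrite mulr_suml big_nat_cond [leRHS]big_nat_cond.
  apply: ler_sum => i /andP[/andP[Ni _] _].
  rewrite normrM normrX (pow_ratio _ _ r0) mulrA ler_wpM2l //.
    by rewrite mulr_ge0 ?exprn_ge0 // ltW.
  by rewrite -(subnKC Ni) exprD ler_piMr ?exprn_ge0 // exprn_ile1 // ltW.
by rewrite ler_wpM2r // exprn_ge0.
Qed.

Lemma ps_intro r C f a : (forall N, wnorm r a N <= C) ->
  (forall h, `|h| < r -> exists D,
     forall N, `|f h - psum1 a h N| <= D * (`|h| / r) ^+ N) ->
  ps r C f.
Proof.
move=> aC fD; exists a; split=> // h hr N.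
have [D HD] := fD h hr; have /andP[q0 q1] := ratio_lt1 hr.
set q := `|h| / r in q0 q1 HD *.
have L : D * q ^+ M + C * q ^+ N @[M --> \oo] --> D * 0 + C * q ^+ N.
  apply: cvgD; last exact: cvg_cst.
  by apply: cvgM; [exact: cvg_cst | apply: cvg_expr; rewrite ger0_norm].
rewrite mulr0 add0r in L.
apply: (cvgr_to_ge L); near=> M.
have NM : (N <= M)%N by near: M; exact: nbhs_infty_ge.
have -> : f h - psum1 a h N = (f h - psum1 a h M) + (psum1 a h M - psum1 a h N) by ring.
by apply: (le_trans (ler_normD _ _)); rewrite lerD // psum1_tail.
Unshelve. all: by end_near. Qed.

Lemma ps_gt0 r C f : ps r C f -> 0 <= C.
Proof. by move=> [a [/(_ 0%N)]]; rewrite /wnorm big_ord0. Qed.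

Lemma ps_ev r C f h : ps r C f -> `|h| < r -> `|f h| <= C.
Proof.
by move=> [a [_ H]] hr; have := H h hr 0%N; rewrite /psum1 big_ord0 subr0 mulr1.
Qed.

Lemma ps_le r C C' f : 0 < r -> C <= C' -> ps r C f -> ps r C' f.
Proof.
move=> r0 CC [a [aC aH]]; exists a; split=> [N|h hr N].
  exact: le_trans CC.
apply: le_trans (aH h hr N) _; rewrite ler_wpM2r // exprn_ge0 //.
by rewrite divr_ge0 // ltW.
Qed.

Lemma ps_cst r (c : R) : 0 < r -> ps r `|c| (fun=> c).
Proof.
move=> r0; exists (fun k => if k is 0%N then c else 0); split=> [N|h hr N].
  case: N => [|N]; rewrite /wnorm; first by rewrite big_ord0.
  rewrite big_ord_recl /= big1 ?addr0 ?mulr1 // => i _.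
  by rewrite normr0 mul0r.
case: N => [|N]; rewrite /psum1; first by rewrite big_ord0 subr0 mulr1.
rewrite big_ord_recl /= big1 ?addr0 ?mulr1 ?subrr ?normr0; last first.
  by move=> i _; rewrite mul0r.
by rewrite mulr_ge0 // exprn_ge0 // divr_ge0 // ltW.
Qed.

Lemma ps_id r : 0 < r -> ps r r id.
Proof.
move=> r0; apply: (@ps_intro _ _ _ (fun k => match k with 1%N => 1 | _ => 0 end)) => [N|h hr].
  case: N => [|[|N]]; rewrite /wnorm; first by rewrite big_ord0 ltW.
    by rewrite big_ord1 /= normr0 mul0r ltW.
  rewrite 2!big_ord_recl /= normr0 mul0r add0r normr1 mul1r expr1 big1 ?addr0 //.
  by move=> i _; rewrite mul0r.
have /andP[q0 q1] := ratio_lt1 hr.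
exists r => -[|[|N]]; rewrite /psum1.
- by rewrite big_ord0 subr0 mulr1 ltW.
- by rewrite big_ord1 /= mul0r subr0 expr1 mulrC divfK ?gt_eqF.
rewrite 2!big_ord_recl /= mul0r add0r mul1r expr1 big1 ?addr0 ?subrr ?normr0.
  by rewrite mulr_ge0 ?exprn_ge0 // ltW.
by move=> i _; rewrite mul0r.
Qed.

Lemma ps_add r C C' f g : 0 < r ->
  ps r C f -> ps r C' g -> ps r (C + C') (fun h => f h + g h).
Proof.
move=> r0 [a [aC aH]] [b [bC bH]]; exists (fun k => a k + b k).
split=> [N|h hr N].
  apply: le_trans (lerD (aC N) (bC N)); rewrite /wnorm -big_split /=.
  by apply: ler_sum => i _; rewrite -mulrDl ler_wpM2r ?exprn_ge0 ?ler_normD // ltW.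
have -> : psum1 (fun k => a k + b k) h N = psum1 a h N + psum1 b h N.
  by rewrite /psum1 -big_split; apply: eq_bigr => i _; rewrite mulrDl.
rewrite opprD addrACA mulrDl.
by apply: (le_trans (ler_normD _ _)); rewrite lerD ?aH ?bH.
Qed.

Definition conv a b k := \sum_(i < k.+1) a i * b (k - i)%N.

Lemma psum1_conv a b h N : psum1 (conv a b) h N =
  \sum_(i < N) \sum_(j < N - i) (a i * h ^+ i) * (b j * h ^+ j).
Proof.
rewrite -(sum_triangle (fun i j => (a i * h ^+ i) * (b j * h ^+ j))).
apply: eq_bigr => k _; rewrite mulr_suml; apply: eq_bigr => i _.
have -> : h ^+ k = h ^+ i * h ^+ (k - i) by rewrite -exprD subnKC // -ltnS.
ring.
Qed.

Lemma wnorm_conv r a b N : 0 <= r ->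
  wnorm r (conv a b) N <= wnorm r a N * wnorm r b N.
Proof.
move=> r0; pose F i j := (`|a i| * r ^+ i) * (`|b j| * r ^+ j).
have F0 i j : 0 <= F i j by rewrite !mulr_ge0 ?exprn_ge0.
apply: (@le_trans _ _ (\sum_(k < N) \sum_(i < k.+1) F i (k - i)%N)).
  apply: ler_sum => k _.
  apply: (@le_trans _ _ ((\sum_(i < k.+1) `|a i * b (k - i)%N|) * r ^+ k)).
    by rewrite ler_wpM2r ?exprn_ge0 // ler_norm_sum.
  rewrite mulr_suml; apply: ler_sum => i _; rewrite /F normrM.
  have -> : r ^+ k = r ^+ i * r ^+ (k - i) by rewrite -exprD subnKC // -ltnS.
  by rewrite mulrACA.
rewrite (sum_triangle F) /wnorm mulr_suml; apply: ler_sum => i _.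
rewrite mulr_sumr -!(big_mkord xpredT (F i)) [leRHS](big_cat_nat (leq0n _) (leq_subr i N)) //=.
by rewrite lerDl; apply: sumr_ge0.
Qed.

Lemma conv_rest r a b h N C C' : `|h| < r ->
  (forall N, wnorm r a N <= C) -> (forall N, wnorm r b N <= C') ->
  `|psum1 a h N * psum1 b h N - psum1 (conv a b) h N| <= C * C' * (`|h| / r) ^+ N.
Proof.
move=> hr aC bC; have /andP[q0 q1] := ratio_lt1 hr.
have r0 : 0 < r by apply: le_lt_trans hr.
rewrite psum1_conv /psum1 mulr_suml -sumrB.
apply: (le_trans (ler_norm_sum _ _ _)).
apply: (@le_trans _ _ (wnorm r a N * C' * (`|h| / r) ^+ N)); last first.
  rewrite ler_wpM2r ?exprn_ge0 // ler_wpM2r //.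
  by apply: le_trans (bC 0%N); rewrite wnorm_ge0 // ltW.
rewrite /wnorm !mulr_suml; apply: ler_sum => i _.
have -> : a i * h ^+ i * (\sum_(j < N) b j * h ^+ j) -
    \sum_(j < N - i) a i * h ^+ i * (b j * h ^+ j) =
    a i * h ^+ i * (psum1 b h N - psum1 b h (N - i)).
  by rewrite /psum1 mulrBr [X in _ = _ - X]mulr_sumr.
rewrite normrM normrM normrX (pow_ratio h i r0).
have -> : (`|h| / r) ^+ N = (`|h| / r) ^+ i * (`|h| / r) ^+ (N - i).
  by rewrite -exprD subnKC // ltnW.
have := psum1_tail hr bC (leq_subr i N).
set X := `|_ - _|; set q := `|h| / r => HX.
have -> : `|a i| * r ^+ i * C' * (q ^+ i * q ^+ (N - i)) =
  `|a i| * (r ^+ i * q ^+ i) * (C' * q ^+ (N - i)) by ring.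
by rewrite ler_wpM2l // !mulr_ge0 ?exprn_ge0 // ltW.
Qed.

(** The weighted norm is submultiplicative for the Cauchy product. *)
Lemma ps_mul r C C' f g : 0 < r ->
  ps r C f -> ps r C' g -> ps r (C * C') (fun h => f h * g h).
Proof.
move=> r0 pf pg; have [a [aC aH]] := pf; have [b [bC bH]] := pg.
apply: (@ps_intro _ _ _ (conv a b)) => [N|h hr].
  apply: le_trans (wnorm_conv _ _ _ (ltW r0)) _.
  by rewrite ler_pM ?wnorm_ge0 // ltW.
have /andP[q0 q1] := ratio_lt1 hr.
exists (3%:R * (C * C')) => N; set q := `|h| / r in q0 q1 *.
have -> : f h * g h - psum1 (conv a b) h N = (f h - psum1 a h N) * g h +
  psum1 a h N * (g h - psum1 b h N) +
  (psum1 a h N * psum1 b h N - psum1 (conv a b) h N) by ring.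
have A1 := aH h hr N; have B1 := bH h hr N.
have A2 : `|psum1 a h N| <= C.
  have := psum1_tail hr aC (leq0n N).
  by rewrite {2}/psum1 big_ord0 subr0 expr0 mulr1.
have := conv_rest N hr aC bC; rewrite -/q => H3.
have H1 : `|(f h - psum1 a h N) * g h| <= (C * q ^+ N) * C'.
  by rewrite normrM ler_pM // (ps_ev pg).
have H2 : `|psum1 a h N * (g h - psum1 b h N)| <= C * (C' * q ^+ N).
  by rewrite normrM ler_pM.
apply: (le_trans (ler_normD _ _)); apply: (le_trans (lerD (ler_normD _ _) (lexx _))).
have -> : 3%:R * (C * C') * q ^+ N = C * q ^+ N * C' + C * (C' * q ^+ N) +
  C * C' * q ^+ N by ring.
by rewrite !lerD.
Qed.

(** The coefficients are bounded by [C / r ^ k], so they converge along an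
    ultrafilter, and the two finite conditions of [ps] pass to the limit. *)
Lemma ps_lim r C (F : nat -> R -> R) f : 0 < r -> (forall j, ps r C (F j)) ->
  (forall h, `|h| < r -> F^~ h @ \oo --> f h) -> ps r C f.
Proof.
move=> r0 pF Ff.
have [A HA] := choice pF.
have [U [UU oU]] := ultraFilterLemma (eventually_filter).
have bnd k : exists l : R, (fun j => A j k) @ U --> l.
  apply: (@ultra_bounded_cvg _ _ _ UU _ (C / r ^+ k)).
  apply: filterS filterT => j _ /=; rewrite ler_pdivlMr ?exprn_gt0 //.
  apply: le_trans ((HA j).1 k.+1); rewrite /wnorm big_ord_recr /= lerDr.
  by apply: sumr_ge0 => i _; rewrite mulr_ge0 ?exprn_ge0 // ltW.
have [a Ha] := choice bnd.
exists a; split=> [N|h hr N].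
  have L : (fun j => wnorm r (A j) N) @ U --> wnorm r a N.
    apply: cvg_sumr => i; apply: cvgM; last exact: cvg_cst.
    exact: cvg_norm.
  by apply: (cvgr_to_le L); apply: filterS filterT => j _; exact: (HA j).1.
have L : (fun j => `|F j h - psum1 (A j) h N|) @ U --> `|f h - psum1 a h N|.
  apply: cvg_norm; apply: cvgB.
    by apply: cvg_trans (Ff h hr); exact: cvg_app.
  apply: cvg_sumr => i; apply: cvgM; last exact: cvg_cst.
  exact: Ha.
by apply: (cvgr_to_le L); apply: filterS filterT => j _; exact: (HA j).2.
Qed.

(** The first nonzero coefficient would dominate the remainder at the zeros
    close enough to the origin. *)
Lemma ps_zero r C f (Z : R -> Prop) : 0 < r -> ps r C f ->
  (forall d, 0 < d -> exists h, [/\ h != 0, `|h| < d, Z h & f h = 0]) ->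
  forall h, `|h| < r -> f h = 0.
Proof.
move=> r0 pf HZ; have C0 := ps_gt0 pf; have [a [aC aH]] := pf.
have a0 k : a k = 0.
  elim/ltn_ind: k => k IH; apply/eqP; rewrite -normr_le0; apply/ler_addgt0Pr => e e0.
  rewrite add0r.
  have [|h [h0 hd _ fh]] := HZ (Num.min r (e * r ^+ k.+1 / (C + 1))).
    by rewrite lt_min r0 divr_gt0 ?mulr_gt0 ?exprn_gt0 // ltr_wpDl.
  move: hd; rewrite lt_min => /andP[hr hd].
  have := aH h hr k.+1; rewrite fh sub0r normrN /psum1 big_ord_recr /= big1 ?add0r.
    rewrite normrM normrX expr_div_n.
    have -> : C * (`|h| ^+ k.+1 / r ^+ k.+1) = `|h| ^+ k * (C * `|h| / r ^+ k.+1).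
      by rewrite exprS; ring.
    rewrite mulrC ler_pM2l ?exprn_gt0 ?normr_gt0 // => /le_trans; apply.
    rewrite ler_pdivrMr ?exprn_gt0 //.
    move: hd; rewrite ltr_pdivlMr ?ltr_wpDl // => /ltW; apply: le_trans.
    by rewrite mulrC ler_wpM2l // lerDl.
  by move=> i _; rewrite IH ?mul0r.
move=> h hr; apply/eqP; rewrite -normr_le0.
have /andP[q0 q1] := ratio_lt1 hr.
have L : C * (`|h| / r) ^+ M @[M --> \oo] --> C * 0.
  by apply: cvgM; [exact: cvg_cst | apply: cvg_expr; rewrite ger0_norm].
rewrite mulr0 in L; apply: (cvgr_to_ge L); near=> M.
have := aH h hr M; rewrite /psum1 big1 ?subr0 // => i _.
by rewrite a0 mul0r.
Unshelve. all: by end_near. Qed.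

End PowerSeriesNorm.

(** * Normed algebras of functions of one variable *)

Section FNorm.
Context {R : realType}.

(** [NN C f] reads: the norm of [f] is at most [C]. One fixed point argument then
    serves for power series and for the values at a single point, the two
    instances below. *)
Record fnorm (Dom : R -> Prop) (r : R) (NN : R -> (R -> R) -> Prop) : Prop := FNorm {
  fn_dom : forall h, Dom h -> `|h| < r;
  fn_le : forall C C' f, C <= C' -> NN C f -> NN C' f;
  fn_ev : forall C f h, NN C f -> Dom h -> `|f h| <= C;
  fn_id : NN r id;
  fn_cst : forall c, NN `|c| (fun=> c);
  fn_add : forall C C' f g, NN C f -> NN C' g -> NN (C + C') (fun h => f h + g h);
  fn_mul : forall C C' f g, NN C f -> NN C' g -> NN (C * C') (fun h => f h * g h);
  fn_lim : forall C (F : nat -> R -> R) f, (forall j, NN C (F j)) ->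
    (forall h, Dom h -> F^~ h @ \oo --> f h) -> NN C f }.

Lemma fnorm_ps (r : R) : 0 < r -> fnorm (fun h => `|h| < r) r (ps r).
Proof.
move=> r0; split=> //.
- by move=> C C' f; exact: ps_le.
- by move=> C f h; exact: ps_ev.
- exact: ps_id.
- by move=> c; exact: ps_cst.
- by move=> *; exact: ps_add.
- by move=> *; exact: ps_mul.
- by move=> C F f; exact: ps_lim.
Qed.

Lemma fnorm_at (r h0 : R) : `|h0| < r ->
  fnorm (fun h => h = h0) r (fun C f => `|f h0| <= C).
Proof.
move=> hr; split=> //.
- by move=> h ->.
- by move=> C C' f CC /le_trans; apply.
- by move=> C f h ? ->.
- exact: ltW.
- by move=> C C' f g Hf Hg; rewrite (le_trans (ler_normD _ _)) // lerD.
- by move=> C C' f g Hf Hg; rewrite normrM ler_pM.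
- move=> C F f HF Ff; have L : (fun j => `|F j h0|) @ \oo --> `|f h0| by apply: cvg_norm; exact: Ff.
  by apply: (cvgr_to_le L); near=> j; exact: HF.
Unshelve. all: by end_near. Qed.

End FNorm.

Ltac nonneg := do ?[apply: exprn_ge0 | apply: mulr_ge0]; rewrite ?normr_ge0 //; by apply: ltW.

Section FNormTheory.
Context {R : realType} (Dom : R -> Prop) (r : R) (NN : R -> (R -> R) -> Prop).
Hypothesis HN : fnorm Dom r NN.
Implicit Types (f g y : R -> R).

Lemma fn_ext C f g : f =1 g -> NN C f -> NN C g.
Proof. by move=> /funext ->. Qed.

Lemma fn_scale C c f : NN C f -> NN (`|c| * C) (fun h => c * f h).
Proof. exact: (fn_mul HN (fn_cst HN c)). Qed.

Lemma fn_opp C f : NN C f -> NN C (fun h => - f h).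
Proof.
move=> Hf; have := fn_scale (-1) Hf; rewrite normrN1 mul1r.
by apply: fn_ext => h; rewrite mulN1r.
Qed.

Lemma fn_0 : NN 0 (fun=> 0).
Proof. by have := fn_cst HN 0; rewrite normr0. Qed.

Lemma fn_exp C f k : NN C f -> NN (C ^+ k) (fun h => f h ^+ k).
Proof.
move=> Hf; elim: k => [|k IH].
  by have := fn_cst HN 1; rewrite normr1.
rewrite exprS; apply: fn_ext (fn_mul HN Hf IH) => h /=.
by rewrite exprS.
Qed.

Lemma fn_sum J (s : seq J) (F : J -> R -> R) (C : J -> R) :
  (forall j, NN (C j) (F j)) ->
  NN (\sum_(j <- s) C j) (fun h => \sum_(j <- s) F j h).
Proof.
move=> HF; elim: s => [|j s IH].
  rewrite big_nil; apply: fn_ext fn_0 => h; by rewrite big_nil.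
rewrite big_cons; apply: fn_ext (fn_add HN (HF j) IH) => h.
by rewrite big_cons.
Qed.

Lemma fn_subX C d y y' k : NN C y -> NN C y' -> NN d (fun h => y h - y' h) ->
  NN (d * (C ^+ k.-1 *+ k)) (fun h => y h ^+ k - y' h ^+ k).
Proof.
move=> Hy Hy' Hd.
under eq_fun do rewrite subrXX.
apply: (fn_mul HN) => //.
have -> : C ^+ k.-1 *+ k = \sum_(i < k) C ^+ (k.-1 - i) * C ^+ i.
  rewrite (eq_bigr (fun=> C ^+ k.-1)); first by rewrite sumr_const card_ord.
  by move=> i _; rewrite -exprD subnK //; have := ltn_ord i; lia.
by apply: fn_sum => i; apply: (fn_mul HN); exact: fn_exp.
Qed.

End FNormTheory.

(** * Substitution into double power series *)

Section DoubleSeries.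
Context {R : realType}.
Implicit Types (c : nat -> nat -> R) (h k K B rho : R).

Definition psum2 c h k D :=
  \sum_(d < D) \sum_(i < d.+1) c i (d - i)%N * h ^+ i * k ^+ (d - i).

Definition coef_bound c K B :=
  [/\ 0 <= K, 0 < B & forall i j, `|c i j| <= K * B ^+ (i + j)].

Definition fhat c h k : R := lim (psum2 c h k @ \oo).

Lemma geo_le2 (x : R) D : 0 <= x <= 2^-1 -> \sum_(d < D) x ^+ d <= 2.
Proof.
move=> /andP[x0 x1]; elim: D => [|D IH]; first by rewrite big_ord0.
rewrite big_ord_recl expr0.
have -> : \sum_(i < D) x ^+ lift ord0 i = x * \sum_(i < D) x ^+ i.
  by rewrite mulr_sumr; apply: eq_bigr => i _; rewrite exprS.
have : x * (\sum_(i < D) x ^+ i) <= 2^-1 * 2 by rewrite ler_pM // sumr_ge0 // => i _; rewrite exprn_ge0.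
lra.
Qed.

Lemma ltn_2exp d : (d.+1%:R : R) <= 2 ^+ d.
Proof. by rewrite -natrX ler_nat ltn_expl. Qed.

(** The homogeneous part of degree [d] has [d + 1 <= 2 ^ d] terms, hence is at most
    [K * (2 * B * rho) ^ d]. *)
Lemma psum2_cvg c K B rho h k : coef_bound c K B -> 4 * B * rho <= 2^-1 ->
  `|h| <= rho -> `|k| <= rho -> psum2 c h k @ \oo --> fhat c h k.
Proof.
move=> [K0 B0 cB] Br hr kr; have r0 : 0 <= rho by apply: le_trans hr.
pose u d := \sum_(i < d.+1) c i (d - i)%N * h ^+ i * k ^+ (d - i).
have E : psum2 c h k = series u.
  by apply/funext => D; rewrite /psum2 /series /= big_mkord.
suff : cvgn (series u) by rewrite /fhat E => /cvg_ex [l ll]; rewrite (cvg_lim _ ll).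
apply: normed_cvg.
apply: (@series_le_cvg _ _ (geometric K (4 * B * rho))) => [d|d|d|].
- exact: normr_ge0.
- by rewrite /geometric /= mulr_ge0 // exprn_ge0 // !mulr_ge0 // ltW.
- rewrite /geometric /= /u; apply: (le_trans (ler_norm_sum _ _ _)).
  apply: (@le_trans _ _ (\sum_(i < d.+1) K * B ^+ d * rho ^+ d)).
    apply: ler_sum => i _; have id : (i <= d)%N by rewrite -ltnS.
    rewrite !normrM !normrX -mulrA ler_pM //.
      by have := cB i (d - i)%N; rewrite subnKC.
    have -> : rho ^+ d = rho ^+ i * rho ^+ (d - i) by rewrite -exprD subnKC.
    by apply: ler_pM; rewrite ?exprn_ge0 // lerXn2r ?nnegrE.
  rewrite sumr_const card_ord -[leLHS]mulr_natr.
  have -> : K * (4 * B * rho) ^+ d = K * B ^+ d * rho ^+ d * 4 ^+ d.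
    by rewrite !exprMn; ring.
  apply: ler_wpM2l; first by nonneg.
  apply: le_trans (ltn_2exp _) _; rewrite lerXn2r ?nnegrE //; lra.
apply: is_cvg_geometric_series.
have : 0 <= 4 * B * rho by rewrite !mulr_ge0 // ltW.
by move=> /ger0_norm ->; lra.
Qed.

Section InNorm.
Variables (Dom : R -> Prop) (r : R) (NN : R -> (R -> R) -> Prop).
Hypothesis HN : fnorm Dom r NN.
Variables (c : nat -> nat -> R) (K B rho : R).
Hypothesis cB : coef_bound c K B.
Hypothesis r_rho : r <= rho.
Hypothesis Brho : 4 * B * rho <= 2^-1.
Hypothesis rho0 : 0 <= rho.

Let fn_hX i : NN (rho ^+ i) (fun h => h ^+ i).
Proof. by apply: (fn_exp HN); apply: (fn_le HN) r_rho (fn_id HN). Qed.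

Let dom_le h : Dom h -> `|h| <= rho.
Proof. by move=> /(fn_dom HN) hr; apply: ltW; apply: lt_le_trans r_rho. Qed.

Lemma fhat_near y : NN rho y ->
  NN (8 * K * B * rho) (fun h => fhat c h (y h) - c 0%N 0%N).
Proof.
move=> Hy; have [K0 B0 cb] := cB.
apply: (fn_lim HN (F := fun D h => psum2 c h (y h) D.+1 - c 0%N 0%N)); last first.
  move=> h Dh; apply: cvgB; last exact: cvg_cst.
  rewrite (@cvg_shiftS _ (psum2 c h (y h))).
  by apply: (psum2_cvg cB Brho); [exact: dom_le | exact: (fn_ev HN Hy)].
move=> D.
pose C := \sum_(d < D) \sum_(i < d.+2) `|c i (d.+1 - i)%N| * rho ^+ i * rho ^+ (d.+1 - i).
apply: (@fn_le _ _ _ _ HN C).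
  apply: (@le_trans _ _ (\sum_(d < D) 4 * K * B * rho * (4 * B * rho) ^+ d)); last first.
    rewrite -mulr_sumr.
    have -> : 8 * K * B * rho = 4 * K * B * rho * 2 by ring.
    apply: ler_wpM2l; first by nonneg.
    by apply: geo_le2; rewrite Brho !mulr_ge0 // ltW.
  apply: ler_sum => d _.
  apply: (@le_trans _ _ (\sum_(i < d.+2) K * B ^+ d.+1 * rho ^+ d.+1)).
    apply: ler_sum => i _; have id : (i <= d.+1)%N by rewrite -ltnS.
    rewrite -mulrA -exprD subnKC // ler_wpM2r ?exprn_ge0 //.
    by have := cb i (d.+1 - i)%N; rewrite subnKC.
  rewrite sumr_const card_ord -[leLHS]mulr_natr.
  have -> : 4 * K * B * rho * (4 * B * rho) ^+ d = K * B ^+ d.+1 * rho ^+ d.+1 * 4 ^+ d.+1.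
    by rewrite !exprMn !exprS; ring.
  apply: ler_wpM2l; first by nonneg.
  apply: le_trans (ltn_2exp _) _; rewrite lerXn2r ?nnegrE //; lra.
apply: (@fn_ext _ _ _ (fun h => \sum_(d < D) \sum_(i < d.+2)
   c i (d.+1 - i)%N * h ^+ i * y h ^+ (d.+1 - i))).
  move=> h; rewrite /psum2 [in RHS]big_ord_recl /= big_ord1 /= !expr0 !mulr1.
  by rewrite addrAC subrr add0r.
apply: (fn_sum HN) => d; apply: (fn_sum HN) => i.
apply: (fn_mul HN); last exact: (fn_exp HN).
exact: (fn_mul HN (fn_cst HN _)).
Qed.

(** Only the terms of degree at least two contribute, whence the factor [rho]:
    the substitution is strictly differentiable in the second variable, with
    constants that are the same in every norm. *)
Lemma fhat_diff y y' d0 : NN rho y -> NN rho y' -> 0 <= d0 ->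
  NN d0 (fun h => y h - y' h) ->
  NN (32 * K * B ^+ 2 * rho * d0)
    (fun h => fhat c h (y h) - fhat c h (y' h) - c 0%N 1%N * (y h - y' h)).
Proof.
move=> Hy Hy' d00 Hd; have [K0 B0 cb] := cB.
apply: (fn_lim HN (F := fun D h => psum2 c h (y h) D.+2 - psum2 c h (y' h) D.+2 -
  c 0%N 1%N * (y h - y' h))); last first.
  move=> h Dh; apply: cvgB; last exact: cvg_cst.
  have Ly : psum2 c h (y h) @ \oo --> fhat c h (y h).
    by apply: (psum2_cvg cB Brho); [exact: dom_le | exact: (fn_ev HN Hy)].
  have Ly' : psum2 c h (y' h) @ \oo --> fhat c h (y' h).
    by apply: (psum2_cvg cB Brho); [exact: dom_le | exact: (fn_ev HN Hy')].
  move: Ly Ly'; rewrite -[X in X -> _ -> _](@cvg_shiftn 2 _ (psum2 c h (y h))).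
  rewrite -[X in _ -> X -> _](@cvg_shiftn 2 _ (psum2 c h (y' h))).
  under eq_fun do rewrite addn2.
  under [in X in _ -> X -> _]eq_fun do rewrite addn2.
  exact: cvgB.
move=> D.
pose C := \sum_(d < D) \sum_(i < d.+3) `|c i (d.+2 - i)%N| * rho ^+ i *
  (d0 * (rho ^+ (d.+2 - i).-1 *+ (d.+2 - i))).
apply: (@fn_le _ _ _ _ HN C).
  apply: (@le_trans _ _ (\sum_(d < D) 16 * K * B ^+ 2 * rho * d0 * (4 * B * rho) ^+ d)); last first.
    rewrite -mulr_sumr.
    have -> : 32 * K * B ^+ 2 * rho * d0 = 16 * K * B ^+ 2 * rho * d0 * 2 by ring.
    apply: ler_wpM2l; first by nonneg.
    by apply: geo_le2; rewrite Brho !mulr_ge0 // ltW.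
  apply: ler_sum => d _.
  apply: (@le_trans _ _ (\sum_(i < d.+3) K * B ^+ d.+2 * rho ^+ d.+1 * d0 * 2 ^+ d.+2)).
    apply: ler_sum => i _; have id : (i <= d.+2)%N by rewrite -ltnS.
    have [->|/prednK j0] := posnP (d.+2 - i)%N.
      by rewrite mulr0n !mulr0; nonneg.
    have E : (d.+1 = i + (d.+2 - i).-1)%N by lia.
    have -> : `|c i (d.+2 - i)%N| * rho ^+ i * (d0 * (rho ^+ (d.+2 - i).-1 *+ (d.+2 - i))) =
       `|c i (d.+2 - i)%N| * rho ^+ d.+1 * d0 * (d.+2 - i)%:R.
      have -> : rho ^+ d.+1 = rho ^+ i * rho ^+ (d.+2 - i).-1 by rewrite -exprD -E.
      by rewrite -[_ *+ (d.+2 - i)]mulr_natr; ring.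
    rewrite ler_pM ?mulr_ge0 ?exprn_ge0 // ?(ler_wpM2r) ?exprn_ge0 //.
      by have := cb i (d.+2 - i)%N; rewrite subnKC.
    apply: le_trans (ltn_2exp d.+2); rewrite ler_nat; lia.
  rewrite sumr_const card_ord -[leLHS]mulr_natr.
  have -> : 16 * K * B ^+ 2 * rho * d0 * (4 * B * rho) ^+ d =
     K * B ^+ d.+2 * rho ^+ d.+1 * d0 * 2 ^+ d.+2 * 2 ^+ d.+2.
    have -> : 4 = 2 * 2 :> R by ring.
    by rewrite !exprMn !exprS; ring.
  apply: ler_wpM2l; first by nonneg.
  exact: (ltn_2exp d.+2).
apply: (@fn_ext _ _ _ (fun h => \sum_(d < D) \sum_(i < d.+3)
   c i (d.+2 - i)%N * h ^+ i * (y h ^+ (d.+2 - i) - y' h ^+ (d.+2 - i)))).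
  move=> h; have E z : psum2 c h z D.+2 = c 0%N 0%N + (c 0%N 1%N * z + c 1%N 0%N * h) +
     \sum_(d < D) \sum_(i < d.+3) c i (d.+2 - i)%N * h ^+ i * z ^+ (d.+2 - i).
    rewrite /psum2 2!big_ord_recl /= big_ord1 /= !big_ord_recl big_ord0 /=.
    by rewrite !expr0 !expr1 !mulr1 addr0 addrA.
  rewrite !E.
  have -> : \sum_(d < D) \sum_(i < d.+3) c i (d.+2 - i)%N * h ^+ i * (y h ^+ (d.+2 - i) - y' h ^+ (d.+2 - i)) =
   \sum_(d < D) \sum_(i < d.+3) c i (d.+2 - i)%N * h ^+ i * y h ^+ (d.+2 - i) -
   \sum_(d < D) \sum_(i < d.+3) c i (d.+2 - i)%N * h ^+ i * y' h ^+ (d.+2 - i).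
    rewrite -sumrB; apply: eq_bigr => d _; rewrite -sumrB; apply: eq_bigr => i _.
    by rewrite mulrBr.
  ring.
apply: (fn_sum HN) => d; apply: (fn_sum HN) => i.
apply: (fn_mul HN); last exact: (fn_subX HN).
exact: (fn_mul HN (fn_cst HN _)).
Qed.

End InNorm.

Definition dcoef c i j : R := c i j.+1 *+ j.+1.

Lemma dcoef_bound c K B : coef_bound c K B -> coef_bound (dcoef c) (K * B) (2 * B).
Proof.
move=> [K0 B0 cB]; split; [by rewrite mulr_ge0 // ltW | by rewrite mulr_gt0 |].
move=> i j; rewrite /dcoef normrMn -[leLHS]mulr_natr.
have -> : K * B * (2 * B) ^+ (i + j) = K * B ^+ (i + j.+1) * 2 ^+ (i + j).
  by rewrite exprMn addnS exprS; ring.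
rewrite ler_pM //.
by apply: le_trans (ltn_2exp _) _; rewrite ler_weXn2l ?leq_addl // ler1n.
Qed.

Lemma pow_taylor (x y rho : R) j : `|x| <= rho -> `|y| <= rho ->
  `|x ^+ j.+1 - y ^+ j.+1 - (y ^+ j *+ j.+1) * (x - y)| <=
    (rho ^+ j.-1 *+ (j.+1 * j.+1)) * `|x - y| ^+ 2 * (0 < j)%:R.
Proof.
move=> xr yr; have r0 : 0 <= rho by apply: le_trans xr.
elim: j => [|j IH].
  by rewrite mulr0 expr0 mulr1n mul1r !expr1 subrr normr0.
have -> : x ^+ j.+2 - y ^+ j.+2 - (y ^+ j.+1 *+ j.+2) * (x - y) =
   (y ^+ j *+ j.+1) * (x - y) ^+ 2 +
   x * (x ^+ j.+1 - y ^+ j.+1 - (y ^+ j *+ j.+1) * (x - y)).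
  have -> : y ^+ j.+1 *+ j.+2 = y * (y ^+ j *+ j.+1) + y * y ^+ j.
    by rewrite exprS mulrSr mulrnAr.
  rewrite ![_ ^+ j.+2]exprS ![_ ^+ j.+1]exprS.
  by move: (y ^+ j *+ j.+1) (x ^+ j) (y ^+ j) => ? ? ?; ring.
apply: (le_trans (ler_normD _ _)); rewrite normrM normrMn !normrX [X in _ + X]normrM mulr1.
have H1 : `|y| ^+ j *+ j.+1 * `|x - y| ^+ 2 <= rho ^+ j *+ j.+1 * `|x - y| ^+ 2.
  by rewrite ler_wpM2r ?exprn_ge0 // lerMn2r lerXn2r ?nnegrE // orbT.
have H2 := ler_pM (normr_ge0 _) (normr_ge0 _) xr IH.
apply: le_trans (lerD H1 H2) _.
case: j {IH H1 H2} => [|j]; first by rewrite mulr0 mulr0 addr0 ler_wpM2r ?exprn_ge0 // ler_pMn2l.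
rewrite /= !mulr1 [rho * _]mulrA -mulrDl ler_wpM2r ?exprn_ge0 //.
rewrite mulrnAr -exprS -mulrnDr; apply: ler_wpMn2l; [by nonneg | lia].
Qed.

(** The Taylor estimates of the monomials, summed: this identifies the derivative
    with the sum of the series [dcoef c]. *)
Lemma fhat_deriv_bound c K B rho h k k' : coef_bound c K B ->
  16 * B * rho <= 1 -> `|h| <= rho -> `|k| <= rho -> `|k'| <= rho ->
  `|fhat c h k - fhat c h k' - fhat (dcoef c) h k' * (k - k')| <=
    16 * K * B ^+ 2 * `|k - k'| ^+ 2.
Proof.
move=> cB Br hr kr kr'; have [K0 B0 cb] := cB; have [_ B0' _] := dcoef_bound cB.
have r0 : 0 <= rho by apply: le_trans hr.
have L : (fun D => `|psum2 c h k D.+1 - psum2 c h k' D.+1 -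
    psum2 (dcoef c) h k' D * (k - k')|) @ \oo -->
   `|fhat c h k - fhat c h k' - fhat (dcoef c) h k' * (k - k')|.
  have Br' : 4 * B * rho <= 2^-1 by lra.
  apply: cvg_norm; apply: cvgB.
    apply: cvgB.
      by rewrite (@cvg_shiftS _ (psum2 c h k)); exact: (psum2_cvg cB Br').
    by rewrite (@cvg_shiftS _ (psum2 c h k')); exact: (psum2_cvg cB Br').
  apply: cvgM; last exact: cvg_cst.
  by apply: (psum2_cvg (dcoef_bound cB) (rho := rho)) => //; lra.
apply: (cvgr_to_le L); apply: nearW => D.
have -> : psum2 c h k D.+1 - psum2 c h k' D.+1 - psum2 (dcoef c) h k' D * (k - k') =
  \sum_(d < D) \sum_(i < d.+1) c i (d - i).+1 * h ^+ i *
    (k ^+ (d - i).+1 - k' ^+ (d - i).+1 - (k' ^+ (d - i) *+ (d - i).+1) * (k - k')).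
  have E z : psum2 c h z D.+1 = c 0%N 0%N + \sum_(d < D) (c d.+1 0%N * h ^+ d.+1 +
     \sum_(i < d.+1) c i (d - i).+1 * h ^+ i * z ^+ (d - i).+1).
    pose H d := \sum_(i < d.+1) c i (d - i)%N * h ^+ i * z ^+ (d - i).
    rewrite -[LHS]/(\sum_(d < D.+1) H d) big_ord_recl {1}/H big_ord1 !expr0 !mulr1.
    congr (_ + _); apply: eq_bigr => d _; rewrite lift0 /H big_ord_recr /= subnn expr0 mulr1 addrC.
    congr (_ + _); apply: eq_bigr => i _.
    by rewrite subSn // -ltnS.
  rewrite !E /psum2 mulr_suml opprD addrACA subrr add0r -!sumrB; apply: eq_bigr => d _.
  rewrite opprD addrACA subrr add0r -!sumrB mulr_suml -sumrB; apply: eq_bigr => i _.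
  rewrite /dcoef -(mulr_natr (c _ _)) -(mulr_natr (k' ^+ _)); ring.
pose G (d : nat) := \sum_(i < d.+1) c i (d - i).+1 * h ^+ i *
    (k ^+ (d - i).+1 - k' ^+ (d - i).+1 - (k' ^+ (d - i) *+ (d - i).+1) * (k - k')).
rewrite -[X in `|X|]/(\sum_(d < D) G d).
have G0 : G 0%N = 0.
  by rewrite /G big_ord1 /= !expr1 !expr0 mulr1n mul1r subrr mulr0.
have GS d : `|G d.+1| <= 8 * K * B ^+ 2 * `|k - k'| ^+ 2 * (8 * B * rho) ^+ d.
  apply: (le_trans (ler_norm_sum _ _ _)).
  apply: (@le_trans _ _ (\sum_(i < d.+2) K * B ^+ d.+2 * rho ^+ d * `|k - k'| ^+ 2 * (2 ^+ d.+1 * 2 ^+ d.+1))).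
    apply: ler_sum => i _; have id : (i <= d.+1)%N by rewrite -ltnS.
    rewrite normrM; have := pow_taylor (d.+1 - i) kr kr'.
    have [E|j0] := posnP (d.+1 - i)%N.
      rewrite E mulr0 normr_le0 => /eqP ->; rewrite normr0 mulr0; nonneg.
    rewrite mulr1 => H; apply: le_trans (ler_wpM2l (normr_ge0 _) H) _.
    rewrite normrM normrX.
    have -> : rho ^+ d = rho ^+ i * rho ^+ (d.+1 - i).-1.
      by rewrite -exprD; congr (_ ^+ _); lia.
    have Hc : `|c i (d.+1 - i).+1| <= K * B ^+ d.+2.
      by have := cb i (d.+1 - i).+1; rewrite addnS subnKC.
    have H2 : ((d.+1 - i).+1%:R : R) <= 2 ^+ d.+1.
      by apply: le_trans (ltn_2exp _); rewrite ler_nat; lia.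
    have Hh : `|h| ^+ i <= rho ^+ i by rewrite lerXn2r ?nnegrE.
    have H3 : (((d.+1 - i).+1 * (d.+1 - i).+1)%:R : R) <= 2 ^+ d.+1 * 2 ^+ d.+1.
      by rewrite natrM ler_pM.
    rewrite -[rho ^+ _ *+ _]mulr_natr.
    have Z0 : 0 <= rho ^+ (d.+1 - i).-1 * `|k - k'| ^+ 2 by nonneg.
    have Hch := ler_pM (normr_ge0 _) (exprn_ge0 i (normr_ge0 h)) Hc Hh.
    have P := ler_wpM2r Z0 (ler_pM (mulr_ge0 (normr_ge0 _) (exprn_ge0 i (normr_ge0 h))) (ler0n _ _) Hch H3).
    apply: le_trans (le_trans P _); rewrite le_eqVlt; apply/orP; left; apply/eqP; ring.
  rewrite sumr_const card_ord -[leLHS]mulr_natr.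
  have -> : 8 * K * B ^+ 2 * `|k - k'| ^+ 2 * (8 * B * rho) ^+ d =
     K * B ^+ d.+2 * rho ^+ d * `|k - k'| ^+ 2 * (2 ^+ d.+1 * 2 ^+ d.+1) * 2 ^+ d.+1.
    have -> : 8 = 2 * 2 * 2 :> R by ring.
    by rewrite !exprMn !exprS; ring.
  apply: ler_wpM2l; first by nonneg.
  exact: (ltn_2exp d.+1).
apply: (le_trans (ler_norm_sum _ _ _)).
case: D {L} => [|D]; first by rewrite big_ord0; nonneg.
rewrite big_ord_recl G0 normr0 add0r.
apply: (@le_trans _ _ (\sum_(d < D) 8 * K * B ^+ 2 * `|k - k'| ^+ 2 * (8 * B * rho) ^+ d)).
  by apply: ler_sum => d _; rewrite lift0.
rewrite -mulr_sumr.
have -> : 16 * K * B ^+ 2 * `|k - k'| ^+ 2 = 8 * K * B ^+ 2 * `|k - k'| ^+ 2 * 2 by ring.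
apply: ler_wpM2l; first by nonneg.
apply: geo_le2; apply/andP; split; last lra.
by nonneg.
Qed.

End DoubleSeries.

(** * Analytic families of functions *)

Section Families.
Context {R : realType}.
Implicit Types (I : set R) (f : R -> R -> R) (c : nat -> nat -> R) (e s eta : R).

(** A representation by one double series around [(e, s)], on a square small
    enough for the estimates on double series to apply. *)
Definition srep I f e s c K B del :=
  [/\ coef_bound c K B, 0 < del, 16 * B * del <= 1 &
   forall e' s', I e' -> `|e' - e| <= del -> `|s' - s| <= del ->
     f e' s' = fhat c (e' - e) (s' - s)].

Definition family_series I f := forall e s, I e ->
  exists c K B del, srep I f e s c K B del.

Definition jcont I f := forall e s, I e -> forall eta, 0 < eta ->
  exists2 d, 0 < d & forall e' s', I e' -> `|e' - e| < d -> `|s' - s| < d ->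
    `|f e' s' - f e s| < eta.

Lemma summable_bound (T : choiceType) (F : T -> R) :
  summable [set: T] (fun x => (F x)%:E) -> exists M, forall x, `|F x| <= M.
Proof.
rewrite /summable; set S := esum _ _ => S1.
have S0 : (0 <= S)%E by apply: esum_ge0 => x _; exact: abse_ge0.
exists (fine S) => x; rewrite -lee_fin fineK; last by rewrite ge0_fin_numE.
apply: esum_ge; exists [set x]%classic; first by rewrite /fsets /=; split.
by rewrite fsbig_set1.
Qed.

(** The terms of a summable family are bounded; at a point off the axes this bounds
    the coefficients geometrically. *)
Lemma analytic_series I f :
  analytic_on (I `*` setT) (fun p => f p.1 p.2) -> family_series I f.
Proof.
move=> an e s Ie; have [//|c [r [r0 sm cv]]] := an (e, s).
have hr2 : `|r / 2| < r by rewrite gtr0_norm; lra.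
have [M HM] := summable_bound (sm (r / 2) (r / 2) hr2 hr2).
have M0 : 0 <= M by apply: le_trans (HM (0, 0)%N).
exists c, M, (2 / r), (r / 64).
have r20 : 0 < 2 / r by rewrite divr_gt0.
split=> //; [split=> // i j| lra | |].
- have := HM (i, j) => /=; rewrite -mulrA -exprD normrM => H.
  have -> : 2 / r = (r / 2)^-1 by rewrite invf_div.
  rewrite exprVn ler_pdivlMr ?exprn_gt0 //; last lra.
  by rewrite -[X in _ * X]ger0_norm // exprn_ge0 //; lra.
- have -> : 16 * (2 / r) * (r / 64) = 2^-1 by field; rewrite gt_eqF.
  lra.
move=> e' s' Ie' he hs.
have L := cv (e', s') (conj Ie' Logic.I) _ _ => /=.
rewrite /fhat; apply/esym/cvg_lim => //.
have -> : psum2 c (e' - e) (s' - s) = series (fun d : nat => \sum_(i < d.+1)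
          c i (d - i)%N * (e' - e) ^+ i * (s' - s) ^+ (d - i)).
  by apply/funext => D; rewrite /psum2 /series /= big_mkord.
by apply: L => /=; [apply: le_lt_trans he _ | apply: le_lt_trans hs _]; lra.
Qed.

Lemma is_derive_quad (f : R -> R) a D C d : 0 < d ->
  (forall x, `|x - a| < d -> `|f x - f a - D * (x - a)| <= C * `|x - a| ^+ 2) ->
  is_derive a 1 f D.
Proof.
move=> d0 H; apply/is_derive1_caratheodory.
pose g z := if z == a then D else (f z - f a) / (z - a).
exists g; split; last by rewrite /g eqxx.
- move=> z; rewrite /g; case: eqVneq => [->|za]; first by rewrite !subrr mulr0.
  by rewrite divfK // subr_eq0.
have ga : g a = D by rewrite /g eqxx.
apply/cvgrPdist_le => eps eps0; rewrite ga.
have C1 : 0 < `|C| + 1 by rewrite ltr_wpDl.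
near=> z; rewrite /g; case: eqVneq => [_|za]; first by rewrite subrr normr0 ltW.
have za0 : 0 < `|z - a| by rewrite normr_gt0 subr_eq0.
have -> : D - (f z - f a) / (z - a) = - ((f z - f a - D * (z - a)) / (z - a)).
  by field; rewrite subr_eq0.
have zd : `|z - a| < Num.min d (eps / (`|C| + 1)).
  by near: z; apply: near_dist; rewrite lt_min d0 divr_gt0.
rewrite lt_min in zd; have /andP[zd1 zd2] := zd.
rewrite normrN normf_div ler_pdivrMr //; apply: le_trans (H z zd1) _.
rewrite expr2 mulrA; apply: ler_wpM2r; first exact: ltW.
rewrite ltr_pdivlMr // mulrC in zd2; apply: le_trans (ltW zd2).
by rewrite ler_wpM2r // (le_trans (ler_norm C)) // lerDl.
Unshelve. all: by end_near. Qed.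

Lemma srep_deriv I f e s c K B del e' s' : srep I f e s c K B del ->
  I e' -> `|e' - e| <= del -> `|s' - s| < del ->
  is_derive s' 1 (f e') (fhat (dcoef c) (e' - e) (s' - s)).
Proof.
move=> [cB d0 Bd Hf] Ie' he hs.
apply: (@is_derive_quad _ _ _ (16 * K * B ^+ 2) (del - `|s' - s|)); first by rewrite subr_gt0.
move=> x hx.
have xs : `|x - s| <= del.
  have -> : x - s = (x - s') + (s' - s) by ring.
  by rewrite (le_trans (ler_normD _ _)) // -lerBrDr ltW.
rewrite (Hf e' x) // (Hf e' s') ?(ltW hs) //.
have -> : x - s' = (x - s) - (s' - s) by ring.
exact: (fhat_deriv_bound cB Bd he xs (ltW hs)).
Qed.

Definition dpar f : R -> R -> R := fun e s => (f e)^`()%classic s.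

Lemma srep_dpar I f e s c K B del : srep I f e s c K B del ->
  srep I (dpar f) e s (dcoef c) (K * B) (2 * B) (del / 2).
Proof.
move=> H; have [cB d0 Bd Hf] := H; split; [exact: dcoef_bound| lra | lra |].
move=> e' s' Ie' he hs; rewrite /dpar derive1E.
have h1 : `|e' - e| <= del by lra.
have h2 : `|s' - s| < del by lra.
exact: (derive_val (is_derive := srep_deriv H Ie' h1 h2)).
Qed.

(** Termwise differentiation: velocities are again analytic families, and can be
    treated as the curves themselves. *)
Lemma family_dpar I f : family_series I f -> family_series I (dpar f).
Proof.
move=> Hf e s Ie; have [c [K [B [del H]]]] := Hf e s Ie.
by exists (dcoef c), (K * B), (2 * B), (del / 2); exact: srep_dpar.
Qed.

Lemma family_derive I f (e s : R) : family_series I f -> I e ->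
  is_derive s 1 (f e) (dpar f e s).
Proof.
move=> Hf Ie; have [c [K [B [del H]]]] := Hf e s Ie; have [_ d0 _ _] := H.
have h1 : `|e - e| <= del by rewrite subrr normr0 ltW.
have h2 : `|s - s| < del by rewrite subrr normr0.
have D := srep_deriv H Ie h1 h2.
rewrite /dpar derive1E; apply: DeriveDef => //; exact: ex_derive.
Qed.

Lemma family_jcont I f : family_series I f -> jcont I f.
Proof.
move=> Hf e s Ie eta eta0; have [c [K [B [del H]]]] := Hf e s Ie.
have [cB d0 Bd Hfe] := H; have [K0 B0 _] := cB.
have M0 : 0 <= 16 * K * B by nonneg.
exists (Num.min del (eta / (16 * K * B + 1))).
  by rewrite lt_min d0 divr_gt0 // ltr_wpDl.
move=> e' s' Ie'; rewrite !lt_min => /andP[he1 he2] /andP[hs1 hs2].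
pose d := Num.min del (eta / (16 * K * B + 1)).
have hd : `|e' - e| < d by rewrite lt_min he1.
have hsd : `|s' - s| <= d by rewrite le_min !ltW.
have dd : d <= del by rewrite ge_min lexx.
have d00 : 0 <= d by apply: le_trans hsd.
have dB : 4 * B * d <= 2^-1.
  have : B * d <= B * del by rewrite ler_wpM2l // ltW.
  lra.
have d1 : 0 < d by rewrite lt_min d0 divr_gt0 // ltr_wpDl.
have E0 : `|0 : R| < d by rewrite normr0.
have A1 := fhat_near (fnorm_at hd) cB (lexx d) dB d00 (y := fun=> s' - s) hsd.
have A2 := fhat_near (fnorm_at E0) cB (lexx d) dB d00 (y := fun=> 0).
rewrite /= normr0 in A1 A2; have {}A2 := A2 d00.
rewrite (Hfe e' s') ?(ltW he1) ?(ltW hs1) // (Hfe e s) ?subrr ?normr0 ?(ltW d0) //.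
have -> : fhat c (e' - e) (s' - s) - fhat c 0 0 =
  (fhat c (e' - e) (s' - s) - c 0%N 0%N) - (fhat c 0 0 - c 0%N 0%N) by ring.
apply: (le_lt_trans (ler_normB _ _)); apply: (le_lt_trans (lerD A1 A2)).
have : d * (16 * K * B + 1) <= eta.
  by rewrite -ler_pdivlMr ?ltr_wpDl // ge_min lexx orbT.
lra.
Qed.

End Families.

(** * Strict differentiability and the implicit function theorem *)

Section StrictDiff.
Context {R : realType}.
Implicit Types (phi psi : R -> (nat -> R) -> R) (Lam : (nat -> R) -> R)
  (K rho : R).

(** Strict differentiability at the origin of the functions [y |-> phi h y] of
    finitely many unknowns, in quantitative form: on the ball of radius [rho],
    increments agree with the linear part [Lam] up to a Lipschitz constant
    [K * rho]. The estimate is asked in all the algebras at once, so that it is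
    stable under ring operations and drives a contraction in each of them. *)
Definition strict_diff_at K rho0 phi (p0 : R) Lam :=
  forall Dom r NN, fnorm Dom r NN -> forall rho, r <= rho -> 0 <= rho -> rho <= rho0 ->
  (forall y : nat -> R -> R, (forall i, NN rho (y i)) ->
     NN (K * rho) (fun h => phi h (y^~ h) - p0)) /\
  (forall (y y' : nat -> R -> R) d, 0 <= d -> (forall i, NN rho (y i)) -> (forall i, NN rho (y' i)) ->
     (forall i, NN d (fun h => y i h - y' i h)) ->
     NN (K * rho * d) (fun h => phi h (y^~ h) - phi h (y'^~ h) -
                               Lam (fun i => y i h - y' i h)) /\
     NN (K * d) (fun h => Lam (fun i => y i h - y' i h))).

Definition strict_diff phi p0 Lam := exists K rho0,
  [/\ 0 <= K, 0 < rho0, rho0 <= 1 & strict_diff_at K rho0 phi p0 Lam].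

Lemma strict_diff_at_le K K' rho0 rho1 phi p0 Lam : K <= K' -> rho1 <= rho0 ->
  strict_diff_at K rho0 phi p0 Lam -> strict_diff_at K' rho1 phi p0 Lam.
Proof.
move=> KK rr H Dom r NN HN rho r1 r2 r3.
have [H1 H2] := H Dom r NN HN rho r1 r2 (le_trans r3 rr); split.
  by move=> y Hy; apply: (fn_le HN _ (H1 y Hy)); rewrite ler_wpM2r.
move=> y y' d d0 Hy Hy' Hd; have [A B] := H2 y y' d d0 Hy Hy' Hd; split.
  by apply: (fn_le HN _ A); rewrite !ler_wpM2r.
by apply: (fn_le HN _ B); rewrite !ler_wpM2r.
Qed.

Lemma strict_diff_ext phi psi p0 Lam Lam' : strict_diff phi p0 Lam ->
  (forall h y, phi h y = psi h y) -> (forall d, Lam d = Lam' d) ->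
  strict_diff psi p0 Lam'.
Proof.
move=> H E1 E2; have -> : psi = phi by apply/funext => h; apply/funext => y.
by have -> : Lam' = Lam by apply/funext => d.
Qed.

Lemma strict_diff_base c K B i : coef_bound c K B ->
  strict_diff (fun h y => fhat c h (y i)) (c 0%N 0%N) (fun d => c 0%N 1%N * d i).
Proof.
move=> cB; have [K0 B0 _] := cB.
exists (8 * K * B + 32 * K * B ^+ 2 + `|c 0%N 1%N|), (Num.min 1 (8 * B)^-1).
have p1 : 0 <= 8 * K * B by nonneg.
have p2 : 0 <= 32 * K * B ^+ 2 by nonneg.
have p3 := normr_ge0 (c 0%N 1%N).
split; [by rewrite !addr_ge0 | by rewrite lt_min invr_gt0; lra | by rewrite ge_min lexx |].
move=> Dom r NN HN rho r1 r2 r3.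
have Br : 4 * B * rho <= 2^-1.
  have : rho <= (8 * B)^-1 by apply: le_trans r3 _; rewrite ge_min lexx orbT.
  rewrite -ler_pdivlMl; last lra.
  by move/le_trans; apply; rewrite -invfM lef_pV2 ?posrE; lra.
split=> [y Hy|y y' d d0 Hy Hy' Hd].
  apply: (fn_le HN) (fhat_near HN cB r1 Br r2 (Hy i)).
  by rewrite ler_wpM2r // -addrA lerDl addr_ge0.
split.
  apply: (fn_le HN) (fhat_diff HN cB r1 Br r2 (Hy i) (Hy' i) d0 (Hd i)).
  by rewrite ler_wpM2r // ler_wpM2r // -addrAC lerDr addr_ge0.
apply: (fn_le HN) (fn_scale HN (c 0%N 1%N) (Hd i)).
by rewrite ler_wpM2r // lerDr addr_ge0.
Qed.

Lemma strict_diff_opp phi p0 Lam : strict_diff phi p0 Lam ->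
  strict_diff (fun h y => - phi h y) (- p0) (fun d => - Lam d).
Proof.
move=> [K [rho0 [K0 r0 r1 H]]]; exists K, rho0; split=> //.
move=> Dom r NN HN rho q1 q2 q3.
have [H1 H2] := H Dom r NN HN rho q1 q2 q3; split.
  by move=> y Hy; apply: fn_ext (fn_opp HN (H1 y Hy)) => h; ring.
move=> y y' d d0 Hy Hy' Hd; have [A B] := H2 y y' d d0 Hy Hy' Hd; split.
  by apply: fn_ext (fn_opp HN A) => h; ring.
exact: (fn_opp HN B).
Qed.

Lemma strict_diff_add phi p0 Lam psi q0 Mu :
  strict_diff phi p0 Lam -> strict_diff psi q0 Mu ->
  strict_diff (fun h y => phi h y + psi h y) (p0 + q0) (fun d => Lam d + Mu d).
Proof.
move=> [K [rho0 [K0 r0 r1 H]]] [K' [rho0' [K0' r0' r1' H']]].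
exists (K + K'), (Num.min rho0 rho0').
split; [by rewrite addr_ge0 | by rewrite lt_min r0 | by rewrite ge_min r1 |].
move=> Dom r NN HN rho q1 q2; rewrite le_min => /andP[q3 q3'].
have [H1 H2] := H Dom r NN HN rho q1 q2 q3.
have [H1' H2'] := H' Dom r NN HN rho q1 q2 q3'; split.
  move=> y Hy; rewrite mulrDl.
  by apply: fn_ext (fn_add HN (H1 y Hy) (H1' y Hy)) => h; ring.
move=> y y' d d0 Hy Hy' Hd; have [A B] := H2 y y' d d0 Hy Hy' Hd.
have [A' B'] := H2' y y' d d0 Hy Hy' Hd; split.
  by rewrite !mulrDl; apply: fn_ext (fn_add HN A A') => h; ring.
by rewrite mulrDl; exact: (fn_add HN B B').
Qed.

Lemma strict_diff_mul phi p0 Lam psi q0 Mu :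
  strict_diff phi p0 Lam -> strict_diff psi q0 Mu ->
  strict_diff (fun h y => phi h y * psi h y) (p0 * q0)
    (fun d => p0 * Mu d + q0 * Lam d).
Proof.
move=> [K [rho0 [K0 r0 r1 H]]] [K' [rho0' [K0' r0' r1' H']]].
exists (`|p0| * K' + `|q0| * K + 4 * (K * K')), (Num.min rho0 rho0').
have KK : 0 <= K * K' by nonneg.
split; [by rewrite !addr_ge0 ?mulr_ge0 | by rewrite lt_min r0 | by rewrite ge_min r1 |].
move=> Dom r NN HN rho q1 q2; rewrite le_min => /andP[q3 q3'].
have rho1 : rho <= 1 by apply: le_trans r1.
have rhorho : rho * rho <= rho by rewrite ler_piMr.
have [H1 H2] := H Dom r NN HN rho q1 q2 q3.
have [H1' H2'] := H' Dom r NN HN rho q1 q2 q3'; split.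
  move=> y Hy; have A := H1 y Hy; have A' := H1' y Hy.
  have P := fn_add HN (fn_add HN (fn_scale HN p0 A') (fn_scale HN q0 A)) (fn_mul HN A A').
  apply: fn_ext (fn_le HN _ P) => [h|]; first by ring.
  have -> : K * rho * (K' * rho) = (K * K') * (rho * rho) by ring.
  have := ler_wpM2l KK rhorho; have := mulr_ge0 KK q2; lra.
move=> y y' d d0 Hy Hy' Hd; have [A B] := H2 y y' d d0 Hy Hy' Hd.
have [A' B'] := H2' y y' d d0 Hy Hy' Hd; split; last first.
  apply: (fn_le HN _ (fn_add HN (fn_scale HN p0 B') (fn_scale HN q0 B))).
  have := mulr_ge0 KK d0; lra.
have AB := fn_add HN A B; have AB' := fn_add HN A' B'.
have P := fn_add HN (fn_add HN (fn_scale HN q0 A) (fn_scale HN p0 A'))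
  (fn_add HN (fn_mul HN AB (H1' y Hy)) (fn_mul HN (H1 y' Hy') AB')).
apply: fn_ext (fn_le HN _ P) => [h|]; first by ring.
have e1 : K * rho * d + K * d <= 2 * (K * d).
  have : K * d * rho <= K * d * 1 by rewrite ler_wpM2l // mulr_ge0.
  lra.
have e2 : K' * rho * d + K' * d <= 2 * (K' * d).
  have : K' * d * rho <= K' * d * 1 by rewrite ler_wpM2l // mulr_ge0.
  lra.
have f1 : 0 <= K' * rho by nonneg.
have f2 : 0 <= K * rho by nonneg.
have := ler_wpM2r f1 e1; have := ler_wpM2l f2 e2; lra.
Qed.

Lemma strict_diff_unif N (phi : nat -> R -> (nat -> R) -> R) (Lam : nat -> (nat -> R) -> R) :
  (forall j, (j < N)%N -> strict_diff (phi j) 0 (Lam j)) ->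
  exists K rho0, [/\ 0 <= K, 0 < rho0, rho0 <= 1 &
    forall j, (j < N)%N -> strict_diff_at K rho0 (phi j) 0 (Lam j)].
Proof.
elim: N => [|N IH] H; first by exists 0, 1.
have [j jN|K [rho0 [K0 r0 r1 HK]]] := IH; first by apply: H; exact: ltnW.
have [K' [rho0' [K0' r0' r1' HK']]] := H N (ltnSn N).
exists (Num.max K K'), (Num.min rho0 rho0').
split; [by rewrite le_max K0 | by rewrite lt_min r0 | by rewrite ge_min r1 |].
move=> j; rewrite ltnS leq_eqVlt => /orP[/eqP ->|jN].
  by apply: strict_diff_at_le HK'; rewrite ?le_max ?ge_min lexx orbT.
by apply: strict_diff_at_le (HK j jN); rewrite ?le_max ?ge_min lexx.
Qed.

Lemma geometric_cvg (u : nat -> R) C :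
  (forall k, `|u k.+1 - u k| <= C * 2^-1 ^+ k) ->
  exists l, u @ \oo --> l /\ forall k, `|l - u k| <= 2 * C * 2^-1 ^+ k.
Proof.
move=> H.
have cv : cvgn u.
  have -> : u = (fun n => u 0%N + series (telescope u) n).
    by apply/funext => n; rewrite -eq_sum_telescope.
  apply: is_cvgD; first exact: is_cvg_cst.
  apply: normed_cvg; apply: (@series_le_cvg _ _ (geometric C 2^-1)) => [k|k|k|].
  - exact: normr_ge0.
  - exact: le_trans (H k).
  - exact: H.
  by apply: is_cvg_geometric_series; rewrite ger0_norm; lra.
exists (limn u); split=> // k.
have B m : `|u (k + m)%N - u k| <= 2 * C * 2^-1 ^+ k.
  have C0 : 0 <= C by have := H 0%N; rewrite expr0 mulr1; apply: le_trans.
  suff : `|u (k + m)%N - u k| <= 2 * C * (2^-1 ^+ k - 2^-1 ^+ (k + m)).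
    move=> /le_trans; apply; rewrite ler_wpM2l ?mulr_ge0 // gerBl exprn_ge0 //.
  elim: m => [|m IH]; first by rewrite addn0 !subrr mulr0 normr0.
  have -> : u (k + m.+1)%N - u k = (u (k + m).+1 - u (k + m)%N) + (u (k + m)%N - u k).
    by rewrite addnS; ring.
  apply: (le_trans (ler_normD _ _)); apply: (le_trans (lerD (H _) IH)).
  rewrite addnS exprS; lra.
have L : (fun m => `|u (m + k)%N - u k|) @ \oo --> `|limn u - u k|.
  apply: cvg_norm; apply: cvgB; last exact: cvg_cst.
  by rewrite (@cvg_shiftn k _ u).
by apply: (cvgr_to_le L); apply: nearW => m; rewrite addnC.
Qed.

(** The unknowns [1 .. N] are solved for in terms of the unknown [0]; [M] inverts
    the linear parts restricted to the unknowns [1 .. N]. *)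
Section ImplicitFunction.
Variables (N : nat) (phi : nat -> R -> (nat -> R) -> R) (Lam : nat -> (nat -> R) -> R)
  (M : nat -> nat -> R).
Hypothesis Hphi : forall j, (j < N)%N -> strict_diff (phi j) 0 (Lam j).
Hypothesis LamD : forall j x y, Lam j (fun i => x i + y i) = Lam j x + Lam j y.
Hypothesis LamZ : forall j (a : R) x, Lam j (fun i => a * x i) = a * Lam j x.
Hypothesis MLam : forall d : nat -> R, d 0%N = 0 ->
  forall i, (0 < i <= N)%N -> d i = \sum_(j < N) M i j * Lam j d.
Hypothesis LamM : forall v : nat -> R, forall j, (j < N)%N ->
  Lam j (fun i => if (0 < i <= N)%N then \sum_(j < N) M i j * v j else 0) = v j.

Let CM : R := \sum_(i < N.+1) \sum_(j < N) `|M i j|.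

Let CM0 : 0 <= CM.
Proof. by rewrite /CM sumr_ge0 // => i _; rewrite sumr_ge0. Qed.

Let CM_row i : (i <= N)%N -> \sum_(j < N) `|M i j| <= CM.
Proof.
move=> iN; have := ltnS i N; rewrite iN => iN1.
rewrite /CM (bigD1 (Ordinal iN1)) //= lerDl sumr_ge0 // => k _.
by rewrite sumr_ge0.
Qed.

Lemma Lam0 j : Lam j (fun=> 0) = 0.
Proof. by have := LamZ j 0 (fun=> 0); rewrite mul0r mul0r. Qed.

(** Applied to the difference of two solutions, with the norm given by the value at
    a single [h], the inverse [M] bounds it by a small multiple of itself plus the
    contribution of the unknown [0]. *)
Lemma implicit_unique : exists rho K, [/\ 0 < rho, 0 <= K &
  forall h (y y' : nat -> R), `|h| < rho ->
    (forall i, `|y i| <= rho) -> (forall i, `|y' i| <= rho) ->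
    (forall i, (N < i)%N -> y i = y' i) ->
    (forall j, (j < N)%N -> phi j h y = 0) ->
    (forall j, (j < N)%N -> phi j h y' = 0) ->
    forall i, `|y i - y' i| <= K * `|y 0%N - y' 0%N|].
Proof.
have [K [rho0 [K0 r0 r1 HK]]] := strict_diff_unif Hphi.
pose rho : R := Num.min rho0 (2 * CM * K + 1)^-1.
pose e0 (i : nat) : R := (i == 0%N)%:R.
pose L0 : R := \sum_(j < N) `|Lam j e0|.
have L00 : 0 <= L0 by rewrite sumr_ge0.
have CK : 0 <= CM * K by nonneg.
have rho_gt0 : 0 < rho by rewrite lt_min r0 invr_gt0; lra.
exists rho, (2 * (1 + CM * L0)); split=> //; first by rewrite mulr_ge0 // addr_ge0 // mulr_ge0.
move=> h y y' hr yr yr' yy p1 p2.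
have CKr : CM * K * rho <= 2^-1.
  have : rho <= (2 * CM * K + 1)^-1 by rewrite ge_min lexx orbT.
  rewrite -[X in _ <= X]mul1r ler_pdivlMr; lra.
pose d i := y i - y' i.
pose S : R := \sum_(i < N.+1) `|d i|.
have dS i : `|d i| <= S.
  have [iN|iN] := leqP i N; last by rewrite /d yy // subrr normr0 sumr_ge0.
  have := ltnS i N; rewrite iN => iN1.
  by rewrite /S (bigD1 (Ordinal iN1)) //= lerDl sumr_ge0.
have S0 : 0 <= S by rewrite sumr_ge0.
have LS j : (j < N)%N -> `|Lam j d| <= K * rho * S.
  move=> jN.
  have rr : rho <= rho0 by rewrite ge_min lexx.
  have [_ H] := HK j jN _ _ _ (fnorm_at hr) rho (lexx _) (ltW rho_gt0) rr.
  have [] := H (fun i _ => y i) (fun i _ => y' i) S S0 yr yr' dS.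
  by rewrite /= p1 // p2 // subrr sub0r normrN.
have Sd : S <= `|d 0%N| + CM * (K * rho * S + L0 * `|d 0%N|).
  have SE : S = `|d 0%N| + \sum_(i < N) `|d i.+1|.
    by rewrite /S big_ord_recl; congr (_ + _); apply: eq_bigr => i _; rewrite lift0.
  have CME : CM = \sum_(j < N) `|M 0%N j| + \sum_(i < N) \sum_(j < N) `|M i.+1 j|.
    by rewrite /CM big_ord_recl; congr (_ + _); apply: eq_bigr => i _; rewrite lift0.
  rewrite {1}SE lerD2l CME mulrDl; apply: ler_wpDl.
    by apply: mulr_ge0; [exact: sumr_ge0 | rewrite addr_ge0 ?mulr_ge0 ?(ltW rho_gt0)].
  rewrite mulr_suml; apply: ler_sum => i _.
  pose dd (k : nat) := d k + - d 0%N * e0 k.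
  have -> : d i.+1 = dd i.+1 by rewrite /dd /e0 mulr0 addr0.
  rewrite (MLam (d := dd)); [|by rewrite /dd /e0 eqxx mulr1 subrr|by rewrite ltn_ord].
  apply: (le_trans (ler_norm_sum _ _ _)); rewrite mulr_suml; apply: ler_sum => j _.
  rewrite normrM ler_wpM2l // /dd LamD LamZ.
  apply: (le_trans (ler_normD _ _)); rewrite lerD ?LS // normrM normrN mulrC ler_wpM2r //.
  by rewrite /L0 (bigD1 j) //= lerDl sumr_ge0.
move=> i; apply: le_trans (dS i) _.
have : CM * K * rho * S <= 2^-1 * S by rewrite ler_wpM2r.
rewrite /d in Sd *; lra.
Qed.

(** Newton iteration with the fixed inverse [M], among the functions of [h] that are
    sums of power series. The iterates converge geometrically, and the limit is
    still a power series by [fn_lim]: the solution is analytic in [h]. *)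
Lemma implicit_exists : exists2 rho, 0 < rho & forall theta, 0 < theta -> theta <= rho ->
  exists del, [/\ 0 < del, del <= theta & forall s, `|s| <= del -> exists y : nat -> R -> R,
    [/\ forall i, ps del theta (y i), y 0%N = (fun=> s),
        forall i, (N < i)%N -> y i = (fun=> 0) &
        forall h, `|h| < del -> forall j, (j < N)%N -> phi j h (y^~ h) = 0]].
Proof.
have [K [rho0 [K0 r0 r1 HK]]] := strict_diff_unif Hphi.
pose rho : R := Num.min rho0 (2 * CM * K + 1)^-1.
have CK : 0 <= CM * K by nonneg.
have rho_gt0 : 0 < rho by rewrite lt_min r0 invr_gt0; lra.
exists rho => // theta t0 tr.
have tr0 : theta <= rho0 by apply: le_trans tr _; rewrite ge_min lexx.
pose del : R := theta / (1 + 2 * (CM * K)).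
have D1 : 0 < 1 + 2 * (CM * K) by lra.
have d0 : 0 < del by rewrite divr_gt0.
have dE : del + 2 * (CM * K * del) = theta.
  by rewrite /del; field; rewrite gt_eqF.
have CKd : 0 <= CM * K * del by rewrite mulr_ge0 // ltW.
have {D1} dth : del <= theta by rewrite -dE lerDl mulr_ge0.
clearbody del.
have CKr : CM * K * theta <= 2^-1.
  have : theta <= (2 * CM * K + 1)^-1 by apply: le_trans tr _; rewrite ge_min lexx orbT.
  rewrite -[X in _ <= X]mul1r ler_pdivlMr; lra.
exists del; split=> // s sd.
pose Phi (y : nat -> R -> R) (i : nat) (h : R) :=
  if (0 < i <= N)%N then y i h - \sum_(j < N) M i j * phi j h (y^~ h) else y i h.
pose y0 (i : nat) (h : R) := if i == 0%N then s else 0.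
pose Y k := iter k Phi y0.
have HP := fnorm_ps d0.
pose C : R := CM * K * del.
have C0 : 0 <= C by [].
have Msum i (F : nat -> R -> R) e : (0 < i <= N)%N -> 0 <= e ->
    (forall j, (j < N)%N -> ps del e (F j)) ->
    ps del (CM * e) (fun h => \sum_(j < N) M i j * F j h).
  move=> /andP[_ iN] e0 HF.
  apply: (fn_le HP (C := \sum_(j < N) `|M i j| * e)).
    by rewrite -mulr_suml ler_wpM2r // CM_row.
  apply: (fn_sum HP) => j; apply: (fn_scale HP); exact: HF.
have Yb k : (forall i, ps del (del + C * (2 - 2 * 2^-1 ^+ k)) (Y k i)) /\
     (forall i, ps del (C * 2^-1 ^+ k) (fun h => Y k.+1 i h - Y k i h)).
  elim: k => [|k [IH1 IH2]]; split.
  - move=> i; rewrite expr0 mulr1 subrr mulr0 addr0 /Y /= /y0.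
    case: (i == 0%N); last by apply: (fn_le HP _ (fn_0 HP)); exact: ltW.
    exact: (fn_le HP sd (fn_cst HP s)).
  - move=> i; rewrite expr0 mulr1 /Y /=; have [iN|iN] := boolP (0 < i <= N)%N; last first.
      by apply: fn_ext (fn_le HP C0 (fn_0 HP)) => h; rewrite /Phi (negbTE iN) subrr.
    have y0d i' : ps del del (y0 i').
      rewrite /y0; case: (i' == 0%N); last by apply: (fn_le HP _ (fn_0 HP)); exact: ltW.
      exact: (fn_le HP sd (fn_cst HP s)).
    have Q j : (j < N)%N -> ps del (K * del) (fun h => phi j h (y0^~ h)).
      move=> jN; have [A _] := HK j jN _ _ _ HP del (lexx _) (ltW d0) (le_trans dth tr0).
      by apply: fn_ext (A y0 y0d) => h; rewrite subr0.
    have Kd0 : 0 <= K * del by nonneg.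
    have := fn_opp HP (Msum i _ _ iN Kd0 Q).
    rewrite mulrA -/C; apply: fn_ext => h; rewrite /Phi iN; ring.
  - move=> i; have := fn_add HP (IH1 i) (IH2 i).
    have -> : del + C * (2 - 2 * 2^-1 ^+ k) + C * 2^-1 ^+ k =
      del + C * (2 - 2 * 2^-1 ^+ k.+1) by rewrite exprS; field.
    by apply: fn_ext => h; ring.
  have Yth k' i' : (forall i, ps del (del + C * (2 - 2 * 2^-1 ^+ k')) (Y k' i)) ->
      ps del theta (Y k' i').
    move=> H; apply: (fn_le HP _ (H i')); rewrite -dE lerD2l -/C mulrC ler_wpM2r //.
    by rewrite gerBl mulr_ge0 // exprn_ge0.
  have IH1' i : ps del (del + C * (2 - 2 * 2^-1 ^+ k.+1)) (Y k.+1 i).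
    have := fn_add HP (IH1 i) (IH2 i).
    have -> : del + C * (2 - 2 * 2^-1 ^+ k) + C * 2^-1 ^+ k =
      del + C * (2 - 2 * 2^-1 ^+ k.+1) by rewrite exprS; field.
    by apply: fn_ext => h; ring.
  move=> i.
  have E k' h : Y k'.+1 i h = Phi (Y k') i h by [].
  have [iN|iN] := boolP (0 < i <= N)%N; last first.
    have -> : (fun h => Y k.+2 i h - Y k.+1 i h) = (fun=> 0).
      by apply/funext => h; rewrite (E k.+1) /Phi (negbTE iN) subrr.
    by apply: (fn_le HP _ (fn_0 HP)); nonneg.
  pose e := C * 2^-1 ^+ k.
  have e0 : 0 <= e by nonneg.
  have Q j : (j < N)%N -> ps del (K * theta * e)
      (fun h => phi j h ((Y k.+1)^~ h) - phi j h ((Y k)^~ h) - Lam j (fun i => Y k.+1 i h - Y k i h)).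
    move=> jN; have [_ A] := HK j jN _ _ _ HP theta dth (ltW t0) tr0.
    by have [] := A (Y k.+1) (Y k) e e0 (fun i => Yth _ _ IH1') (fun i => Yth _ _ IH1) IH2.
  have Ke0 : 0 <= K * theta * e by nonneg.
  have := fn_opp HP (Msum i _ _ iN Ke0 Q).
  have le1 : CM * (K * theta * e) <= C * 2^-1 ^+ k.+1.
    have -> : C * 2^-1 ^+ k.+1 = 2^-1 * e by rewrite /e exprS; ring.
    have -> : CM * (K * theta * e) = CM * K * theta * e by ring.
    by rewrite ler_wpM2r.
  move=> /(fn_le HP le1); apply: fn_ext => h.
  have -> : - (\sum_(j < N) M i j * (phi j h ((Y k.+1)^~ h) - phi j h ((Y k)^~ h) - Lam j (fun i => Y k.+1 i h - Y k i h))) =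
     \sum_(j < N) M i j * Lam j (fun i => Y k.+1 i h - Y k i h) +
     (\sum_(j < N) M i j * phi j h ((Y k)^~ h) - \sum_(j < N) M i j * phi j h ((Y k.+1)^~ h)).
    rewrite -sumrB -big_split -sumrN; apply: eq_bigr => j _ /=; ring.
  rewrite -(MLam (d := fun i => Y k.+1 i h - Y k i h)) //; last first.
    by rewrite -[Y k.+1 0%N h]/(Phi (Y k) 0%N h) /Phi /= subrr.
  have EE : Y k.+1 i h - Y k i h = - \sum_(j < N) M i j * phi j h ((Y k)^~ h).
    by rewrite E /Phi iN; ring.
  rewrite EE (E k.+1) {1}/Phi iN; ring.
have Yth k i : ps del theta (Y k i).
  apply: (fn_le HP _ ((Yb k).1 i)); rewrite -dE lerD2l -/C mulrC ler_wpM2r //.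
  by rewrite gerBl mulr_ge0 // exprn_ge0.
have Y0 k h : Y k 0%N h = s by elim: k => [|k IH] //.
have YN k i h : (N < i)%N -> Y k i h = 0.
  move=> iN; elim: k => [|k IH]; first by rewrite /Y /= /y0; case: i iN.
  by rewrite -[Y k.+1 i h]/(Phi (Y k) i h) /Phi IH (leqNgt i N) iN andbF.
pose y (i : nat) (h : R) : R := limn (fun k => Y k i h).
have yP i h : `|h| < del -> (fun k => Y k i h) @ \oo --> y i h /\
    forall k, `|y i h - Y k i h| <= 2 * C * 2^-1 ^+ k.
  move=> hd; have [|l [ll lb]] := @geometric_cvg (fun k => Y k i h) C.
    by move=> k; exact: (fn_ev HP ((Yb k).2 i) hd).
  by rewrite /y (cvg_lim _ ll).
have ypt i : ps del theta (y i).
  by apply: (fn_lim HP (Yth^~ i)) => h hd; exact: (yP i h hd).1.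
exists y; split=> //.
- apply/funext => h; rewrite /y; under eq_fun do rewrite Y0; exact: lim_cst.
- move=> i iN; apply/funext => h; rewrite /y; under eq_fun do rewrite YN //; exact: lim_cst.
move=> h hd.
have hth : `|h| < theta by apply: lt_le_trans dth.
pose v j : R := phi j h (y^~ h).
have phiL j k : (j < N)%N -> `|v j - phi j h ((Y k)^~ h)| <= 4 * K * C * 2^-1 ^+ k.
  move=> jN; pose e := 2 * C * 2^-1 ^+ k.
  have e0 : 0 <= e by rewrite /e; nonneg.
  have [_ A] := HK j jN _ _ _ (fnorm_at hth) theta (lexx _) (ltW t0) tr0.
  have [] := A (fun i _ => y i h) (fun i _ => Y k i h) e e0.
  - by move=> i /=; exact: (fn_ev HP (ypt i) hd).
  - by move=> i /=; exact: (fn_ev HP (Yth k i) hd).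
  - by move=> i /=; exact: (yP i h hd).2.
  rewrite /= -/(v j); set a := phi j h _; set b := Lam j _ => H1 H2.
  have -> : v j - a = (v j - a - b) + b by ring.
  apply: (le_trans (ler_normD _ _)); apply: (le_trans (lerD H1 H2)).
  have Ke : 0 <= K * e by rewrite mulr_ge0.
  have th1 : theta <= 1 by apply: le_trans tr0 r1.
  have := ler_wpM2l Ke th1; rewrite /e; lra.
have Mv0 i : (0 < i <= N)%N -> \sum_(j < N) M i j * v j = 0.
  move=> iN; apply/eqP; rewrite -normr_le0.
  have B k : `|\sum_(j < N) M i j * v j| <= (CM * (4 * K * C) + C) * 2^-1 ^+ k.
    have -> : \sum_(j < N) M i j * v j = \sum_(j < N) M i j * (v j - phi j h ((Y k)^~ h)) +
        (Y k i h - Y k.+1 i h).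
      rewrite -[Y k.+1 i h]/(Phi (Y k) i h) /Phi iN subKr -big_split /=.
      by apply: eq_bigr => j _; ring.
    apply: (le_trans (ler_normD _ _)); rewrite mulrDl; apply: lerD; last first.
      by rewrite distrC; exact: (fn_ev HP ((Yb k).2 i) hd).
    apply: (le_trans (ler_norm_sum _ _ _)).
    apply: (@le_trans _ _ (\sum_(j < N) `|M i j| * (4 * K * C * 2^-1 ^+ k))).
      by apply: ler_sum => j _; rewrite normrM ler_wpM2l // phiL.
    rewrite -mulr_suml -[leRHS]mulrA; apply: ler_wpM2r.
      by apply: mulr_ge0; [apply: mulr_ge0 => //; nonneg | nonneg].
    by apply: CM_row; case/andP: iN.
  have L : (CM * (4 * K * C) + C) * 2^-1 ^+ k @[k --> \oo] --> (CM * (4 * K * C) + C) * 0.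
    by apply: cvgM; [exact: cvg_cst | apply: cvg_expr; rewrite ger0_norm; lra].
  by rewrite mulr0 in L; apply: (cvgr_to_ge L); exact: nearW.
move=> j jN; rewrite -/(v j) -(LamM v jN).
rewrite (_ : (fun i => _) = fun=> 0) ?Lam0 //.
by apply/funext => i; case: ifP => // /Mv0.
Qed.

End ImplicitFunction.
End StrictDiff.

(** * Strictly convex curves *)

Section Geometry.
Context {R : realType}.
Implicit Types (p q r : R * R) (A : set (R * R)) (g : R -> R * R).

Definition dot2 (u v : R * R) : R := u.1 * v.1 + u.2 * v.2.

Lemma derive_eps (f : R -> R) (s D : R) : is_derive s 1 f D -> forall eta, 0 < eta ->
  exists2 d, 0 < d & forall t, `|t| < d -> `|f (s + t) - f s - D * t| <= eta * `|t|.
Proof.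
move=> /is_derive1_caratheodory[G [GE Gc Gs]] eta eta0.
have /cvgrPdist_le/(_ eta eta0)/nearE_dist[d d0 H] := Gc.
exists d => // t td; have := H (s + t); rewrite addrAC subrr add0r => /(_ td).
rewrite Gs => H2; rewrite GE addrAC subrr add0r -mulrBl normrM ler_wpM2r //.
by rewrite distrC.
Qed.

Lemma det2_param (u v : R * R) : u != 0 -> det2 u v = 0 -> exists c, v = (c * u.1, c * u.2).
Proof.
case: u v => [u1 u2] [v1 v2]; rewrite /det2 /= => u0 H.
have [u10|u10] := eqVneq u1 0.
  have u20 : u2 != 0.
    by apply: contra u0 => /eqP ->; rewrite u10.
  exists (v2 / u2); move: H; rewrite u10 mul0r sub0r mulr0 divfK // => /eqP.
  by rewrite oppr_eq0 mulf_eq0 (negbTE u20) /= => /eqP ->.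
exists (v1 / u1); rewrite divfK //; congr (_, _).
have -> : v2 = (u1 * v2 - u2 * v1 + u2 * v1) / u1 by field.
by rewrite H add0r; field.
Qed.

Lemma subp_eq0 p q : (p - q == 0) = (p == q).
Proof. exact: subr_eq0. Qed.

(** What the analytic parametrizations of the family and the arc-length ones have
    in common. *)
Record convex_curve A g T : Prop := ConvexCurve {
  cc_dom : strictly_convex_bounded_domain A;
  cc_par : closed_parametrization A g T;
  cc_der1 : forall s : R, is_derive s 1 (fst \o g) (velocity g s).1;
  cc_der2 : forall s : R, is_derive s 1 (snd \o g) (velocity g s).2;
  cc_cont1 : continuous (fun s => (velocity g s).1);
  cc_cont2 : continuous (fun s => (velocity g s).2);
  cc_reg : forall s, velocity g s != 0 }.

Section Param.
Variables (A : set (R * R)) (g : R -> R * R) (T : R).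
Hypothesis cp : closed_parametrization A g T.

Lemma param_int s (k : int) : g (s + k%:~R * T) = g s.
Proof.
have [T0 per _ _] := cp.
have P n u : g (u + n%:R * T) = g u.
  elim: n u => [|n IH] u; first by rewrite mul0r addr0.
  by rewrite -natr1 mulrDl mul1r addrA per.
case: k => n; first exact: P.
have := P n.+1 (s + (Negz n)%:~R * T).
rewrite NegzE mulrNz mulNr -[(n.+1%:Z)%:~R]/(n.+1%:R) subrK => <-.
by rewrite ?subrK.
Qed.

Lemma param_eq s t : g s = g t -> exists k : int, t = s + k%:~R * T.
Proof.
have [T0 per inj _] := cp.
have red u : exists k : int, 0 <= u + k%:~R * T < T.
  exists (- Num.floor (u / T)); have /andP[f1 f2] := floor_itv (u / T).
  rewrite mulrNz mulNr.
  move: f1 f2; rewrite ler_pdivlMr // ltr_pdivrMr // intrD mulrDl mul1r.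
  by move=> f1 f2; apply/andP; split; lra.
have [k /andP[k1 k2]] := red s; have [l /andP[l1 l2]] := red t.
move=> E; have : s + k%:~R * T = t + l%:~R * T.
  apply: inj; [by rewrite in_itv /= k1 | by rewrite in_itv /= l1 | by rewrite !param_int].
move=> H; exists (k - l); rewrite intrB mulrBl; lra.
Qed.

Lemma param_neq s t : s < t < s + T -> g s != g t.
Proof.
have [T0 _ _ _] := cp.
move=> /andP[h1 h2]; apply/eqP => /param_eq[k tE].
have k0 : 0 < k.
  rewrite -(ltr0z R); have : 0 < k%:~R * T by lra.
  by rewrite pmulr_lgt0.
have : k%:~R * T < 1 * T by lra.
rewrite ltr_pM2r // -[1]/(1%:~R) ltr_int; lia.
Qed.

Lemma param_dist s t : s <= t <= s + T -> g s = g t -> t = s \/ t = s + T.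
Proof.
move=> /andP[]; rewrite le_eqVlt => /orP[/eqP ->|st]; first by left.
rewrite le_eqVlt => /orP[/eqP ->|tT]; first by right.
by move=> /eqP; rewrite (negbTE (@param_neq s t _)) // st.
Qed.

Lemma param_bd s : boundary A (g s).
Proof. by have [_ _ _ <-] := cp; exists s. Qed.

End Param.

Section Convex.
Variable A : set (R * R).
Hypothesis hA : strictly_convex_bounded_domain A.

Lemma interior_dom : interior A = A.
Proof. by have [oA _ _ _ _] := hA; exact/interior_id. Qed.

Lemma bd_closure p : boundary A p -> closure A p.
Proof. by case. Qed.

Lemma bd_notin p : boundary A p -> ~ A p.
Proof. by case; rewrite interior_dom. Qed.

Lemma dom_seg p q t : closure A p -> closure A q -> p != q -> 0 < t < 1 ->
  A (segment_point t p q).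
Proof.
by have [_ _ _ _ sc] := hA; move=> ? ? ? ?; rewrite -interior_dom; exact: sc.
Qed.

(** Of three collinear points one lies strictly between the other two, hence in the
    interior. *)
Lemma bd_noncollinear p q r : boundary A p -> boundary A q -> boundary A r ->
  p != q -> p != r -> q != r -> det2 (q - p) (r - p) != 0.
Proof.
move=> bp bq br pq pr qr; apply/eqP => H.
have qp0 : q - p != 0 by rewrite subp_eq0 eq_sym.
have [c E] := det2_param qp0 H.
have E1 : r.1 = p.1 + c * (q.1 - p.1).
  by have := congr1 fst E => /= <-; rewrite addrC subrK.
have E2 : r.2 = p.2 + c * (q.2 - p.2).
  by have := congr1 snd E => /= <-; rewrite addrC subrK.
have c0 : c != 0.
  apply: contra pr => /eqP c0; apply/eqP; rewrite [p]surjective_pairing [r]surjective_pairing.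
  by rewrite E1 E2 c0 !mul0r !addr0.
have c1 : c != 1.
  apply: contra qr => /eqP c1; apply/eqP; rewrite [q]surjective_pairing [r]surjective_pairing.
  by rewrite E1 E2 c1 !mul1r ![p.1 + _]addrC ![p.2 + _]addrC !subrK.
have [clt0|cge0] := ltP c 0.
  apply: (bd_notin bp).
  have t01 : 0 < - c / (1 - c) < 1.
    by rewrite divr_gt0 ?ltr_pdivrMr //; lra.
  have := dom_seg (bd_closure bq) (bd_closure br) qr t01.
  rewrite [p]surjective_pairing /segment_point E1 E2; congr (A (_, _)); field; lra.
have cgt0 : 0 < c by rewrite lt_def c0.
have [clt1|cge1] := ltP c 1.
  apply: (bd_notin br).
  have t01 : 0 < c < 1 by rewrite cgt0.
  have := dom_seg (bd_closure bq) (bd_closure bp) _ t01.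
  rewrite eq_sym => /(_ pq).
  rewrite [r]surjective_pairing /segment_point E1 E2; congr (A (_, _)); ring.
have cgt1 : 1 < c by rewrite lt_def c1.
apply: (bd_notin bq).
have t01 : 0 < c^-1 < 1 by rewrite invr_gt0 cgt0 invf_lt1.
have := dom_seg (bd_closure br) (bd_closure bp) _ t01.
rewrite eq_sym => /(_ pr).
rewrite [q]surjective_pairing /segment_point E1 E2; congr (A (_, _)); field; lra.
Qed.

Lemma dom_nbhs p : A p -> exists2 d, 0 < d &
  forall q, `|q.1 - p.1| < d -> `|q.2 - p.2| < d -> A q.
Proof.
have [oA _ _ _ _] := hA; move=> Ap.
have : nbhs p A by exact: open_nbhs_nbhs.
move=> /nbhs_ballP[d /= d0 H]; exists d => // q q1 q2; apply: H.
by split; rewrite /ball /= distrC.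
Qed.

End Convex.

Lemma nonzero_sign (f : R -> R) a b : continuous f -> a <= b ->
  (forall x, a <= x <= b -> f x != 0) -> (0 < f a) = (0 < f b).
Proof.
move=> cf ab nz.
have K : ~ (Num.min (f a) (f b) <= 0 <= Num.max (f a) (f b)).
  move=> H; have [|x xab /eqP] := IVT ab _ H; first exact: continuous_subspaceT.
  by apply/negP; apply: nz; rewrite in_itv in xab.
have fa : f a != 0 by apply: nz; rewrite lexx.
have fb : f b != 0 by apply: nz; rewrite lexx ab.
case: (ltrgtP 0 (f a)) (fa) => // Ha _; case: (ltrgtP 0 (f b)) (fb) => // Hb _.
- by exfalso; apply: K; rewrite ge_min le_max (ltW Ha) (ltW Hb) orbT.
- by exfalso; apply: K; rewrite ge_min le_max (ltW Ha) (ltW Hb) orbT.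
Qed.

Lemma is_derive_continuous (f : R -> R) (D : R -> R) :
  (forall s : R, is_derive s 1 f (D s)) -> continuous f.
Proof.
move=> H s; apply: differentiable_continuous; apply/derivable1_diffP.
exact: (@ex_derive _ _ _ _ _ _ _ (H s)).
Qed.

Section Curve.
Variables (A : set (R * R)) (g : R -> R * R) (T : R).
Hypothesis cc : convex_curve A g T.
Let hA := cc_dom cc.
Let cp := cc_par cc.
Let T0 : 0 < T. Proof. by have [] := cp. Qed.

(** If the tangent line met the domain at [p], then, for small [t] of the suitable
    sign, the line through [g s] and [g (s + t)] would pass near [p], at a point
    [q] of the domain such that [g s] lies between [q] and [g (s + t)]: the
    boundary point [g s] would be in the interior. *)
Lemma tangent_avoids s p : A p -> det2 (velocity g s) (p - g s) != 0.
Proof.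
move=> Ap; apply/eqP => H.
have [c E] := det2_param (cc_reg cc s) H.
set v := velocity g s in H E.
have E1 : p.1 = (g s).1 + c * v.1.
  by have := congr1 fst E => /= <-; rewrite addrC subrK.
have E2 : p.2 = (g s).2 + c * v.2.
  by have := congr1 snd E => /= <-; rewrite addrC subrK.
have c0 : c != 0.
  apply/eqP => c0; apply: (bd_notin hA (param_bd cp s)).
  by rewrite [g s]surjective_pairing; move: Ap; rewrite [p]surjective_pairing E1 E2 c0 !mul0r !addr0.
have [d d0 Hd] := dom_nbhs hA Ap.
have eta0 : 0 < d / (2 * `|c|) by rewrite divr_gt0 // mulr_gt0 // normr_gt0.
have [d1 d10 D1] := derive_eps (cc_der1 cc s) eta0.
have [d2 d20 D2] := derive_eps (cc_der2 cc s) eta0.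
have m0 : 0 < Num.min d1 d2 by rewrite lt_min d10.
pose t := if 0 < c then - (Num.min d1 d2 / 2) else Num.min d1 d2 / 2.
have tn : `|t| = Num.min d1 d2 / 2.
  by rewrite /t; case: ifP => _; rewrite ?normrN gtr0_norm // divr_gt0.
have t1 : `|t| < d1.
  have : Num.min d1 d2 <= d1 by rewrite ge_min lexx.
  rewrite tn; lra.
have t2 : `|t| < d2.
  have : Num.min d1 d2 <= d2 by rewrite ge_min lexx orbT.
  rewrite tn; lra.
have tn0 : t != 0 by rewrite -normr_gt0 tn divr_gt0.
have ct : (0 < t) && (c < 0) || (t < 0) && (0 < c).
  rewrite /t; case: ifP => [c1|/negbT]; first by rewrite orbC oppr_lt0 divr_gt0.
  by rewrite -leNgt le_eqVlt (negbTE c0) /= => ->; rewrite divr_gt0.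
pose q : R * R := ((g s).1 + (c / t) * ((g (s + t)).1 - (g s).1),
                   (g s).2 + (c / t) * ((g (s + t)).2 - (g s).2)).
have bnd x D : `|x - D * t| <= d / (2 * `|c|) * `|t| -> `|c / t * x - c * D| < d.
  move=> H1; have -> : c / t * x - c * D = (c / t) * (x - D * t) by field.
  rewrite normrM normf_div.
  have H2 : 0 <= `|c| / `|t| by rewrite divr_ge0.
  apply: (le_lt_trans (ler_wpM2l H2 H1)).
  have -> : `|c| / `|t| * (d / (2 * `|c|) * `|t|) = d / 2.
    by field; rewrite !normr_eq0 tn0 c0.
  lra.
have Aq : A q.
  apply: Hd => /=.
    by rewrite E1 opprD addrACA subrr add0r; exact: bnd (D1 t t1).
  by rewrite E2 opprD addrACA subrr add0r; exact: bnd (D2 t t2).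
apply: (bd_notin hA (param_bd cp s)).
have bq := param_bd cp (s + t).
have qn : q != g (s + t) by apply/eqP => E3; apply: (bd_notin hA bq); rewrite -E3.
have l01 : 0 < t / (t - c) < 1.
  case/orP: ct => /andP[ct1 ct2].
    by rewrite divr_gt0 ?ltr_pdivrMr //; lra.
  have -> : t / (t - c) = (- t) / (c - t) by field; lra.
  by rewrite divr_gt0 ?ltr_pdivrMr //; lra.
have := dom_seg hA (subset_closure Aq) (bd_closure bq) qn l01.
have tc : t - c != 0.
  by case/orP: ct => /andP[ct1 ct2]; [rewrite gt_eqF //|rewrite lt_eqF //]; lra.
suff <- : g s = segment_point (t / (t - c)) q (g (s + t)) by [].
by rewrite [LHS]surjective_pairing /segment_point /q /=; congr (_, _); field; rewrite tn0 tc.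
Qed.

Lemma curve_cont1 : continuous (fun s => (g s).1).
Proof. exact: (is_derive_continuous (cc_der1 cc)). Qed.

Lemma curve_cont2 : continuous (fun s => (g s).2).
Proof. exact: (is_derive_continuous (cc_der2 cc)). Qed.

Lemma det2_cont (f1 f2 h1 h2 : R -> R) : continuous f1 -> continuous f2 ->
  continuous h1 -> continuous h2 -> continuous (fun s => det2 (f1 s, f2 s) (h1 s, h2 s)).
Proof.
by move=> c1 c2 c3 c4 s; apply: cvgB; apply: cvgM; [exact: c1|exact: c4|exact: c2|exact: c3].
Qed.

(** By [tangent_avoids] the determinant keeps its sign along the curve, and along
    the segment joining two points of the domain. *)
Lemma orientation : exists2 o : R, o = 1 \/ o = -1 &
  forall s p, A p -> 0 < o * det2 (velocity g s) (p - g s).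
Proof.
have [_ _ [p0 Ap0] _ _] := hA.
have S1 p s t : A p -> s <= t -> (0 < det2 (velocity g s) (p - g s)) = (0 < det2 (velocity g t) (p - g t)).
  move=> Ap st; apply: (nonzero_sign (f := fun s => det2 (velocity g s) (p - g s))) => //.
    apply: det2_cont; first exact: (cc_cont1 cc).
    - exact: (cc_cont2 cc).
    - by move=> x; apply: cvgB; [exact: cvg_cst | exact: curve_cont1].
    - by move=> x; apply: cvgB; [exact: cvg_cst | exact: curve_cont2].
  by move=> x _; exact: tangent_avoids.
have S1' p s t : A p -> (0 < det2 (velocity g s) (p - g s)) = (0 < det2 (velocity g t) (p - g t)).
  by move=> Ap; case: (leP s t) => st; [exact: S1 | apply/esym/S1 => //; exact: ltW].
have S2 s p q : A p -> A q -> 0 < det2 (velocity g s) (p - g s) -> 0 < det2 (velocity g s) (q - g s).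
  move=> Ap Aq Hp; rewrite ltNge; apply/negP; rewrite le_eqVlt (negbTE (tangent_avoids s Aq)) /= => Hq.
  set a := det2 _ _ in Hp; set b := det2 _ _ in Hq.
  have pq : p != q by apply/eqP => E; move: Hp Hq; rewrite /a /b E; lra.
  have l01 : 0 < - b / (a - b) < 1 by rewrite divr_gt0 ?ltr_pdivrMr //; lra.
  have := tangent_avoids s (dom_seg hA (subset_closure Ap) (subset_closure Aq) pq l01).
  have -> : det2 (velocity g s) (segment_point (- b / (a - b)) p q - g s) =
     (- b / (a - b)) * a + (1 - (- b / (a - b))) * b.
    by rewrite /a /b /det2 /segment_point /=; ring.
  have ab : a - b != 0 by rewrite gt_eqF //; lra.
  have -> : (- b / (a - b)) * a + (1 - (- b / (a - b))) * b = 0 by field.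
  by rewrite eqxx.
have [H|H] := boolP (0 < det2 (velocity g 0) (p0 - g 0)).
  by exists 1; [by left|] => s p Ap; rewrite mul1r (S1' _ s 0) //; exact: S2 H.
exists (-1); [by right|] => s p Ap; rewrite mulN1r oppr_gt0 lt_neqAle (tangent_avoids s Ap) /= leNgt.
by apply: contra H => H; apply: (S2 0 p) => //; rewrite (S1' _ 0 s).
Qed.

Variable o : R.
Hypothesis Ho : forall s p, A p -> 0 < o * det2 (velocity g s) (p - g s).

(** The midpoint of the chord is in the domain. *)
Lemma chord_side s t : g s != g t -> 0 < o * det2 (velocity g s) (g t - g s).
Proof.
move=> st; have h01 : 0 < (2^-1 : R) < 1 by lra.
have := Ho s (dom_seg hA (bd_closure (param_bd cp s)) (bd_closure (param_bd cp t)) st h01).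
have -> : o * det2 (velocity g s) (segment_point 2^-1 (g s) (g t) - g s) =
  2^-1 * (o * det2 (velocity g s) (g t - g s)).
  by rewrite /det2 /segment_point /=; field.
lra.
Qed.

(** As a function of [t'] the determinant has no zero, by [bd_noncollinear], and
    it is positive right after [t], where its derivative is given by
    [chord_side]. *)
Lemma chord_order x t t' : x < t -> t < t' -> t' < x + T ->
  0 < o * det2 (g t - g x) (g t' - g x).
Proof.
move=> xt tt' tx.
have n1 : g x != g t by apply: (param_neq cp); lra.
pose f u := o * det2 (g t - g x) (g u - g x).
have o0 : o != 0.
  by apply/eqP => o0; have := chord_side n1; rewrite o0 mul0r ltxx.
have fc : continuous f.
  move=> u; apply: cvgM; first exact: cvg_cst.
  apply: cvgB; apply: cvgM; try exact: cvg_cst.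
    by apply: cvgB; [exact: curve_cont2 | exact: cvg_cst].
  by apply: cvgB; [exact: curve_cont1 | exact: cvg_cst].
have fn u : t < u < x + T -> f u != 0.
  move=> /andP[u1 u2]; rewrite mulf_neq0 //.
  apply: (bd_noncollinear hA); try exact: (param_bd cp).
  - exact: n1.
  - by apply: (param_neq cp); lra.
  - by apply: (param_neq cp); lra.
have fd : is_derive t 1 f (o * det2 (g t - g x) (velocity g t)).
  pose a := g t - g x.
  have E : f = (fun u => (o * a.1) * ((snd \o g) u - (g x).2) - (o * a.2) * ((fst \o g) u - (g x).1)).
    by apply/funext => u; rewrite /f /det2 /a /=; ring.
  have d1 := cc_der1 cc t; have d2 := cc_der2 cc t.
  rewrite E; apply: is_derive_eq; rewrite /det2 /a /= !subr0 /GRing.scale /=; ring.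
have D0 : 0 < o * det2 (g t - g x) (velocity g t).
  have n2 : g t != g x by rewrite eq_sym.
  have -> : o * det2 (g t - g x) (velocity g t) = o * det2 (velocity g t) (g x - g t).
    by rewrite /det2 /=; ring.
  exact: chord_side.
have ft0 : f t = 0 by rewrite /f /det2; ring.
set D := o * _ in fd D0.
have eta0 : 0 < D / 2 by rewrite divr_gt0.
have [d d0 Hd] := derive_eps fd eta0.
pose k := Num.min d (t' - t) / 2.
have m0 : 0 < Num.min d (t' - t) by rewrite lt_min d0; lra.
have k0 : 0 < k by rewrite divr_gt0.
have kd : `|k| < d.
  have : Num.min d (t' - t) <= d by rewrite ge_min lexx.
  rewrite gtr0_norm // /k; lra.
have kt : t + k < t'.
  have : Num.min d (t' - t) <= t' - t by rewrite ge_min lexx orbT.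
  rewrite /k; lra.
have fk : 0 < f (t + k).
  have := Hd k kd; rewrite ft0 subr0 (gtr0_norm k0) ler_norml => /andP[H1 _].
  have : 0 < D * k by rewrite mulr_gt0.
  lra.
rewrite -[X in 0 < X]/(f t') -(nonzero_sign (a := t + k) fc (ltW kt)) //.
by move=> u /andP[u1 u2]; apply: fn; lra.
Qed.

End Curve.
End Geometry.

(** * The reflection law and closing maps *)

Section Law.
Context {R : realType}.
Implicit Types (g : R -> R * R) (G : R -> R).

(** Equality of the angles of incidence and reflection at [g x1], multiplied out: the
    cotangents of the angles from the tangent to the two chords are opposite. *)
Definition law g x0 x1 x2 : R :=
  dot2 (velocity g x1) (g x0 - g x1) * det2 (velocity g x1) (g x2 - g x1) +
  dot2 (velocity g x1) (g x2 - g x1) * det2 (velocity g x1) (g x0 - g x1).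

Lemma law_sym g x0 x1 x2 : law g x0 x1 x2 = law g x2 x1 x0.
Proof. by rewrite /law addrC. Qed.

Lemma derive1_shift (f : R -> R) c s : (f^`()%classic) (s + c) = ((fun x => f (x + c))^`()%classic) s.
Proof. by rewrite /derive1; under eq_fun do rewrite addrA. Qed.

Lemma velocity_shift g T s : periodic g T -> velocity g (s + T) = velocity g s.
Proof.
move=> per; rewrite /velocity !derive1_shift; congr (_^`()%classic s, _^`()%classic s);
by apply/funext => x /=; rewrite per.
Qed.

Lemma periodic_int (X : Type) (f : R -> X) T : (forall s, f (s + T) = f s) ->
  forall s (k : int), f (s + k%:~R * T) = f s.
Proof.
move=> per s k.
have P n u : f (u + n%:R * T) = f u.
  elim: n u => [|n IH] u; first by rewrite mul0r addr0.
  by rewrite -natr1 mulrDl mul1r addrA per.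
case: k => n; first by have := P n s.
have := P n.+1 (s + (Negz n)%:~R * T).
by rewrite NegzE mulrNz mulNr -[(n.+1%:Z)%:~R]/(n.+1%:R) subrK => <-.
Qed.

Lemma law_shift g T (k0 k1 k2 : int) x0 x1 x2 : periodic g T ->
  law g (x0 + k0%:~R * T) (x1 + k1%:~R * T) (x2 + k2%:~R * T) = law g x0 x1 x2.
Proof.
move=> per; rewrite /law !(periodic_int per).
by rewrite (periodic_int (f := velocity g) (T := T)) // => s; exact: velocity_shift.
Qed.

Lemma law_scale g h (psi : R -> R) c x0 x1 x2 : (forall s, h s = g (psi s)) ->
  velocity h x1 = (c * (velocity g (psi x1)).1, c * (velocity g (psi x1)).2) ->
  law h x0 x1 x2 = c ^+ 2 * law g (psi x0) (psi x1) (psi x2).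
Proof. by move=> E V; rewrite /law V !E /dot2 /det2 /=; ring. Qed.

(** The dynamics on a periodic invariant curve. The curve itself is recovered from
    [G] as the angle between the tangent at [g s] and the chord to [g (G s)]. *)
Record closing_map g (T : R) (m : int) (n : nat) G : Prop := ClosingMap {
  cm_mono : forall x y, x < y -> G x < G y;
  cm_per : forall s, G (s + T) = G s + T;
  cm_twist : forall s, s < G s < s + T;
  cm_iter : forall s, iter n G s = s + m%:~R * T;
  cm_law : forall s, law g s (G s) (G (G s)) = 0 }.

Definition closing g T m n := exists G, closing_map g T m n G.

Section ClosingTheory.
Variables (g : R -> R * R) (T : R) (m : int) (n : nat) (G : R -> R).
Hypothesis n0 : (0 < n)%N.
Hypothesis cm : closing_map g T m n G.

Lemma cm_mono_le x y : x <= y -> G x <= G y.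
Proof. by rewrite le_eqVlt => /orP[/eqP -> //|/(cm_mono cm)/ltW]. Qed.

Lemma cm_per_int s (k : int) : G (s + k%:~R * T) = G s + k%:~R * T.
Proof.
have per u : G (u + T) - (u + T) = G u - u by rewrite (cm_per cm); ring.
have := periodic_int (f := fun u => G u - u) per s k; lra.
Qed.

Definition cm_inv s := iter n.-1 G (s - m%:~R * T).

Lemma cm_invK s : G (cm_inv s) = s.
Proof. by rewrite /cm_inv -iterS prednK // (cm_iter cm) subrK. Qed.

Lemma cm_inv_mono x y : x < y -> cm_inv x < cm_inv y.
Proof.
move=> xy; rewrite /cm_inv; elim: (n.-1) => [|k IH] /=; first by rewrite ltrD2r.
exact: (cm_mono cm IH).
Qed.

Lemma cm_inj x y : G x = G y -> x = y.
Proof.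
move=> E; case: (ltrgtP x y) => // xy; have := cm_mono cm xy; rewrite E ltxx //.
Qed.

Lemma cm_Kinv s : cm_inv (G s) = s.
Proof. by apply: cm_inj; rewrite cm_invK. Qed.

Lemma cm_inv_per s : cm_inv (s + T) = cm_inv s + T.
Proof. by apply: cm_inj; rewrite (cm_per cm) !cm_invK. Qed.

Lemma cm_inv_iter s : iter n cm_inv s = s - m%:~R * T.
Proof.
have K k u : iter k cm_inv (iter k G u) = u.
  by elim: k u => [|k IH] u //; rewrite iterS iterSr IH cm_Kinv.
have E : s = iter n G (s - m%:~R * T) by rewrite (cm_iter cm) subrK.
by rewrite {1}E K.
Qed.

Lemma cm_continuous : continuous G.
Proof.
move=> s; apply/cvgrPdist_lt => eta eta0; apply/nearE_dist.
pose a := cm_inv (G s - eta); pose b := cm_inv (G s + eta).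
have as_ : a < s by rewrite -[X in _ < X]cm_Kinv; apply: cm_inv_mono; lra.
have sb : s < b by rewrite -[X in X < _]cm_Kinv; apply: cm_inv_mono; lra.
exists (Num.min (s - a) (b - s)); first by rewrite lt_min !subr_gt0 as_.
move=> x; rewrite lt_min => /andP[h1 h2].
have h3 : a < x by move: h1; rewrite ltr_norml; lra.
have h4 : x < b by move: h2; rewrite ltr_norml; lra.
have := cm_mono cm h3; have := cm_mono cm h4; rewrite !cm_invK distrC ltr_norml; lra.
Qed.

End ClosingTheory.

Definition reverse g (s : R) := g (- s).

Lemma velocity_reverse g s :
  (forall s, derivable (fst \o g) s 1) -> (forall s, derivable (snd \o g) s 1) ->
  velocity (reverse g) s = (-1 * (velocity g (- s)).1, -1 * (velocity g (- s)).2).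
Proof.
move=> d1 d2; rewrite /velocity /=.
have E (f : R -> R) : derivable f (- s) 1 -> ((fun x => f (- x))^`()%classic) s = -1 * f^`()%classic (- s).
  move=> df; have D1 : is_derive (- s) 1 f (f^`()%classic (- s)) by rewrite derive1E; exact: DeriveDef.
  have D2 : is_derive s 1 (fun x : R => - x) (-1) by apply: is_derive_eq.
  have := is_derive1_comp (f := f) (g := fun x : R => - x) (x := s).
  move=> /(_ _ _ D1 D2) H; rewrite derive1E (derive_val (is_derive := H)) mulrC //.
by congr (_, _); exact: E.
Qed.

(** Reversing the orientation reverses the dynamics: the inverse of [G] is used. *)
Lemma closing_reverse g T m n : (0 < n)%N ->
  (forall s, derivable (fst \o g) s 1) -> (forall s, derivable (snd \o g) s 1) ->
  closing g T m n -> closing (reverse g) T m n.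
Proof.
move=> n0 d1 d2 [G cm]; pose H := cm_inv T m n G.
exists (fun s => - H (- s)); split.
- by move=> x y xy; rewrite ltrN2; apply: (cm_inv_mono cm); rewrite ltrN2.
- move=> s; have := cm_inv_per n0 cm (- s - T); rewrite subrK /H opprD => ->; ring.
- move=> s; have := cm_twist cm (H (- s)); rewrite (cm_invK n0 cm) => /andP[]; lra.
- move=> s; have -> : iter n (fun s => - H (- s)) s = - iter n H (- s).
    by elim: (n) => [|k IH] /=; rewrite ?opprK // IH opprK.
  by rewrite (cm_inv_iter n0 cm); ring.
move=> s; rewrite opprK (law_scale (g := g) (psi := fun s => - s) (c := -1)) //; last exact: velocity_reverse.
rewrite !opprK law_sym.
have := cm_law cm (H (H (- s))); rewrite !(cm_invK n0 cm) => ->; ring.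
Qed.

Lemma closing_map_transport g h T L m n (psi psi' G : R -> R) :
  (forall x y, x < y -> psi x < psi y) -> cancel psi psi' -> cancel psi' psi ->
  (forall s, psi (s + L) = psi s + T) -> (forall s, h s = g (psi s)) ->
  (forall s, exists c, velocity h s = (c * (velocity g (psi s)).1, c * (velocity g (psi s)).2)) ->
  closing_map g T m n G -> closing_map h L m n (fun s => psi' (G (psi s))).
Proof.
move=> mono K K' per E V cm.
have mono' x y : x < y -> psi' x < psi' y.
  move=> xy; case: (ltrgtP (psi' x) (psi' y)) => // H.
    by have := mono _ _ H; rewrite !K'; lra.
  by have := congr1 psi H; rewrite !K' => ?; lra.
have per' s : psi' (s + T) = psi' s + L.
  by rewrite -{1}(K' s) -per K.
have perz s : psi (s + m%:~R * L) = psi s + m%:~R * T.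
  have pu u : psi (u + L) - (u + L) * (T / L) = psi u - u * (T / L).
    have [L0|L0] := eqVneq L 0.
      have := per 0; rewrite L0 !addr0 => H; have T00 : T = 0 by lra.
      by [].
    by rewrite per; field.
  have [L0|L0] := eqVneq L 0.
    have := per 0; rewrite L0 !addr0 => H; have T00 : T = 0 by lra.
    by rewrite T00 !mulr0 !addr0.
  have := periodic_int (f := fun u => psi u - u * (T / L)) pu s m.
  have -> : (s + m%:~R * L) * (T / L) = s * (T / L) + m%:~R * T by field.
  lra.
split.
- by move=> x y /mono/(cm_mono cm)/mono'.
- by move=> s; rewrite per (cm_per cm) per'.
- move=> s; have /andP[h1 h2] := cm_twist cm (psi s).
  apply/andP; split; first by rewrite -{1}(K s); exact: mono'.
  by have := mono' _ _ h2; rewrite per' K.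
- move=> s; have -> : iter n (fun s => psi' (G (psi s))) s = psi' (iter n G (psi s)).
    by elim: (n) => [|k IH] /=; rewrite ?K // IH K'.
  by rewrite (cm_iter cm) -perz K.
move=> s; have [c Vc] := V (psi' (G (psi s))).
by rewrite (law_scale _ _ E Vc) !K' (cm_law cm) mulr0.
Qed.

Lemma closing_transport g h T L m n (psi psi' : R -> R) :
  (forall x y, x < y -> psi x < psi y) -> cancel psi psi' -> cancel psi' psi ->
  (forall s, psi (s + L) = psi s + T) -> (forall s, h s = g (psi s)) ->
  (forall s, exists c, velocity h s = (c * (velocity g (psi s)).1, c * (velocity g (psi s)).2)) ->
  closing g T m n -> closing h L m n.
Proof. by move=> mono K K' per E V [G cm]; eexists; exact: closing_map_transport mono K K' per E V cm. Qed.

Section LawMono.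
Variables (A : set (R * R)) (g : R -> R * R) (T o : R).
Hypothesis cc : convex_curve A g T.
Hypothesis Ho : forall s p, A p -> 0 < o * det2 (velocity g s) (p - g s).

Definition cotan x t := dot2 (velocity g x) (g t - g x) / (o * det2 (velocity g x) (g t - g x)).

Lemma normsq_gt0 x : 0 < (velocity g x).1 ^+ 2 + (velocity g x).2 ^+ 2.
Proof.
have := cc_reg cc x; case: (velocity g x) => a b /= ab.
rewrite lt_def paddr_eq0 ?sqr_ge0 // !sqrf_eq0 addr_ge0 ?sqr_ge0 // andbT.
by apply: contra ab => /andP[/eqP -> /eqP ->].
Qed.

(** The difference of the two cotangents is a positive multiple of the determinant of
    the chords, see [chord_order]. *)
Lemma cotan_decr x t t' : x < t -> t < t' -> t' < x + T -> cotan x t' < cotan x t.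
Proof.
move=> xt tt' tx; rewrite -subr_gt0 /cotan.
have d1 : 0 < o * det2 (velocity g x) (g t - g x).
  by apply: (chord_side cc Ho); apply: (param_neq (cc_par cc)); lra.
have d2 : 0 < o * det2 (velocity g x) (g t' - g x).
  by apply: (chord_side cc Ho); apply: (param_neq (cc_par cc)); lra.
have d3 := chord_order cc Ho xt tt' tx.
set v := velocity g x in d1 d2 *; set a := g t - g x in d1 d3 *; set b := g t' - g x in d2 d3 *.
have -> : dot2 v a / (o * det2 v a) - dot2 v b / (o * det2 v b) =
  (v.1 ^+ 2 + v.2 ^+ 2) * (o * det2 a b) / ((o * det2 v a) * (o * det2 v b)).
  have E : o * (dot2 v a * det2 v b - dot2 v b * det2 v a) = (v.1 ^+ 2 + v.2 ^+ 2) * (o * det2 a b).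
    by rewrite /dot2 /det2; ring.
  have o0 : o != 0 by apply/eqP => o0; move: d1; rewrite o0 mul0r ltxx.
  have p0 : det2 v a != 0 by apply/eqP => o1; move: d1; rewrite o1 mulr0 ltxx.
  have q0 : det2 v b != 0 by apply/eqP => o1; move: d2; rewrite o1 mulr0 ltxx.
  by rewrite -E; field; rewrite o0 p0 q0.
by rewrite divr_gt0 // mulr_gt0 // normsq_gt0.
Qed.

Lemma law_cotan x0 x1 x2 : g x1 != g x0 -> g x1 != g x2 ->
  law g x0 x1 x2 = 0 <-> cotan x1 x0 + cotan x1 x2 = 0.
Proof.
move=> n0 n2; have d0 := chord_side cc Ho n0; have d2 := chord_side cc Ho n2.
rewrite /law /cotan.
set v := velocity g x1 in d0 d2 *; set a := g x0 - g x1 in d0 *; set b := g x2 - g x1 in d2 *.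
have o0 : o != 0 by apply/eqP => o0; move: d0; rewrite o0 mul0r ltxx.
have p0 : det2 v a != 0 by apply/eqP => o1; move: d0; rewrite o1 mulr0 ltxx.
have q0 : det2 v b != 0 by apply/eqP => o1; move: d2; rewrite o1 mulr0 ltxx.
have -> : dot2 v a / (o * det2 v a) + dot2 v b / (o * det2 v b) =
  (dot2 v a * det2 v b + dot2 v b * det2 v a) / (o * det2 v a * det2 v b).
  by field; rewrite o0 p0 q0.
split=> [->|/eqP]; first by rewrite mul0r.
by rewrite mulf_eq0 invr_eq0 !mulf_eq0 (negbTE o0) (negbTE p0) (negbTE q0) !orbF => /eqP.
Qed.

Lemma cotan_per x t : cotan x (t + T) = cotan x t.
Proof. by have [_ per _ _] := cc_par cc; rewrite /cotan per. Qed.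

(** Moving both ends forward decreases both cotangents, while the law keeps their sum
    equal to zero. *)
Lemma law_mono x0 x0' x1 x2 x2' : x0 <= x0' -> x0' < x1 -> x1 < x0 + T ->
  x1 < x2 -> x2 <= x2' -> x2' < x1 + T ->
  law g x0 x1 x2 = 0 -> law g x0' x1 x2' = 0 -> x0 = x0' /\ x2 = x2'.
Proof.
move=> h1 h2 h3 h4 h5 h6.
have [_ per _ _] := cc_par cc.
have n u : u < x1 < u + T -> g x1 != g u.
  by move=> H; rewrite eq_sym; exact: (param_neq (cc_par cc)).
have n' u : x1 < u < x1 + T -> g x1 != g u by exact: (param_neq (cc_par cc)).
move=> /law_cotan-/(_ (n _ _) (n' _ _)) => H1 /law_cotan-/(_ (n _ _) (n' _ _)) => H2.
have {}H1 : cotan x1 x0 + cotan x1 x2 = 0 by apply: H1; lra.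
have {}H2 : cotan x1 x0' + cotan x1 x2' = 0 by apply: H2; lra.
have C0 : x0 = x0' \/ cotan x1 x0' < cotan x1 x0.
  have [->|E] := eqVneq x0 x0'; [by left | right].
  rewrite -(cotan_per _ x0) -(cotan_per _ x0'); apply: cotan_decr; [lra| |lra].
  by rewrite ltrD2r lt_neqAle E.
have C2 : x2 = x2' \/ cotan x1 x2' < cotan x1 x2.
  have [->|E] := eqVneq x2 x2'; [by left | right].
  by apply: cotan_decr => //; rewrite lt_neqAle E.
case: C0 => [E0|E0]; case: C2 => [E2|E2] //; exfalso; move: H1 H2; rewrite ?E0 ?E2; lra.
Qed.

End LawMono.
End Law.

(** * Continuity of the period *)

Section UltraTools.
Context {R : realType}.

Lemma ultra_at (P : R -> Prop) (e0 : R) :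
  (forall d, 0 < d -> exists2 e, `|e - e0| < d & P e) ->
  exists U : set_system R, [/\ UltraFilter U, U P & id @ U --> e0].
Proof.
move=> H.
have PF : ProperFilter (within P (nbhs e0)).
  apply: Build_ProperFilter_ex => B; rewrite /within /= => /nearE_dist[d d0 HB].
  by have [e ed Pe] := H d d0; exists e; exact: HB.
have [U [UU WU]] := ultraFilterLemma PF.
exists U; split=> //; first by apply: WU; rewrite /within /=; exact: nearW.
by move=> B HB; apply: WU; rewrite /within /=; apply: filterS HB.
Qed.

Lemma cvg_dist (X : Type) (U : set_system X) (x : X -> R) x0 d :
  x @ U --> x0 -> 0 < d -> U [set e | `|x e - x0| < d].
Proof. by move=> xx d0; exact: (xx _ (near_dist x0 d0)). Qed.

End UltraTools.

Section Family.
Context {R : realType}.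
Variables (I : set R) (Omega : R -> set (R * R)) (gam : R -> R -> R * R) (T : R -> R).
Let f1 e s := (gam e s).1.
Let f2 e s := (gam e s).2.
Hypothesis S1 : family_series I f1.
Hypothesis S2 : family_series I f2.
Hypothesis cc : forall e, I e -> convex_curve (Omega e) (gam e) (T e).

Lemma fam_MVT (f : R -> R -> R) e x y : family_series I f -> I e -> x < y ->
  exists2 xi, x < xi < y & f e y - f e x = dpar f e xi * (y - x).
Proof.
move=> Sf Ie xy; have D s := family_derive s Sf Ie.
have [|xi] := MVT xy (fun s _ => D s).
  by apply: continuous_subspaceT; exact: (is_derive_continuous D).
by rewrite in_itv /= => ? ?; exists xi.
Qed.

Lemma T_pos e : I e -> 0 < T e.
Proof. by move=> /cc/cc_par[]. Qed.

Lemma bd_fam e s : I e -> boundary (Omega e) (gam e s).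
Proof. by move=> /cc/cc_par/param_bd. Qed.

(** Let [a] be half the period at [e0]. The line through [gam e 0] and [gam e a]
    separates the points of parameters slightly before and slightly after the
    period, at [e0] and hence at all [e] near [e0]. In between the curve crosses
    this line, and it can do so only at [gam e 0]. *)
Lemma closing_time e0 : I e0 -> forall eta, 0 < eta -> exists2 d, 0 < d &
  forall e, I e -> `|e - e0| < d -> exists2 t, `|t - T e0| <= eta & gam e t = gam e 0.
Proof.
move=> Ie0 eta0 eta00.
have c0 := cc Ie0; have T0 := T_pos Ie0; have cp0 := cc_par c0.
have [ o _ Ho] := orientation c0.
set T0' := T e0 in T0 *; pose a := T0' / 2.
have Ja1 := family_jcont S1; have Ja2 := family_jcont S2.
have n0a : gam e0 0 != gam e0 a by apply: (param_neq cp0); rewrite -/T0' /a; lra.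
have per0 : gam e0 T0' = gam e0 0 by have [_ per _ _] := cp0; rewrite -(per 0) add0r.
have [d1 d10 H1] : exists2 d, 0 < d & forall e t, I e -> `|e - e0| < d -> `|t - T0'| < d ->
    gam e t != gam e a.
  have K (f : R -> R -> R) : jcont I f -> f e0 T0' != f e0 a ->
     exists2 d, 0 < d & forall e t, I e -> `|e - e0| < d -> `|t - T0'| < d -> f e t != f e a.
    move=> Jf nf; have k0 : 0 < `|f e0 T0' - f e0 a| / 2 by rewrite divr_gt0 // normr_gt0 subr_eq0.
    have [da da0 Ha] := Jf e0 a Ie0 _ k0; have [db db0 Hb] := Jf e0 T0' Ie0 _ k0.
    exists (Num.min da db) => [|e t Ie]; first by rewrite lt_min da0.
    rewrite !lt_min => /andP[e1 e2] /andP[t1 t2]; apply/eqP => E.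
    have B := Hb e t Ie e2 t2.
    have : `|f e0 T0' - f e0 a| <= `|f e t - f e0 T0'| + `|f e a - f e0 a|.
      have -> : f e0 T0' - f e0 a = (f e a - f e0 a) - (f e t - f e0 T0') by rewrite E; ring.
      by rewrite [leRHS]addrC; exact: ler_normB.
    have aa : `|a - a| < da by rewrite subrr normr0.
    have A := Ha e a Ie e1 aa; lra.
  have [E1|E1] := eqVneq (f1 e0 T0') (f1 e0 a).
    have [|d d0 Hd] := K f2 Ja2.
      apply: contra n0a => /eqP E2; rewrite -per0 [X in X == _]surjective_pairing [X in _ == X]surjective_pairing.
      by rewrite -/(f1 e0 T0') E1 -/(f2 e0 T0') E2.
    by exists d => // e t Ie he ht; apply: contra (Hd e t Ie he ht) => /eqP E; rewrite /f2 E.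
  have [d d0 Hd] := K f1 Ja1 E1.
  by exists d => // e t Ie he ht; apply: contra (Hd e t Ie he ht) => /eqP E; rewrite /f1 E.
pose eta := Num.min (Num.min eta0 (d1 / 2)) (a / 2).
have eta_gt0 : 0 < eta by rewrite !lt_min eta00 /a !divr_gt0.
have le1 : eta <= eta0 by rewrite !ge_min lexx.
have le2 : eta <= d1 / 2 by rewrite !ge_min lexx orbT.
have le3 : eta <= a / 2 by rewrite !ge_min lexx orbT.
pose F e t := det2 (gam e a - gam e 0) (gam e t - gam e 0).
have Fm : 0 < o * F e0 (T0' - eta).
  by apply: (chord_order c0 Ho); rewrite -/T0' /a in le3 *; lra.
have Fp : o * F e0 (T0' + eta) < 0.
  have -> : F e0 (T0' + eta) = - det2 (gam e0 eta - gam e0 0) (gam e0 a - gam e0 0).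
    have [_ per _ _] := cp0; have pe : gam e0 (eta + T0') = gam e0 eta by exact: per.
    by rewrite /F [T0' + eta]addrC pe /det2; ring.
  have : 0 < o * det2 (gam e0 eta - gam e0 0) (gam e0 a - gam e0 0).
    by apply: (chord_order c0 Ho); rewrite -/T0' /a in le3 *; lra.
  lra.
have JF t eps : 0 < eps -> exists2 d, 0 < d & forall e, I e -> `|e - e0| < d -> `|F e t - F e0 t| < eps.
  move=> eps0.
  have C (f : R -> R -> R) u : jcont I f -> f e u @[e --> within I (nbhs e0)] --> f e0 u.
    move=> Jf; apply/cvgrPdist_lt => k k0; have [d d0 Hd] := Jf e0 u Ie0 k k0.
    rewrite /within /=; apply/nearE_dist; exists d => // e ed Ie; rewrite distrC; apply: Hd => //.
    by rewrite subrr normr0.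
  have : F e t @[e --> within I (nbhs e0)] --> F e0 t.
    by apply: cvgB; apply: cvgM; apply: cvgB; (exact: (C f1) || exact: (C f2)).
  move/cvgrPdist_lt => /(_ eps eps0); rewrite /within /= => /nearE_dist[d d0 Hd].
  by exists d => // e Ie ed; rewrite distrC; exact: Hd.
have n1 : 0 < `|F e0 (T0' - eta)|.
  by rewrite normr_gt0; apply/eqP => E; move: Fm; rewrite E mulr0 ltxx.
have n2 : 0 < `|F e0 (T0' + eta)|.
  by rewrite normr_gt0; apply/eqP => E; move: Fp; rewrite E mulr0 ltxx.
have [d2 d20 H2] := JF (T0' - eta) _ n1; have [d3 d30 H3] := JF (T0' + eta) _ n2.
exists (Num.min d1 (Num.min d2 d3)); first by rewrite !lt_min d10 d20.
move=> e Ie; rewrite !lt_min => /and3P[e1 e2 e3].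
have ce := cc Ie.
have Fc : continuous (F e).
  move=> u; apply: cvgB; apply: cvgM; try exact: cvg_cst.
    by apply: cvgB; [exact: (curve_cont2 ce) | exact: cvg_cst].
  by apply: cvgB; [exact: (curve_cont1 ce) | exact: cvg_cst].
have opp : Num.min (F e (T0' - eta)) (F e (T0' + eta)) <= 0 <= Num.max (F e (T0' - eta)) (F e (T0' + eta)).
  have := H2 e Ie e2; have := H3 e Ie e3.
  have [ oo| oo] : (0 < F e0 (T0' - eta) /\ F e0 (T0' + eta) < 0) \/ (F e0 (T0' - eta) < 0 /\ 0 < F e0 (T0' + eta)).
    have [ o0| o0| o0] := ltrgtP o 0; [right|left|by move: Fm; rewrite o0 mul0r ltxx].
      by move: Fm Fp; rewrite (nmulr_rgt0 _ o0) (nmulr_rlt0 _ o0).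
    by move: Fm Fp; rewrite (pmulr_rgt0 _ o0) (pmulr_rlt0 _ o0).
  - rewrite (gtr0_norm oo.1) (ltr0_norm oo.2) !ltr_norml => /andP[_ h1] /andP[h2 _].
    by rewrite ge_min le_max; apply/andP; split; apply/orP; [right|left]; lra.
  rewrite (ltr0_norm oo.1) (gtr0_norm oo.2) !ltr_norml => /andP[h1 _] /andP[_ h2].
  by rewrite ge_min le_max; apply/andP; split; apply/orP; [left|right]; lra.
have [||t tI Ft] := IVT _ _ opp; [lra | exact: continuous_subspaceT|].
move: tI; rewrite in_itv /= => /andP[t1 t2].
have tT : `|t - T0'| <= eta by rewrite ler_norml; lra.
exists t; first by apply: le_trans le1.
have nta : gam e t != gam e a by apply: H1 => //; apply: le_lt_trans tT _; lra.
have na : gam e 0 != gam e a.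
  apply/eqP => E; have := H2 e Ie e2; rewrite /F E subrr.
  have -> : det2 0 (gam e (T0' - eta) - gam e a) = 0 by rewrite /det2 /= !mul0r subrr.
  by rewrite sub0r normrN ltxx.
apply/eqP; rewrite eq_sym; apply/negPn/negP => nt0.
have := bd_noncollinear (cc_dom ce) (bd_fam 0 Ie) (bd_fam a Ie) (bd_fam t Ie) na nt0.
by rewrite eq_sym nta -[det2 _ _]/(F e t) Ft eqxx => /(_ isT).
Qed.

(** Over a short period some component of the velocity would vanish near
    parameter [0], by Rolle's theorem. *)
Lemma period_lower e0 : I e0 -> exists2 d, 0 < d &
  forall e, I e -> `|e - e0| < d -> d <= T e.
Proof.
move=> Ie0.
have K (f : R -> R -> R) : family_series I f -> (forall e, I e -> f e (T e) = f e 0) ->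
    dpar f e0 0 != 0 -> exists2 d, 0 < d & forall e, I e -> `|e - e0| < d -> d <= T e.
  move=> Sf fper D0; rewrite -normr_gt0 in D0.
  have [d d0 Hd] := family_jcont (family_dpar Sf) 0 Ie0 D0.
  exists d => // e Ie ed; rewrite leNgt; apply/negP => Td.
  have T0 := T_pos Ie.
  have [xi /andP[x1 x2]] := fam_MVT Sf Ie T0; rewrite fper // subrr subr0 => /esym/eqP.
  rewrite mulf_eq0 (gt_eqF T0) orbF => /eqP E.
  have xd : `|xi - 0| < d by rewrite subr0 gtr0_norm //; lra.
  by have := Hd e xi Ie ed xd; rewrite E sub0r normrN ltxx.
have per e : I e -> gam e (T e) = gam e 0.
  by move=> Ie; have [_ p _ _] := cc_par (cc Ie); rewrite -(p 0) add0r.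
have [E1|] := eqVneq (dpar f1 e0 0) 0; last by apply: K => // e Ie; rewrite /f1 per.
apply: (K f2) => //; first by move=> e Ie; rewrite /f2 per.
by apply: contra (cc_reg (cc Ie0) 0) => /eqP E2; rewrite /velocity -[X in (X, _)]/(dpar f1 e0 0) -[X in (_, X)]/(dpar f2 e0 0) E1 E2.
Qed.

Section AlongUltra.
Variables (U : set_system R) (e0 : R).
Hypothesis UU : UltraFilter U.
Hypothesis UI : U I.
Hypothesis Ue0 : id @ U --> e0.
Hypothesis Ie0 : I e0.

Lemma U_near d : 0 < d -> U [set e | `|e - e0| < d].
Proof. by move=> d0; apply: (Ue0 (near_dist e0 d0)). Qed.

Lemma jcont_ultra f (x : R -> R) x0 : jcont I f -> x @ U --> x0 ->
  (fun e => f e (x e)) @ U --> f e0 x0.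
Proof.
move=> Jf xx; apply/cvgrPdist_lt => eta eta0; have [d d0 Hd] := Jf e0 x0 Ie0 eta eta0.
have Ux : U [set e | `|x e - x0| < d] by exact: cvg_dist.
apply: filterS (filterI UI (filterI (U_near d0) Ux)) => e [Ie [h1 h2]].
by rewrite distrC; exact: Hd.
Qed.

(** The limit is positive by [period_lower]; it is at most the period at [e0], since
    closing times are multiples of the period; and it is a closing time. *)
Lemma period_ultra : T @ U --> T e0.
Proof.
have T0 := T_pos Ie0.
have up eta : 0 < eta -> U [set e | 0 <= T e <= T e0 + eta].
  move=> eta0.
  have m0 : 0 < Num.min eta (T e0 / 2) by rewrite lt_min eta0 divr_gt0.
  have [d d0 Hd] := closing_time Ie0 m0.
  apply: filterS (filterI UI (U_near d0)) => e [Ie he] /=.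
  have [t tT tE] := Hd e Ie he; rewrite (ltW (T_pos Ie)) /=.
  have [k kE] := param_eq (cc_par (cc Ie)) (esym tE).
  rewrite add0r in kE.
  have h1 : Num.min eta (T e0 / 2) <= eta by rewrite ge_min lexx.
  have h2 : Num.min eta (T e0 / 2) <= T e0 / 2 by rewrite ge_min lexx orbT.
  move: tT; rewrite ler_norml => /andP[t1 t2].
  have k0 : 0 < k.
    rewrite -(ltr0z R); have : 0 < k%:~R * T e by rewrite -kE; lra.
    by rewrite pmulr_lgt0 // T_pos.
  have : 1 * T e <= k%:~R * T e.
    by rewrite ler_wpM2r // ?(ltW (T_pos Ie)) // -[1]/(1%:~R) ler_int; lia.
  lra.
have [T' TT'] : exists T' : R, T @ U --> T'.
  apply: (@ultra_bounded_cvg _ _ _ UU _ (T e0 + 1)); apply: filterS (up 1 ltr01) => e /= /andP[h1 h2].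
  by rewrite ger0_norm.
have T'le : T' <= T e0.
  apply/ler_addgt0Pr => eta eta0; apply: (cvgr_to_le TT'); apply: filterS (up _ eta0) => e /andP[_ h]//.
have T'0 : 0 < T'.
  have [d d0 Hd] := period_lower Ie0; apply: (lt_le_trans d0); apply: (cvgr_to_ge TT').
  by apply: filterS (filterI UI (U_near d0)) => e [Ie he]; exact: Hd.
have per e : I e -> gam e (T e) = gam e 0.
  by move=> Ie; have [_ p _ _] := cc_par (cc Ie); rewrite -(p 0) add0r.
have E (f : R -> R -> R) : jcont I f -> (forall e, I e -> f e (T e) = f e 0) -> f e0 T' = f e0 0.
  move=> Jf fper; have L1 := jcont_ultra Jf TT'.
  have L0 : (fun _ : R => (0 : R)) @ U --> (0 : R) by exact: cvg_cst.
  have L2 := jcont_ultra Jf L0.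
  have L3 : (fun e => f e (T e)) @ U --> f e0 0.
    by apply: cvg_trans L2; apply: near_eq_cvg; apply: filterS UI => e Ie; rewrite fper.
  exact: (cvg_unique _ L1 L3).
have E12 : gam e0 0 = gam e0 T'.
  rewrite [LHS]surjective_pairing [RHS]surjective_pairing; congr (_, _); apply/esym.
    by apply: (E f1 (family_jcont S1)) => e Ie; rewrite /f1 per.
  by apply: (E f2 (family_jcont S2)) => e Ie; rewrite /f2 per.
have [|E0|E0] := param_dist (cc_par (cc Ie0)) _ E12.
- by rewrite add0r T'le ltW.
- by move: T'0; rewrite E0 ltxx.
by move: TT'; rewrite E0 add0r.
Qed.

End AlongUltra.

Lemma period_continuous e0 : I e0 -> forall eta, 0 < eta -> exists2 d, 0 < d &
  forall e, I e -> `|e - e0| < d -> `|T e - T e0| < eta.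
Proof.
move=> Ie0 eta eta0; apply: contrapT => H.
have [|U [UU UP Ue]] := @ultra_at R [set e | I e /\ eta <= `|T e - T e0|] e0.
  move=> d d0; apply: contrapT => H2; apply: H; exists d => // e Ie ed.
  by rewrite ltNge; apply/negP => H3; apply: H2; exists e.
have UI : U I by apply: filterS UP => e [].
have UT := cvg_dist (period_ultra UU UI Ue Ie0) eta0.
have [e [[_ h1] /= h2]] := filter_ex (filterI UP UT).
by move: h2; rewrite ltNge h1.
Qed.

(** * Limits of closing maps *)
Section LimitMap.
Variables (U : set_system R) (e0 : R) (m : int) (n : nat) (G : R -> R -> R).
Hypothesis UU : UltraFilter U.
Hypothesis UI : U I.
Hypothesis Ue0 : id @ U --> e0.
Hypothesis Ie0 : I e0.
Hypothesis n0 : (0 < n)%N.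
Hypothesis m0 : 0 < m.
Hypothesis mn : m < n%:Z.
Hypothesis UG : U [set e | closing_map (gam e) (T e) m n (G e)].

Let UT : T @ U --> T e0 := period_ultra UU UI Ue0 Ie0.
Let T0 : 0 < T e0 := T_pos Ie0.
Let v s := velocity (gam e0) s.

Lemma v_ultra (x : R -> R) x0 : x @ U --> x0 ->
  ((fun e => (velocity (gam e) (x e)).1) @ U --> (v x0).1) /\
  ((fun e => (velocity (gam e) (x e)).2) @ U --> (v x0).2).
Proof.
move=> xx; split.
  exact: (jcont_ultra UU UI Ue0 Ie0 (family_jcont (family_dpar S1)) xx).
exact: (jcont_ultra UU UI Ue0 Ie0 (family_jcont (family_dpar S2)) xx).
Qed.

Lemma g_ultra (x : R -> R) x0 : x @ U --> x0 ->
  ((fun e => (gam e (x e)).1) @ U --> (gam e0 x0).1) /\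
  ((fun e => (gam e (x e)).2) @ U --> (gam e0 x0).2).
Proof.
move=> xx; split.
  exact: (jcont_ultra UU UI Ue0 Ie0 (family_jcont S1) xx).
exact: (jcont_ultra UU UI Ue0 Ie0 (family_jcont S2) xx).
Qed.

Lemma dot_det (a b : R * R) :
  dot2 a b ^+ 2 + det2 a b ^+ 2 = (a.1 ^+ 2 + a.2 ^+ 2) * (b.1 ^+ 2 + b.2 ^+ 2).
Proof. by rewrite /dot2 /det2; ring. Qed.

Lemma dot_gt0 (a b : R * R) : a != 0 -> b != 0 -> det2 a b = 0 -> 0 <= dot2 a b -> 0 < dot2 a b.
Proof.
move=> a0 b0 d0 h; rewrite lt_def h andbT; apply/eqP => h0.
have sq (c : R * R) : c != 0 -> c.1 ^+ 2 + c.2 ^+ 2 != 0.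
  case: c => c1 c2 c0 /=; rewrite paddr_eq0 ?sqr_ge0 // !sqrf_eq0.
  by apply: contra c0 => /andP[/eqP -> /eqP ->].
have := dot_det a b; rewrite h0 d0 expr0n addr0 => /esym/eqP.
by rewrite mulf_eq0 (negbTE (sq a a0)) (negbTE (sq b b0)).
Qed.

Lemma cvg_U_unique (f : R -> R) (a b : R) : f @ U --> a -> f @ U --> b -> a = b.
Proof. exact: cvg_unique. Qed.

(** By the mean value theorem, the direction of a chord that shrinks to a point tends
    to that of the tangent, with its orientation. *)
Lemma short_chord (a b N w1 w2 : R -> R) (X : R) (w : R * R) : a @ U --> X -> b @ U --> X ->
  w1 @ U --> w.1 -> w2 @ U --> w.2 ->
  U [set e | [/\ a e < b e, 0 < N e,
     (gam e (b e)).1 - (gam e (a e)).1 = N e * w1 e &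
     (gam e (b e)).2 - (gam e (a e)).2 = N e * w2 e]] ->
  det2 (v X) w = 0 /\ 0 <= dot2 (v X) w.
Proof.
move=> aX bX W1 W2 H.
have K (f : R -> R -> R) (u : R -> R) : family_series I f ->
    U [set e | [/\ a e < b e, 0 < N e & f e (b e) - f e (a e) = N e * u e]] ->
    exists2 d : R -> R, d @ U --> dpar f e0 X & U [set e | N e * u e = d e * (b e - a e)].
  move=> Sf Hf.
  have [xi Hxi] : {xi : R -> R & forall e, I e -> a e < b e ->
      a e < xi e < b e /\ f e (b e) - f e (a e) = dpar f e (xi e) * (b e - a e)}.
    apply: (@choice _ _ (fun e x => I e -> a e < b e ->
      a e < x < b e /\ f e (b e) - f e (a e) = dpar f e x * (b e - a e))) => e.
    have [Ie|nI] := pselect (I e); last by exists 0.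
    have [ab|ab] := boolP (a e < b e); last by exists 0.
    by have [x x1 x2] := fam_MVT Sf Ie ab; exists x.
  have xiX : xi @ U --> X.
    apply: (squeeze_cvgr _ aX bX).
    by apply: filterS (filterI UI Hf) => e [Ie [ab _ _]]; have [/andP[/ltW -> /ltW ->]] := Hxi e Ie ab.
  exists (fun e => dpar f e (xi e)).
    exact: (jcont_ultra UU UI Ue0 Ie0 (family_jcont (family_dpar Sf)) xiX).
  by apply: filterS (filterI UI Hf) => e [Ie [ab _ E]] /=; rewrite -E; have [_ ->] := Hxi e Ie ab.
have [|d1 D1 E1] := K f1 w1 S1; first by apply: filterS H => e [].
have [|d2 D2 E2] := K f2 w2 S2; first by apply: filterS H => e [].
have P : U [set e | [/\ d1 e * w2 e - d2 e * w1 e = 0, 0 <= d1 e * w1 e & 0 <= d2 e * w2 e]].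
  apply: filterS (filterI H (filterI E1 E2)) => e [[ab N0 _ _] [/= h1 h2]].
  have ba : 0 < b e - a e by rewrite subr_gt0.
  have q (p u : R) : N e * u = p * (b e - a e) -> p = N e * u / (b e - a e).
    by move=> ->; rewrite mulfK // gt_eqF.
  rewrite (q _ _ h1) (q _ _ h2); split; first by ring.
    have -> : N e * w1 e / (b e - a e) * w1 e = N e / (b e - a e) * w1 e ^+ 2 by ring.
    by rewrite mulr_ge0 ?sqr_ge0 // ltW // divr_gt0.
  have -> : N e * w2 e / (b e - a e) * w2 e = N e / (b e - a e) * w2 e ^+ 2 by ring.
  by rewrite mulr_ge0 ?sqr_ge0 // ltW // divr_gt0.
have L1 : (fun e => d1 e * w2 e - d2 e * w1 e) @ U --> det2 (v X) w.
  exact: (cvgB (cvgM D1 W2) (cvgM D2 W1)).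
split.
  apply: (cvg_U_unique L1).
  apply: (@cvg_trans _ ((fun=> (0 : R)) @ U)); last exact: cvg_cst.
  by apply: near_eq_cvg; apply: filterS P => e [-> _ _].
apply: addr_ge0.
  by apply: (cvgr_to_ge (cvgM D1 W1)); apply: filterS P => e [_ ? _].
by apply: (cvgr_to_ge (cvgM D2 W2)); apply: filterS P => e [_ _ ?].
Qed.

Section Config.
Variables (x : R -> R) (x0 : R).
Hypothesis xx0 : x @ U --> x0.

Let orb i e := iter i (G e) (x e).

Lemma orb_bounds i : U [set e | x e <= orb i e <= x e + i%:R * T e].
Proof.
apply: filterS UG => e cm; rewrite /orb.
elim: i => [|i /andP[IH1 IH2]] /=; first by rewrite mul0r addr0 !lexx.
have /andP[h1 h2] := cm_twist cm (iter i (G e) (x e)).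
by rewrite -natr1 mulrDl mul1r; apply/andP; split; lra.
Qed.

Lemma orb_lim i : exists l : R, orb i @ U --> l.
Proof.
apply: (@ultra_bounded_cvg _ _ _ UU _ (`|x0| + 1 + i%:R * (T e0 + 1))).
have h1 : U [set e | `|x e - x0| < 1] by exact: cvg_dist.
have h2 : U [set e | `|T e - T e0| < 1] by exact: cvg_dist.
apply: filterS (filterI (orb_bounds i) (filterI h1 h2)) => e [] /andP[p1 p2] [] /= k1 k2.
move: k1 k2; rewrite !ltr_norml ler_norml => /andP[k1 k1'] /andP[k2 k2'].
have : i%:R * T e <= i%:R * (T e0 + 1) by rewrite ler_wpM2l //; lra.
have T0p : 0 < T e0 by exact: T0.
have : 0 <= i%:R * (T e0 + 1) by rewrite mulr_ge0 //; lra.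
have k3 := ler_norm x0; have k4 : - `|x0| <= x0 by rewrite lerNl ler_normr lexx orbT.
by move=> k5 k6; apply/andP; split; lra.
Qed.

(** Only the strict inequalities are not immediate in the limit. If two consecutive
    points collide, the normalized chord tends to the tangent direction; the
    reflection law then makes the next limit chord tangent as well, which is
    possible only if it collapses in the same way. So all the steps would be [0], or
    all of them a full turn. *)
Lemma orb_config : exists X : nat -> R, [/\ forall i, orb i @ U --> X i, X 0%N = x0,
  forall i, X i < X i.+1 < X i + T e0,
  forall i, X (i + n)%N = X i + m%:~R * T e0 &
  forall i, law (gam e0) (X i) (X i.+1) (X i.+2) = 0].
Proof.
have [X XP] := choice orb_lim.
have X0 : X 0%N = x0 by exact: (cvg_U_unique (XP 0%N) xx0).
have tw : forall i, U [set e | orb i e < orb i.+1 e < orb i e + T e].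
  by move=> i; apply: filterS UG => e cm; exact: (cm_twist cm (orb i e)).
have Xle i : X i <= X i.+1.
  rewrite -subr_ge0; apply: (cvgr_to_ge (cvgB (XP i.+1) (XP i))).
  by apply: filterS (tw i) => e /andP[h _]; rewrite /= subr_ge0 ltW.
have XleT i : X i.+1 <= X i + T e0.
  rewrite -subr_ge0; apply: (cvgr_to_ge (cvgB (cvgD (XP i) UT) (XP i.+1))).
  by apply: filterS (tw i) => e /andP[_ h]; rewrite /= subr_ge0 ltW.
have Xn i : X (i + n)%N = X i + m%:~R * T e0.
  have L : (fun e => orb i e + m%:~R * T e) @ U --> X i + m%:~R * T e0.
    by apply: cvgD => //; apply: cvgM => //; exact: cvg_cst.
  apply: (cvg_U_unique (XP (i + n)%N)); apply: cvg_trans L; apply: near_eq_cvg.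
  by apply: filterS UG => e cm; rewrite /orb addnC iterD (cm_iter cm).
have V i := v_ultra (XP i); have GG i := g_ultra (XP i).
have lawX i : law (gam e0) (X i) (X i.+1) (X i.+2) = 0.
  have L : (fun e => law (gam e) (orb i e) (orb i.+1 e) (orb i.+2 e)) @ U --> law (gam e0) (X i) (X i.+1) (X i.+2).
    have [V1 V2] := V i.+1; have [a1 a2] := GG i; have [b1 b2] := GG i.+1; have [c1 c2] := GG i.+2.
    apply: cvgD; apply: cvgM.
    - by apply: cvgD; apply: cvgM => //; exact: cvgB.
    - by apply: cvgB; apply: cvgM => //; exact: cvgB.
    - by apply: cvgD; apply: cvgM => //; exact: cvgB.
    - by apply: cvgB; apply: cvgM => //; exact: cvgB.
  apply: (cvg_U_unique L); apply: (@cvg_trans _ ((fun=> (0 : R)) @ U)); last exact: cvg_cst.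
  by apply: near_eq_cvg; apply: filterS UG => e cm; rewrite -(cm_law cm (orb i e)).
suff XS : forall i, X i < X i.+1 < X i + T e0 by exists X.
(* the normalized chords have limit directions even if the chords collapse *)
pose c1 i e := (gam e (orb i.+1 e)).1 - (gam e (orb i e)).1.
pose c2 i e := (gam e (orb i.+1 e)).2 - (gam e (orb i e)).2.
pose N i e := Num.max `|c1 i e| `|c2 i e|.
have N0 i : U [set e | 0 < N i e].
  apply: filterS (filterI UI (tw i)) => e [Ie t] /=; rewrite /N lt_max !normr_gt0.
  have := param_neq (cc_par (cc Ie)) t; apply: contraNT; rewrite negb_or !negbK.
  move=> /andP[/eqP h1 /eqP h2]; apply/eqP.
  rewrite [LHS]surjective_pairing [RHS]surjective_pairing; congr (_, _); apply/esym/eqP.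
    by rewrite -subr_eq0 -[X in X == _]/(c1 i e) h1.
  by rewrite -subr_eq0 -[X in X == _]/(c2 i e) h2.
have W (i : nat) : exists w : R * R, [/\ w != 0, (fun e => c1 i e / N i e) @ U --> w.1 &
    (fun e => c2 i e / N i e) @ U --> w.2].
  have B (c : R -> R) : (forall e, `|c e| <= N i e) -> exists l : R, (fun e => c e / N i e) @ U --> l.
    move=> cN; apply: (@ultra_bounded_cvg _ _ _ UU _ 1); apply: filterS (N0 i) => e /= Ne.
    by rewrite normf_div (gtr0_norm Ne) ler_pdivrMr // mul1r.
  have [|w1 W1] := B (c1 i); first by move=> e; rewrite le_max lexx.
  have [|w2 W2] := B (c2 i); first by move=> e; rewrite le_max lexx orbT.
  exists (w1, w2); split=> //; apply/eqP => -[E1 E2].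
  have L : (fun e => `|c1 i e / N i e| + `|c2 i e / N i e|) @ U --> `|w1| + `|w2|.
    by apply: cvgD; exact: cvg_norm.
  have : 1 <= `|w1| + `|w2|.
    apply: (cvgr_to_ge L); apply: filterS (N0 i) => e /= Ne.
    rewrite !normf_div (gtr0_norm Ne) -mulrDl ler_pdivlMr // mul1r.
    by rewrite /N ge_max lerDl lerDr !normr_ge0.
  by rewrite E1 E2 normr0 addr0 ler10.
have [w WP] := choice W.
pose vv i := v (X i).
(* the inequality keeps track of the orientation, which the equation forgets *)
have refl i : dot2 (vv i.+1) (w i) * det2 (vv i.+1) (w i.+1) + dot2 (vv i.+1) (w i.+1) * det2 (vv i.+1) (w i) = 0 /\
    0 <= dot2 (vv i.+1) (w i) * dot2 (vv i.+1) (w i.+1).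
  have [V1 V2] := V i.+1; have [_ wi1 wi2] := WP i; have [_ wj1 wj2] := WP i.+1.
  pose ve e := velocity (gam e) (orb i.+1 e).
  pose we k e : R * R := (c1 k e / N k e, c2 k e / N k e).
  have Ldi : (fun e => dot2 (ve e) (we i e)) @ U --> dot2 (vv i.+1) (w i).
    exact: (cvgD (cvgM V1 wi1) (cvgM V2 wi2)).
  have Ldj : (fun e => dot2 (ve e) (we i.+1 e)) @ U --> dot2 (vv i.+1) (w i.+1).
    exact: (cvgD (cvgM V1 wj1) (cvgM V2 wj2)).
  have Lki : (fun e => det2 (ve e) (we i e)) @ U --> det2 (vv i.+1) (w i).
    exact: (cvgB (cvgM V1 wi2) (cvgM V2 wi1)).
  have Lkj : (fun e => det2 (ve e) (we i.+1 e)) @ U --> det2 (vv i.+1) (w i.+1).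
    exact: (cvgB (cvgM V1 wj2) (cvgM V2 wj1)).
  have P : U [set e | dot2 (ve e) (we i e) * det2 (ve e) (we i.+1 e) +
      dot2 (ve e) (we i.+1 e) * det2 (ve e) (we i e) = 0 /\
      0 <= dot2 (ve e) (we i e) * dot2 (ve e) (we i.+1 e)].
    apply: filterS (filterI UG (filterI UI (filterI (tw i) (filterI (tw i.+1) (filterI (N0 i) (N0 i.+1)))))).
    move=> e [cm [Ie [t1 [t2 [n1 n2]]]]]; move: n1 n2 => /= n1 n2.
    have [ o _ Ho] := orientation (cc Ie).
    pose a := gam e (orb i e) - gam e (orb i.+1 e).
    pose b := gam e (orb i.+2 e) - gam e (orb i.+1 e).
    have ga : 0 < o * det2 (ve e) a.
      by apply: (chord_side (cc Ie) Ho); rewrite eq_sym; exact: (param_neq (cc_par (cc Ie)) t1).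
    have gb : 0 < o * det2 (ve e) b.
      by apply: (chord_side (cc Ie) Ho); exact: (param_neq (cc_par (cc Ie)) t2).
    have l0 : dot2 (ve e) a * det2 (ve e) b + dot2 (ve e) b * det2 (ve e) a = 0.
      exact: (cm_law cm (orb i e)).
    have E1 : dot2 (ve e) (we i e) = - (dot2 (ve e) a / N i e).
      by rewrite /dot2 /we /c1 /c2 /=; ring.
    have E2 : det2 (ve e) (we i e) = - (det2 (ve e) a / N i e).
      by rewrite /det2 /we /c1 /c2 /=; ring.
    have E3 : dot2 (ve e) (we i.+1 e) = dot2 (ve e) b / N i.+1 e.
      by rewrite /dot2 /we /c1 /c2 /=; ring.
    have E4 : det2 (ve e) (we i.+1 e) = det2 (ve e) b / N i.+1 e.
      by rewrite /det2 /we /c1 /c2 /=; ring.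
    rewrite E1 E2 E3 E4; move: l0 ga gb.
    move: (dot2 _ a) (det2 _ a) (dot2 _ b) (det2 _ b) => da ka db kb l0 ga gb.
    split.
      have -> : - (da / N i e) * (kb / N i.+1 e) + db / N i.+1 e * - (ka / N i e) =
        - (da * kb + db * ka) / (N i e * N i.+1 e).
        by field; rewrite !gt_eqF.
      by rewrite l0 oppr0 mul0r.
    have kk : 0 < ka * kb.
      have := mulr_gt0 ga gb; have -> : o * ka * (o * kb) = o ^+ 2 * (ka * kb) by ring.
      by apply: contraTT; rewrite -!leNgt => h; rewrite mulr_ge0_le0 ?sqr_ge0.
    have ka0 : ka != 0 by apply/eqP => h; move: kk; rewrite h mul0r ltxx.
    have kb0 : kb != 0 by apply/eqP => h; move: kk; rewrite h mulr0 ltxx.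
    have -> : - (da / N i e) * (db / N i.+1 e) = (- (da * db)) / (N i e * N i.+1 e).
      by field; rewrite !gt_eqF.
    apply: divr_ge0; last by rewrite ltW // mulr_gt0.
    have -> : - (da * db) = db ^+ 2 * (ka * kb) / kb ^+ 2.
      have -> : da = - (db * ka) / kb by apply/eqP; rewrite -(can2_eq (mulfK kb0) (divfK kb0)) eq_sym; apply/eqP; lra.
      by field.
    by apply: divr_ge0; [apply: mulr_ge0; [exact: sqr_ge0 | exact: ltW] | exact: sqr_ge0].
  split.
    have L : (fun e => dot2 (ve e) (we i e) * det2 (ve e) (we i.+1 e) +
        dot2 (ve e) (we i.+1 e) * det2 (ve e) (we i e)) @ U -->
        dot2 (vv i.+1) (w i) * det2 (vv i.+1) (w i.+1) + dot2 (vv i.+1) (w i.+1) * det2 (vv i.+1) (w i).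
      exact: (cvgD (cvgM Ldi Lkj) (cvgM Ldj Lki)).
    apply: (cvg_U_unique L); apply: (@cvg_trans _ ((fun=> (0 : R)) @ U)); last exact: cvg_cst.
    by apply: near_eq_cvg; apply: filterS P => e [-> _].
  by apply: (cvgr_to_ge (cvgM Ldi Ldj)); apply: filterS P => e [_ ?].
have vv0 i : vv i != 0 by exact: cc_reg (cc Ie0) _.
have w0 i : w i != 0 by have [] := WP i.
have cE i : U [set e | c1 i e = N i e * (c1 i e / N i e) /\ c2 i e = N i e * (c2 i e / N i e)].
  by apply: filterS (N0 i) => e /= Ne; split; rewrite mulrC divfK // gt_eqF.
(* a limit chord is tangent exactly when it collapses, forward if the step is
   zero and backward if it is a full turn *)
have typP i : X i.+1 = X i -> det2 (vv i) (w i) = 0 /\ 0 < dot2 (vv i) (w i).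
  move=> E; have [_ wi1 wi2] := WP i.
  have L1 : orb i.+1 @ U --> X i by rewrite -E.
  have [|K1 K2] := short_chord (w := w i) (XP i) L1 wi1 wi2 (N := N i).
    by apply: filterS (filterI (tw i) (filterI (N0 i) (cE i))) => e [/andP[h1 h2] [h3 [h4 h5]]].
  by split=> //; exact: dot_gt0.
have typM i : X i.+1 = X i + T e0 -> det2 (vv i) (w i) = 0 /\ dot2 (vv i) (w i) < 0.
  move=> E; have [_ wi1 wi2] := WP i.
  have L1 : (fun e => orb i.+1 e - T e) @ U --> X i.
    by rewrite -[X in _ --> X](addrK (T e0)) -E; exact: cvgB.
  have [|K1 K2] := short_chord (w := - w i) L1 (XP i) (cvgN wi1) (cvgN wi2) (N := N i).
    apply: filterS (filterI UI (filterI (tw i) (filterI (N0 i) (cE i)))) => e [Ie [/andP[h1 h2] [h3 [h4 h5]]]].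
    have pe : gam e (orb i.+1 e - T e) = gam e (orb i.+1 e).
      by have [_ p _ _] := cc_par (cc Ie); rewrite -[in RHS](subrK (T e) (orb i.+1 e)) p.
    rewrite /= pe !mulrN -h4 -h5 /c1 /c2; split=> //; [by rewrite ltrBlDr | ring | ring].
  have K3 : det2 (vv i) (- w i) = - det2 (vv i) (w i) by rewrite /det2 /=; ring.
  have K4 : dot2 (vv i) (- w i) = - dot2 (vv i) (w i) by rewrite /dot2 /=; ring.
  have K5 : 0 < dot2 (vv i) (- w i) by apply: dot_gt0; rewrite ?oppr_eq0.
  by split; [move: K1; rewrite -/(vv i) K3 => /eqP; rewrite oppr_eq0 => /eqP | move: K5; rewrite K4 oppr_gt0].
have typ0 i : X i < X i.+1 < X i + T e0 -> det2 (vv i) (w i) != 0.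
  move=> t; have [_ wi1 wi2] := WP i.
  pose C : R * R := gam e0 (X i.+1) - gam e0 (X i).
  have [b1 b2] := GG i; have [d1 d2] := GG i.+1.
  have C1 : c1 i @ U --> C.1 by exact: cvgB.
  have C2 : c2 i @ U --> C.2 by exact: cvgB.
  have E : (w i).1 * C.2 - (w i).2 * C.1 = 0.
    have L : (fun e => c1 i e / N i e * c2 i e - c2 i e / N i e * c1 i e) @ U --> (w i).1 * C.2 - (w i).2 * C.1.
      exact: (cvgB (cvgM wi1 C2) (cvgM wi2 C1)).
    apply: (cvg_U_unique L); apply: (@cvg_trans _ ((fun=> (0 : R)) @ U)); last exact: cvg_cst.
    by apply: near_eq_cvg; apply: nearW => e; ring.
  have [k Ek] := det2_param (w0 i) E.
  have [ o _ Ho] := orientation (cc Ie0).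
  have := chord_side (cc Ie0) Ho (param_neq (cc_par (cc Ie0)) t).
  rewrite -/C Ek -/(v (X i)) -/(vv i) => h; apply/eqP => h0; move: h.
  have -> : det2 (vv i) (k * (w i).1, k * (w i).2) = k * det2 (vv i) (w i) by rewrite /det2 /=; ring.
  by rewrite h0 !mulr0 ltxx.
have tri i : [\/ X i.+1 = X i, X i.+1 = X i + T e0 | X i < X i.+1 < X i + T e0].
  have := Xle i; rewrite le_eqVlt => /orP[/eqP ->|h1]; first by constructor 1.
  have := XleT i; rewrite le_eqVlt => /orP[/eqP h2|h2]; first by constructor 2.
  by constructor 3; rewrite h1.
have stepP i : X i.+1 = X i -> X i.+2 = X i.+1.
  move=> E; have [K1 K2] := typP i E; have [r1 r2] := refl i.
  have vE : vv i.+1 = vv i by rewrite /vv E.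
  move: r1 r2; rewrite vE K1 mulr0 addr0 => /eqP; rewrite mulf_eq0 gt_eqF //= => /eqP K3 r2.
  case: (tri i.+1) => // h; exfalso.
    have [_] := typM _ h; rewrite vE; move: r2; rewrite pmulr_rge0 //; lra.
  by have := typ0 _ h; rewrite vE K3 eqxx.
have stepM i : X i.+1 = X i + T e0 -> X i.+2 = X i.+1 + T e0.
  move=> E; have [K1 K2] := typM i E; have [r1 r2] := refl i.
  have vE : vv i.+1 = vv i.
    rewrite /vv E; have [_ per _ _] := cc_par (cc Ie0); exact: velocity_shift per.
  move: r1 r2; rewrite vE K1 mulr0 addr0 => /eqP; rewrite mulf_eq0 lt_eqF //= => /eqP K3 r2.
  case: (tri i.+1) => // h; exfalso.
    have [_] := typP _ h; rewrite vE; move: r2; rewrite nmulr_rge0 //; lra.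
  by have := typ0 _ h; rewrite vE K3 eqxx.
move=> i; case: (tri i) => // E; exfalso.
  have K k : X (i + k)%N = X i /\ X (i + k).+1 = X (i + k)%N.
    elim: k => [|k [IH1 IH2]]; first by rewrite addn0.
    by rewrite addnS IH2; split=> //; rewrite (stepP _ IH2).
  have := Xn i; rewrite (K n).1 => /eqP; rewrite -[X in X == _]addr0 (inj_eq (addrI _)) eq_sym.
  by rewrite mulf_eq0 (gt_eqF T0) orbF intr_eq0 gt_eqF.
have K k : X (i + k)%N = X i + k%:R * T e0 /\ X (i + k).+1 = X (i + k)%N + T e0.
  elim: k => [|k [IH1 IH2]]; first by rewrite addn0 mul0r addr0.
  rewrite addnS IH2; split; first by rewrite IH1 -natr1; ring.
  by rewrite -IH2 (stepM _ IH2).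
have Tn : T e0 != 0 by rewrite gt_eqF // T_pos.
have := Xn i; rewrite (K n).1 => /addrI/(mulIf Tn).
rewrite -[n%:R]/((n%:Z)%:~R) => /eqP; rewrite eqr_int; move: mn; lia.
Qed.

End Config.

(** The orbits of the maps [G e] from a point that moves with [e] have the same limit
    as those from the limit point, since two ordered configurations with the same
    origin coincide. Hence the limits of orbits are the orbits of one map. *)
Lemma limit_closing_map : exists Gs, closing_map (gam e0) (T e0) m n Gs /\
  forall s i, (fun e => iter i (G e) s) @ U --> iter i Gs s.
Proof.
have ccs (s : R) : (fun=> s) @ U --> s by exact: cvg_cst.
have [S SP] := choice (fun s => orb_config (ccs s)).
have S0 s : S s 0%N = s by have [_ -> _ _ _] := SP s.
have SL s i : (fun e => iter i (G e) s) @ U --> S s i by have [+ _ _ _ _] := SP s; apply.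
have c0 := cc Ie0; have [ o _ Ho] := orientation c0.
(* the common origin recurs after [n] steps, and [law_mono] propagates the
   equality from there *)
have rigid (X Y : nat -> R) : X 0%N = Y 0%N -> (forall i, X i <= Y i) ->
    (forall i, X i < X i.+1 < X i + T e0) -> (forall i, Y i < Y i.+1 < Y i + T e0) ->
    (forall i, X (i + n)%N = X i + m%:~R * T e0) ->
    (forall i, Y (i + n)%N = Y i + m%:~R * T e0) ->
    (forall i, law (gam e0) (X i) (X i.+1) (X i.+2) = 0) ->
    (forall i, law (gam e0) (Y i) (Y i.+1) (Y i.+2) = 0) -> forall i, X i = Y i.
  move=> XY0 XY tX tY pX pY lX lY.
  have step i : X i.+1 = Y i.+1 -> X i.+2 = Y i.+2.
    move=> E; have /andP[x1 x2] := tX i; have /andP[x3 x4] := tX i.+1.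
    have /andP[y1 y2] := tY i; have /andP[y3 y4] := tY i.+1.
    have lY' := lY i; rewrite -E in lY' y1 y2 y3 y4.
    by have [] := law_mono c0 Ho (XY i) y1 x2 x3 (XY i.+2) y4 (lX i) lY'.
  have all i : X (i + n)%N = Y (i + n)%N.
    elim: i => [|i IH]; first by rewrite pX pY XY0.
    move: IH; have -> : (i + n)%N = (i + n.-1).+1 by lia.
    have -> : (i.+1 + n)%N = (i + n.-1).+2 by lia.
    exact: step.
  by move=> i; have := all i; rewrite pX pY => /addIr.
have moving (x : R -> R) s : x @ U --> s -> forall i, (fun e => iter i (G e) (x e)) @ U --> S s i.
  move=> xs; have [X [XL X0 tX pX lX]] := orb_config xs.
  have [_ _ tS pS lS] := SP s.
  suff E : forall i, X i = S s i by move=> i; rewrite -E.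
  have mon (a b : R -> R) (A B : R) i : U [set e | a e <= b e] ->
      (fun e => iter i (G e) (a e)) @ U --> A -> (fun e => iter i (G e) (b e)) @ U --> B -> A <= B.
    move=> ab LA LB; rewrite -subr_ge0; apply: (cvgr_to_ge (cvgB LB LA)).
    apply: filterS (filterI UG ab) => e [cm /= h]; rewrite subr_ge0.
    by elim: (i) => //= k IH; apply: (cm_mono_le cm).
  have [Uc|Uc] := in_ultra_setVsetC [set e | x e <= s] UU.
    by apply: rigid => //; rewrite ?X0 ?S0 // => i; exact: mon Uc (XL i) (SL s i).
  have Uc' : U [set e | s <= x e] by apply: filterS Uc => e /= /negP; rewrite -ltNge => /ltW.
  move=> i; apply/esym; move: i.
  by apply: rigid => //; rewrite ?X0 ?S0 // => i; exact: mon Uc' (SL s i) (XL i).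
pose Gs s := S s 1%N.
have SS s i : S s i.+1 = S (Gs s) i.
  have L := moving (fun e => G e s) (Gs s) (SL s 1%N) i.
  apply: (cvg_U_unique (SL s i.+1)); apply: cvg_trans L; apply: near_eq_cvg.
  by apply: nearW => e; rewrite iterSr.
have it s i : iter i Gs s = S s i.
  by elim: i s => [|i IH] s; [rewrite S0 | rewrite iterSr IH SS].
have iterG s : iter n Gs s = s + m%:~R * T e0.
  by rewrite it; have [_ _ _ p _] := SP s; have := p 0%N; rewrite add0n S0.
exists Gs; split; last by move=> s i; rewrite it; exact: SL.
split=> //.
- move=> x y xy; rewrite lt_neqAle; apply/andP; split.
    apply/eqP => E; have : iter n Gs x = iter n Gs y.
      by rewrite -(prednK n0) !iterSr E.
    rewrite !iterG => /addIr E2; move: xy; rewrite E2 ltxx //.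
  rewrite -subr_ge0; apply: (cvgr_to_ge (cvgB (SL y 1%N) (SL x 1%N))).
  by apply: filterS UG => e cm; rewrite /= subr_ge0; apply: (cm_mono_le cm); exact: ltW.
- move=> s; have L1 : (fun e => s + T e) @ U --> s + T e0 by apply: cvgD => //; exact: cvg_cst.
  have L2 := moving _ _ L1 1%N.
  have L3 : (fun e => G e s + T e) @ U --> Gs s + T e0 by apply: cvgD => //; exact: (SL s 1%N).
  apply: (cvg_U_unique L2); apply: cvg_trans L3; apply: near_eq_cvg.
  by apply: filterS UG => e cm; rewrite /= (cm_per cm).
- by move=> s; have [_ _ t _ _] := SP s; have := t 0%N; rewrite S0.
move=> s; have [_ _ _ _ l] := SP s; have := l 0%N; rewrite S0 -/(Gs s).
by rewrite SS.
Qed.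

End LimitMap.
End Family.

(** * Linearization of the reflection law *)

Section Base.
Context {R : realType}.
Implicit Types (I : set R) (f : R -> R -> R).

Lemma fhat00 (c : nat -> nat -> R) : fhat c 0 0 = c 0%N 0%N.
Proof.
apply: cvg_lim => //; rewrite -(@cvg_shiftS _ (psum2 c 0 0)).
apply: (@cvg_trans _ ((fun=> c 0%N 0%N) @ \oo)); last exact: cvg_cst.
apply: near_eq_cvg; apply: nearW => D /=; apply/esym.
rewrite /psum2 big_ord_recl big_ord1 !expr0 !mulr1 big1 ?addr0 // => d _.
rewrite lift0 big1 // => i _; have [i0|i0] := posnP i.
  by rewrite i0 subn0 [X in _ * X]exprS mul0r mulr0.
by rewrite -(prednK i0) exprS mul0r mulr0 mul0r.
Qed.

Lemma family_base I f e0 (s : R) : family_series I f -> I e0 ->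
  exists (p : R -> R -> R) del, [/\ 0 < del,
    forall e s', I e -> `|e - e0| <= del -> `|s' - s| <= del -> f e s' = p (e - e0) (s' - s) &
    forall i, strict_diff (fun h y => p h (y i)) (f e0 s) (fun d => dpar f e0 s * d i)].
Proof.
move=> Sf Ie; have [c [K [B [del H]]]] := Sf e0 s Ie.
have [cB d0 _ Hf] := H; have [_ _ _ Hd] := srep_dpar H.
exists (fhat c), del; split=> // i.
have z x : `|x - x| <= del by rewrite subrr normr0 ltW.
have -> : f e0 s = c 0%N 0%N by rewrite Hf // !subrr fhat00.
have -> : dpar f e0 s = c 0%N 1%N.
  by rewrite Hd // ?subrr ?normr0 ?fhat00 ?divr_ge0 // ltW.
exact: strict_diff_base cB.
Qed.

End Base.

Section LawCoefs.
Context {R : realType}.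
Variables (A : set (R * R)) (g : R -> R * R) (T o : R).
Hypothesis cc : convex_curve A g T.
Hypothesis Ho : forall s p, A p -> 0 < o * det2 (velocity g s) (p - g s).

(** The derivative of the law with respect to its argument [x0]; by symmetry
    [lawP g x2 x1 x0] is the one with respect to [x2]. *)
Definition lawP g x0 x1 x2 : R := let v := velocity g x1 in
  dot2 v (velocity g x0) * det2 v (g x2 - g x1) + dot2 v (g x2 - g x1) * det2 v (velocity g x0).

(** At a reflection, moving either end forward decreases its cotangent. *)
Lemma law_coef_sign x0 x1 x2 : g x1 != g x0 -> g x1 != g x2 -> law g x0 x1 x2 = 0 ->
  0 < lawP g x0 x1 x2 * lawP g x2 x1 x0.
Proof.
move=> n0 n2; have d0 := chord_side cc Ho n0; have d2 := chord_side cc Ho n2.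
have e0 : 0 < o * det2 (velocity g x0) (g x1 - g x0) by apply: (chord_side cc Ho); rewrite eq_sym.
have e2 : 0 < o * det2 (velocity g x2) (g x1 - g x2) by apply: (chord_side cc Ho); rewrite eq_sym.
have v2 := normsq_gt0 cc x1.
rewrite /law /lawP /=; set v := velocity g x1 in d0 d2 v2 *.
set v0 := velocity g x0 in e0 *; set v2' := velocity g x2 in e2 *.
set a := g x0 - g x1 in d0 *; set b := g x2 - g x1 in d2 *.
have E0 : g x1 - g x0 = - a by rewrite /a opprB.
have E2 : g x1 - g x2 = - b by rewrite /b opprB.
rewrite E0 in e0; rewrite E2 in e2; move=> L.
have Q0 : (dot2 v v0 * det2 v b + dot2 v b * det2 v v0) * det2 v a =
    - (det2 v b * (v.1 ^+ 2 + v.2 ^+ 2) * det2 v0 (- a)).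
  have -> : (dot2 v v0 * det2 v b + dot2 v b * det2 v v0) * det2 v a =
    - (det2 v b * (v.1 ^+ 2 + v.2 ^+ 2) * det2 v0 (- a)) +
    det2 v v0 * (dot2 v a * det2 v b + dot2 v b * det2 v a) by rewrite /dot2 /det2 /=; ring.
  by rewrite L mulr0 addr0.
have Q2 : (dot2 v v2' * det2 v a + dot2 v a * det2 v v2') * det2 v b =
    - (det2 v a * (v.1 ^+ 2 + v.2 ^+ 2) * det2 v2' (- b)).
  have -> : (dot2 v v2' * det2 v a + dot2 v a * det2 v v2') * det2 v b =
    - (det2 v a * (v.1 ^+ 2 + v.2 ^+ 2) * det2 v2' (- b)) +
    det2 v v2' * (dot2 v a * det2 v b + dot2 v b * det2 v a) by rewrite /dot2 /det2 /=; ring.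
  by rewrite L mulr0 addr0.
set P := (dot2 v v0 * _ + _) in Q0 *; set S := (dot2 v v2' * _ + _) in Q2 *.
move: Q0 Q2 d0 d2 e0 e2 v2; move: P S (det2 v a) (det2 v b) (det2 v0 _) (det2 v2' _) (v.1 ^+ 2 + v.2 ^+ 2).
move=> P S ka kb ea eb vv Q0 Q2 d0 d2 e0 e2 v2.
have kk : 0 < ka * kb.
  have := mulr_gt0 d0 d2; have -> : o * ka * (o * kb) = o ^+ 2 * (ka * kb) by ring.
  by apply: contraTT; rewrite -!leNgt => h; rewrite mulr_ge0_le0 ?sqr_ge0.
have ee : 0 < ea * eb.
  have := mulr_gt0 e0 e2; have -> : o * ea * (o * eb) = o ^+ 2 * (ea * eb) by ring.
  by apply: contraTT; rewrite -!leNgt => h; rewrite mulr_ge0_le0 ?sqr_ge0.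
have : 0 < (P * S) * (ka * kb).
  have -> : (P * S) * (ka * kb) = (P * ka) * (S * kb) by ring.
  rewrite Q0 Q2; have -> : - (kb * vv * ea) * - (ka * vv * eb) = (ka * kb) * (ea * eb) * vv ^+ 2 by ring.
  by apply: mulr_gt0; [exact: mulr_gt0 | exact: exprn_gt0].
by rewrite pmulr_lgt0.
Qed.

End LawCoefs.

Section LawHat.
Context {R : realType}.
Variables (p1 p2 q1 q2 : nat -> R -> R -> R).

(** The law for curves given near each vertex by local representatives, [p1] and [p2]
    for the position and [q1] and [q2] for the velocity. *)
Definition lawhat (l j k : nat) (h : R) (y : nat -> R) : R :=
  let v := (q1 j h (y j), q2 j h (y j)) in
  let gj := (p1 j h (y j), p2 j h (y j)) in
  let a := (p1 l h (y l), p2 l h (y l)) - gj in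
  let b := (p1 k h (y k), p2 k h (y k)) - gj in
  dot2 v a * det2 v b + dot2 v b * det2 v a.

Lemma strict_diff_lawhat (P1 P2 D1 D2 W1 W2 : nat -> R) (l j k : nat) :
  (forall i, strict_diff (fun h y => p1 i h (y i)) (P1 i) (fun d => D1 i * d i)) ->
  (forall i, strict_diff (fun h y => p2 i h (y i)) (P2 i) (fun d => D2 i * d i)) ->
  strict_diff (fun h y => q1 j h (y j)) (D1 j) (fun d => W1 j * d j) ->
  strict_diff (fun h y => q2 j h (y j)) (D2 j) (fun d => W2 j * d j) ->
  let v := (D1 j, D2 j) in let w := (W1 j, W2 j) in
  let a := (P1 l, P2 l) - (P1 j, P2 j) in let b := (P1 k, P2 k) - (P1 j, P2 j) in
  strict_diff (lawhat l j k) (dot2 v a * det2 v b + dot2 v b * det2 v a)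
   (fun d => (dot2 v (D1 l, D2 l) * det2 v b + dot2 v b * det2 v (D1 l, D2 l)) * d l +
     ((dot2 w a - dot2 v v) * det2 v b + dot2 v a * det2 w b +
      (dot2 w b - dot2 v v) * det2 v a + dot2 v b * det2 w a) * d j +
     (dot2 v (D1 k, D2 k) * det2 v a + dot2 v a * det2 v (D1 k, D2 k)) * d k).
Proof.
move=> Hp1 Hp2 Hq1 Hq2 v w a b.
have Sa1 := strict_diff_add (Hp1 l) (strict_diff_opp (Hp1 j)).
have Sa2 := strict_diff_add (Hp2 l) (strict_diff_opp (Hp2 j)).
have Sb1 := strict_diff_add (Hp1 k) (strict_diff_opp (Hp1 j)).
have Sb2 := strict_diff_add (Hp2 k) (strict_diff_opp (Hp2 j)).
have Dota := strict_diff_add (strict_diff_mul Hq1 Sa1) (strict_diff_mul Hq2 Sa2).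
have Dotb := strict_diff_add (strict_diff_mul Hq1 Sb1) (strict_diff_mul Hq2 Sb2).
have Deta := strict_diff_add (strict_diff_mul Hq1 Sa2) (strict_diff_opp (strict_diff_mul Hq2 Sa1)).
have Detb := strict_diff_add (strict_diff_mul Hq1 Sb2) (strict_diff_opp (strict_diff_mul Hq2 Sb1)).
have L := strict_diff_add (strict_diff_mul Dota Detb) (strict_diff_mul Dotb Deta).
apply: (strict_diff_ext L) => [h y|d]; first by [].
by rewrite /v /w /a /b /dot2 /det2 /=; ring.
Qed.

End LawHat.

Section Tridiagonal.
Context {R : realType}.
Variables (n : nat) (P Q S w : nat -> R).
Hypothesis n1 : (1 < n)%N.
Hypothesis w0 : forall i, (i <= n)%N -> 0 < w i.
Hypothesis PS : forall v, (0 < v < n)%N -> 0 < P v * S v.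
Hypothesis Lw : forall v, (0 < v < n)%N -> P v * w v.-1 + Q v * w v + S v * w v.+1 = 0.

(** Discrete Sturm comparison: the Wronskian [d i.+1 * w i - w i.+1 * d i] keeps the
    sign of [d 1], so that [d / w] is monotone and cannot come back to zero. *)
Lemma tridiagonal_inj (d : nat -> R) : d 0%N = 0 -> d n = 0 ->
  (forall v, (0 < v < n)%N -> P v * d v.-1 + Q v * d v + S v * d v.+1 = 0) ->
  forall i, (i <= n)%N -> d i = 0.
Proof.
move=> d0 dn Ld.
have ratio i : (i < n)%N -> exists2 th, 0 < th & d i.+1 * w i - w i.+1 * d i = th * d 1%N.
  elim: i => [|i IH] iN; first by exists (w 0%N); [exact: w0 | rewrite d0 mulr0 subr0 mulrC].
  have [th th0 E] := IH (ltnW iN).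
  have iv : (0 < i.+1 < n)%N by rewrite iN.
  have S0 : S i.+1 != 0 by apply/eqP => h; have := PS iv; rewrite h mulr0 ltxx.
  exists (P i.+1 / S i.+1 * th).
    rewrite mulr_gt0 //; have -> : P i.+1 / S i.+1 = P i.+1 * S i.+1 / S i.+1 ^+ 2 by field.
    by rewrite divr_gt0 ?PS // exprn_even_gt0 //= S0.
  have Ew := Lw iv; have Ed := Ld _ iv; rewrite /= in Ew Ed.
  apply: (mulfI S0).
  have -> : S i.+1 * (P i.+1 / S i.+1 * th * d 1%N) = P i.+1 * (d i.+1 * w i - w i.+1 * d i).
    by rewrite E; field.
  have -> : S i.+1 * (d i.+2 * w i.+1 - w i.+2 * d i.+1) =
     (S i.+1 * d i.+2) * w i.+1 - (S i.+1 * w i.+2) * d i.+1 by ring.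
  have -> : S i.+1 * d i.+2 = - (P i.+1 * d i + Q i.+1 * d i.+1) by lra.
  have -> : S i.+1 * w i.+2 = - (P i.+1 * w i + Q i.+1 * w i.+1) by lra.
  ring.
have prop i : (i < n)%N -> exists2 th, 0 < th & d i.+1 / w i.+1 = th * d 1%N.
  elim: i => [|i IH] iN.
    by exists (w 1%N)^-1; [rewrite invr_gt0 w0 | rewrite mulrC].
  have [th th0 E] := IH (ltnW iN); have [th' th'0 E'] := ratio _ iN.
  have h1 : 0 < w i.+1 by apply: w0; exact: ltnW.
  have h2 : 0 < w i.+2 by apply: w0.
  exists (th + th' / (w i.+1 * w i.+2)); first by rewrite addr_gt0 // divr_gt0 // mulr_gt0.
  rewrite mulrDl -E mulrAC -E'; field; rewrite !gt_eqF //.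
have d1 : d 1%N = 0.
  have [th th0] := prop n.-1 ltac:(lia).
  rewrite prednK; last by lia.
  by rewrite dn mul0r => /esym/eqP; rewrite mulf_eq0 gt_eqF //= => /eqP.
case=> [//|i] iN; have [th th0] := prop i iN.
rewrite d1 mulr0 => /eqP; rewrite mulf_eq0 invr_eq0 [w _ == 0]gt_eqF ?w0 // orbF => /eqP //.
Qed.

End Tridiagonal.

(** * The cyclic linear system *)

Section CyclicSystem.
Context {R : realType}.
Variables (N : nat) (P Q S w : nat -> R).
Let n := N.+2.

Definition cyc (v : nat) (d : nat -> R) : R :=
  P v * d ((v + n.-1) %% n)%N + Q v * d v + S v * d (v.+1 %% n)%N.

Lemma cycD v x y : cyc v (fun i => x i + y i) = cyc v x + cyc v y.
Proof. by rewrite /cyc; ring. Qed.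

Lemma cycZ v a x : cyc v (fun i => a * x i) = a * cyc v x.
Proof. by rewrite /cyc; ring. Qed.

Lemma cyc_ext v x y : (v < n)%N -> (forall i, (i < n)%N -> x i = y i) -> cyc v x = cyc v y.
Proof. by move=> vn E; rewrite /cyc !E // ltn_pmod. Qed.

Lemma cyc_sum v J (s : seq J) (a : J -> R) (F : J -> nat -> R) :
  cyc v (fun i => \sum_(k <- s) a k * F k i) = \sum_(k <- s) a k * cyc v (F k).
Proof.
elim: s => [|k s IH].
  rewrite big_nil /cyc !big_nil; ring.
rewrite big_cons -IH -cycZ -cycD /cyc !big_cons //.
Qed.

Hypothesis w0 : forall i, (i < n)%N -> 0 < w i.
Hypothesis PS : forall v, (v < n)%N -> 0 < P v * S v.
Hypothesis cw : forall v, (v < n)%N -> cyc v w = 0.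

Lemma cyc_kernel d : d 0%N = 0 -> (forall v, (0 < v < n)%N -> cyc v d = 0) ->
  forall i, (i < n)%N -> d i = 0.
Proof.
move=> d0 cd.
have E v x : (0 < v < n)%N -> cyc v x = P v * x (v.-1 %% n)%N + Q v * x (v %% n)%N + S v * x (v.+1 %% n)%N.
  move=> /andP[v0 vn]; rewrite /cyc (modn_small vn).
  have -> : (v + n.-1 = v.-1 + n)%N by rewrite /n; lia.
  by rewrite modnDr.
move=> i iN.
have -> : d i = d (i %% n)%N by rewrite modn_small.
apply: (@tridiagonal_inj R n P Q S (fun i => w (i %% n)%N) isT _ _ _ (fun i => d (i %% n)%N)); last exact: ltnW.
- by move=> k _; apply: w0; rewrite ltn_pmod.
- by move=> v /andP[_ vn]; exact: PS.
- by move=> v vn; rewrite -E // cw //; case/andP: vn.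
- by rewrite mod0n.
- by rewrite modnn.
- by move=> v vn; rewrite -E // cd.
Qed.

Let col (u : 'rV[R]_N.+1) (i : nat) : R := \sum_(k < N.+1) u 0 k * (i == k.+1)%:R.

Let col0 u : col u 0%N = 0.
Proof. by rewrite /col big1 // => k _; rewrite mulr0. Qed.

Let colS u (k : 'I_N.+1) : col u k.+1 = u 0 k.
Proof.
rewrite /col (bigD1 k) //= eqxx mulr1 big1 ?addr0 // => l lk.
by rewrite eqSS (inj_eq val_inj) eq_sym (negbTE lk) mulr0.
Qed.

Let A : 'M[R]_N.+1 := \matrix_(i, j) cyc j.+1 (fun l => (l == i.+1)%:R).

Let colA u (j : 'I_N.+1) : (u *m A) 0 j = cyc j.+1 (col u).
Proof.
rewrite /col (cyc_sum _ _ (fun k : 'I_N.+1 => u 0 k) (fun k l => (l == k.+1)%:R)) mxE.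
by apply: eq_bigr => k _; rewrite mxE.
Qed.

Let A_unit : A \in unitmx.
Proof.
rewrite -row_free_unit; apply: inj_row_free => u uA.
apply/rowP => k; rewrite mxE -colS; apply: cyc_kernel; first exact: col0.
  move=> [//|v] /andP[_ vn]; have vN : (v < N.+1)%N by [].
  by have := colA u (Ordinal vN); rewrite uA mxE /= => <-.
by rewrite /n ltnS.
Qed.

(** Without the equation and the unknown of index [0] the system is square, and
    [cyc_kernel] makes it injective. *)
Lemma cyc_inverse : exists M : nat -> nat -> R,
  (forall d, d 0%N = 0 -> forall i, (0 < i <= N.+1)%N ->
     d i = \sum_(j < N.+1) M i j * cyc j.+1 d) /\
  (forall (v : nat -> R) j, (j < N.+1)%N ->
     cyc j.+1 (fun i => if (0 < i <= N.+1)%N then \sum_(j < N.+1) M i j * v j else 0) = v j).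
Proof.
exists (fun i j => invmx A (inord j) (inord i.-1)); split.
  move=> d d0 [//|i] /andP[_ iN]; rewrite ltnS in iN.
  pose u : 'rV[R]_N.+1 := \row_k d k.+1.
  have E j : (j < N.+1)%N -> cyc j.+1 d = cyc j.+1 (col u).
    move=> jN; apply: cyc_ext => // -[_|k kn]; first by rewrite col0.
    have kN : (k < N.+1)%N by [].
    by rewrite (colS u (Ordinal kN)) mxE.
  have := mulmxK A_unit u; move/rowP/(_ (Ordinal (iN : (i < N.+1)%N))); rewrite !mxE /= => <-.
  apply: eq_bigr => j _; rewrite colA E // inord_val [RHS]mulrC /=.
  by have -> : inord i = Ordinal (iN : (i < N.+1)%N) by apply: val_inj; rewrite /= inordK.
move=> v j jN; pose r : 'rV[R]_N.+1 := \row_k v k.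
have := mulmxKV A_unit r; move/rowP/(_ (Ordinal jN)); rewrite colA mxE /= => <-.
apply: cyc_ext => // -[_|k kn]; first by rewrite col0.
have kN : (k < N.+1)%N by [].
rewrite (colS _ (Ordinal kN)) mxE kN /=; apply: eq_bigr => l _.
rewrite mxE inord_val [RHS]mulrC /=.
by have -> : inord k = Ordinal kN by apply: val_inj; rewrite /= inordK.
Qed.

End CyclicSystem.

(** * Closed orbits near an orbit of a closing map *)

Section Chart.
Context {R : realType}.
Variables (I : set R) (Omega : R -> set (R * R)) (gam : R -> R -> R * R) (T : R -> R).
Let f1 e s := (gam e s).1.
Let f2 e s := (gam e s).2.
Hypothesis S1 : family_series I f1.
Hypothesis S2 : family_series I f2.
Hypothesis cc : forall e, I e -> convex_curve (Omega e) (gam e) (T e).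
Variables (m : int) (N : nat).
Let n := N.+2.

Definition config e s (x : nat -> R) := [/\ x 0%N = s,
  forall i, x (i + n)%N = x i + m%:~R * T e &
  forall i, law (gam e) (x i) (x i.+1) (x i.+2) = 0].

Lemma config_modn e (x : nat -> R) : (forall i, x (i + n)%N = x i + m%:~R * T e) ->
  forall i, x i = x (i %% n)%N + ((i %/ n)%:Z * m)%:~R * T e.
Proof.
move=> px i; rewrite {1}(divn_eq i n); elim: (i %/ n)%N => [|k IH].
  by rewrite mul0n add0n mul0r mulr0z mul0r addr0.
have -> : (k.+1 * n + i %% n = k * n + i %% n + n)%N by rewrite mulSn; lia.
by rewrite px IH -addn1 PoszD mulrDl mul1r intrD mulrDl addrA.
Qed.

Lemma law_modn e (x : nat -> R) a b c : I e -> (forall i, x (i + n)%N = x i + m%:~R * T e) ->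
  law (gam e) (x (a %% n)%N) (x (b %% n)%N) (x (c %% n)%N) = law (gam e) (x a) (x b) (x c).
Proof.
move=> Ie px; rewrite (config_modn px a) (config_modn px b) (config_modn px c) law_shift //.
by have [_ per _ _] := cc_par (cc Ie).
Qed.

Lemma gam_modn e (x : nat -> R) i : I e -> (forall i, x (i + n)%N = x i + m%:~R * T e) ->
  gam e (x (i %% n)%N) = gam e (x i).
Proof.
by move=> Ie px; rewrite (config_modn px i) (param_int (cc_par (cc Ie))).
Qed.

Lemma closing_config e s G : closing_map (gam e) (T e) m n G -> config e s (fun i => iter i G s).
Proof.
move=> cm; split=> // i; last exact: (cm_law cm).
rewrite addnC iterD (cm_iter cm) //.
Qed.

Lemma common_del (del : nat -> R) k : (forall i, 0 < del i) ->
  exists2 d, 0 < d & forall i, (i < k)%N -> d <= del i.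
Proof.
move=> d0; elim: k => [|k [d dp IH]]; first by exists 1.
exists (Num.min d (del k)); first by rewrite lt_min dp d0.
move=> i; rewrite ltnS leq_eqVlt => /orP[/eqP ->|/IH h]; first by rewrite ge_min lexx orbT.
by rewrite ge_min h.
Qed.

Section AtPoint.
Variables (e0 s0 : R) (G : R -> R).
Hypothesis Ie0 : I e0.
Hypothesis cm : closing_map (gam e0) (T e0) m n G.
Let X i := iter i G s0.

(** The reflection laws at the [n] vertices, as functions of the displacements of the
    vertices. Indices are taken modulo [n], since the law is invariant under
    translations of its arguments by periods. *)
Lemma chart_eqs : exists (E : nat -> R -> (nat -> R) -> R) P Q S del, [/\ 0 < del,
  forall v e x y, (v < n)%N -> I e -> `|e - e0| <= del ->
     (forall i, x (i + n)%N = x i + m%:~R * T e) ->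
     (forall i, (i < n)%N -> y i = x i - X i /\ `|y i| <= del) ->
     E v (e - e0) y = law (gam e) (x (v + n.-1)%N) (x (v + n)%N) (x (v + n).+1),
  forall v, (v < n)%N -> strict_diff (E v) 0 (cyc N P Q S v) &
  forall v, (v < n)%N -> 0 < P v * S v].
Proof.
have [p1 Hp1] := choice (fun i => family_base (X i) S1 Ie0).
have [p2 Hp2] := choice (fun i => family_base (X i) S2 Ie0).
have [q1 Hq1] := choice (fun i => family_base (X i) (family_dpar S1) Ie0).
have [q2 Hq2] := choice (fun i => family_base (X i) (family_dpar S2) Ie0).
have [dp1 {}Hp1] := choice Hp1; have [dp2 {}Hp2] := choice Hp2.
have [dq1 {}Hq1] := choice Hq1; have [dq2 {}Hq2] := choice Hq2.
have [|del d0 Hdel] := @common_del (fun i => Num.min (Num.min (dp1 i) (dp2 i)) (Num.min (dq1 i) (dq2 i))) n.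
  move=> i; have [h1 _ _] := Hp1 i; have [h2 _ _] := Hp2 i.
  by have [h3 _ _] := Hq1 i; have [h4 _ _] := Hq2 i; rewrite !lt_min h1 h2 h3 h4.
have c0 := cc Ie0; have [_ cX lX] := closing_config s0 cm.
pose W1 i := dpar (dpar f1) e0 (X i); pose W2 i := dpar (dpar f2) e0 (X i).
pose V i := velocity (gam e0) (X i).
pose pr v := ((v + n.-1) %% n)%N; pose nx v := (v.+1 %% n)%N.
pose a l j := gam e0 (X l) - gam e0 (X j).
pose Q v := let w := (W1 v, W2 v) in
  (dot2 w (a (pr v) v) - dot2 (V v) (V v)) * det2 (V v) (a (nx v) v) + dot2 (V v) (a (pr v) v) * det2 w (a (nx v) v) +
  (dot2 w (a (nx v) v) - dot2 (V v) (V v)) * det2 (V v) (a (pr v) v) + dot2 (V v) (a (nx v) v) * det2 w (a (pr v) v).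
pose P v := lawP (gam e0) (X (pr v)) (X v) (X (nx v)).
pose S v := lawP (gam e0) (X (nx v)) (X v) (X (pr v)).
have law0 v : (v < n)%N -> law (gam e0) (X (pr v)) (X v) (X (nx v)) = 0.
  move=> vn; have := law_modn (v + n.-1) v v.+1 Ie0 cX; rewrite (modn_small vn) => ->.
  have := lX (v + n.-1)%N; have -> : (v + n.-1).+1 = (v + n)%N by rewrite /n; lia.
  have -> : (v + n).+1 = (v.+1 + n)%N by rewrite /n; lia.
  rewrite !cX; have [_ per _ _] := cc_par c0.
  have := law_shift 0 m m (X (v + n.-1)%N) (X v) (X v.+1) per.
  by rewrite mulr0z mul0r addr0 => ->.
exists (fun v => lawhat p1 p2 q1 q2 (pr v) v (nx v)), P, Q, S, del; split=> //.
- move=> v e x y vn Ie he px hx.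
  have H i : (i < n)%N -> [/\ f1 e (x i) = p1 i (e - e0) (x i - X i), f2 e (x i) = p2 i (e - e0) (x i - X i),
      dpar f1 e (x i) = q1 i (e - e0) (x i - X i) & dpar f2 e (x i) = q2 i (e - e0) (x i - X i)].
    move=> iN; have dl := Hdel i iN; have [hy hi] := hx i iN; rewrite hy in hi.
    move: dl; rewrite !le_min => /andP[/andP[l1 l2] /andP[l3 l4]].
    have [_ h1 _] := Hp1 i; have [_ h2 _] := Hp2 i; have [_ h3 _] := Hq1 i; have [_ h4 _] := Hq2 i.
    by split; [apply: h1 | apply: h2 | apply: h3 | apply: h4] => //;
      (apply: le_trans l1 || apply: le_trans l2 || apply: le_trans l3 || apply: le_trans l4).
  have [A1 A2 _ _] := H (pr v) ltac:(by rewrite ltn_pmod).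
  have [B1 B2 B3 B4] := H v vn.
  have [C1 C2 _ _] := H (nx v) ltac:(by rewrite ltn_pmod).
  have := law_modn (v + n.-1) (v + n) (v + n).+1 Ie px.
  have -> : ((v + n).+1 = v.+1 + n)%N by rewrite /n; lia.
  rewrite !modnDr (modn_small vn) => <-.
  have [ypr _] := hx (pr v) ltac:(by rewrite ltn_pmod).
  have [yv _] := hx v vn.
  have [ynx _] := hx (nx v) ltac:(by rewrite ltn_pmod).
  rewrite /lawhat /= ypr yv ynx -A1 -A2 -B1 -B2 -B3 -B4 -C1 -C2 -/(pr v) -/(nx v).
  by rewrite /law /dot2 /det2.
- move=> v vn; have := @strict_diff_lawhat R p1 p2 q1 q2 (fun i => f1 e0 (X i)) (fun i => f2 e0 (X i))
    (fun i => dpar f1 e0 (X i)) (fun i => dpar f2 e0 (X i)) W1 W2 (pr v) v (nx v) _ _ _ _.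
  have Hf1 i : strict_diff (fun h y => p1 i h (y i)) (f1 e0 (X i)) (fun d => dpar f1 e0 (X i) * d i).
    by have [_ _] := Hp1 i; apply.
  have Hf2 i : strict_diff (fun h y => p2 i h (y i)) (f2 e0 (X i)) (fun d => dpar f2 e0 (X i) * d i).
    by have [_ _] := Hp2 i; apply.
  have Hg1 : strict_diff (fun h y => q1 v h (y v)) (dpar f1 e0 (X v)) (fun d => W1 v * d v).
    by have [_ _] := Hq1 v; apply.
  have Hg2 : strict_diff (fun h y => q2 v h (y v)) (dpar f2 e0 (X v)) (fun d => W2 v * d v).
    by have [_ _] := Hq2 v; apply.
  move=> /(_ Hf1 Hf2 Hg1 Hg2) /=.
  have := law0 v vn; rewrite {1}/law => l0; rewrite -[X in strict_diff _ X _]/(dot2 (V v) (a (pr v) v) * det2 (V v) (a (nx v) v) + dot2 (V v) (a (nx v) v) * det2 (V v) (a (pr v) v)) l0.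
  by move=> H; apply: (strict_diff_ext H).
move=> v vn; have [ o _ Ho] := orientation c0.
have lv := lX (v + n.-1)%N.
have tw i : gam e0 (X i) != gam e0 (X i.+1).
  by apply: (param_neq (cc_par c0)); exact: (cm_twist cm).
have nq : gam e0 (X v) != gam e0 (X (nx v)) by rewrite /nx gam_modn.
have np : gam e0 (X v) != gam e0 (X (pr v)).
  rewrite /pr gam_modn // eq_sym; have := tw (v + n.-1)%N.
  have -> : (v + n.-1).+1 = (v + n)%N by rewrite /n; lia.
  have -> : X (v + n)%N = X v + m%:~R * T e0 by exact: cX.
  by rewrite (param_int (cc_par c0)).
exact: (law_coef_sign c0 Ho np nq (law0 v vn)).
Qed.

Lemma orbit_cont i : forall eta, 0 < eta -> exists2 d, 0 < d &
  forall s, `|s - s0| < d -> `|iter i G s - X i| < eta.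
Proof.
move=> eta eta0.
have ci : continuous (iter i G).
  elim: i => [|i IH] s; first exact: cvg_id.
  by apply: (@continuous_comp _ _ _ (iter i G) G); [exact: IH | exact: (cm_continuous (isT : (0 < n)%N) cm)].
by have /cvgrPdist_lt/(_ eta eta0)/nearE_dist[d d0 H] := ci s0; exists d => // s sd; rewrite distrC; exact: H.
Qed.

(** The displacements from the orbit of [s0] to those of larger [s] are positive,
    because the closing map is increasing. Normalized by their sum and taken to the
    limit along an ultrafilter, they solve the linearized equations. A zero
    component would propagate to all of them, since the outer coefficients of an
    equation have the same sign. *)
Lemma positive_jacobi (E : nat -> R -> (nat -> R) -> R) P Q S del : 0 < del ->
  (forall v e x y, (v < n)%N -> I e -> `|e - e0| <= del ->
     (forall i, x (i + n)%N = x i + m%:~R * T e) ->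
     (forall i, (i < n)%N -> y i = x i - X i /\ `|y i| <= del) ->
     E v (e - e0) y = law (gam e) (x (v + n.-1)%N) (x (v + n)%N) (x (v + n).+1)) ->
  (forall v, (v < n)%N -> strict_diff (E v) 0 (cyc N P Q S v)) ->
  (forall v, (v < n)%N -> 0 < P v * S v) ->
  exists w, (forall i, (i < n)%N -> 0 < w i) /\ forall v, (v < n)%N -> cyc N P Q S v w = 0.
Proof.
move=> d0 HE SD PS.
pose t (k : nat) : R := s0 + k.+1%:R^-1.
pose y (k i : nat) : R := if (i < n)%N then iter i G (t k) - X i else 0.
have ypos k i : (i < n)%N -> 0 < y k i.
  move=> iN; rewrite /y iN subr_gt0 /X.
  have : s0 < t k by rewrite /t ltrDl invr_gt0.
  by elim: (i) => //= j IH h; apply: (cm_mono cm); exact: IH.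
have yge k i : 0 <= y k i.
  by case: (ltnP i n) => iN; [exact/ltW/ypos | rewrite /y ltnNge iN].
pose D k : R := \sum_(i < n) y k i.
have yD k i : y k i <= D k.
  case: (ltnP i n) => iN; last by rewrite {1}/y ltnNge iN /=; exact: sumr_ge0.
  by rewrite /D (bigD1 (Ordinal iN)) //= lerDl sumr_ge0.
have D0 k : 0 < D k by apply: lt_le_trans (yD k 0%N); exact: ypos.
have small eta : 0 < eta -> \forall k \near \oo, D k < eta.
  move=> eta0.
  have K i : \forall k \near \oo, y k i < eta / n.+1%:R.
    have e1 : 0 < eta / n.+1%:R by rewrite divr_gt0.
    have [d dp Hd] := orbit_cont i e1.
    near=> k; rewrite /y; case: ifP => // iN.
    apply: le_lt_trans (ler_norm _) _; apply: Hd.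
    rewrite /t addrAC subrr add0r gtr0_norm ?invr_gt0 //.
    by near: k; exact: (near_infty_natSinv_lt (PosNum dp)).
  have {}K : \forall k \near \oo, forall i : 'I_n, y k i < eta / n.+1%:R by apply: filter_forall => i; exact: K.
  near=> k; have Kk : forall i : 'I_n, y k i < eta / n.+1%:R by near: k.
  apply: (@le_lt_trans _ _ (\sum_(i < n) eta / n.+1%:R)).
    by apply: ler_sum => i _; exact/ltW/Kk.
  rewrite sumr_const card_ord -[_ *+ n]mulr_natr mulrAC ltr_pdivrMr // ltr_pM2l //.
  by rewrite ltr_nat.
have [U [UU oU]] := ultraFilterLemma (eventually_filter).
have W0 i : exists l : R, (fun k => y k i / D k) @ U --> l.
  apply: (@ultra_bounded_cvg _ _ _ UU _ 1); apply: filterS filterT => k _ /=.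
  have h : 0 <= y k i / D k by rewrite divr_ge0 // ltW.
  by rewrite (ger0_norm h) ler_pdivrMr // mul1r.
have [w W] := choice W0.
have wge i : 0 <= w i.
  by apply: (cvgr_to_ge (W i)); apply: filterS filterT => k _; rewrite divr_ge0 // ltW.
have c0 := cc Ie0; have [_ cX lX] := closing_config s0 cm.
have cw v : (v < n)%N -> cyc N P Q S v w = 0.
  move=> vn; have [K [rho0 [K0 r0 r1 HK]]] := SD v vn.
  have L : (fun k => cyc N P Q S v (fun i => y k i / D k)) @ U --> cyc N P Q S v w.
    by apply: cvgD; [apply: cvgD|]; (apply: cvgM; [exact: cvg_cst | exact: W]).
  apply/eqP; rewrite -normr_le0; apply/ler_addgt0Pr => eta eta0; rewrite add0r.
  apply: (cvgr_to_le (cvg_norm L)).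
  have m1 : 0 < Num.min (Num.min rho0 del) (eta / (K + 1)).
    by rewrite !lt_min r0 d0 divr_gt0 // ltr_wpDl.
  apply: filterS (oU _ (small _ m1)) => k /=; rewrite !lt_min => /andP[/andP[k1 k2] k3].
  have E0 z x : config e0 (x 0%N) x -> (forall i, (i < n)%N -> z i = x i - X i /\ `|z i| <= del) -> E v 0 z = 0.
    move=> [_ ct lt] hz; have := HE v e0 x z vn Ie0.
    rewrite subrr normr0 => /(_ (ltW d0) ct hz) ->; rewrite -[RHS](lt (v + n.-1)%N).
    by have -> : (v + n.-1).+1 = (v + n)%N by rewrite /n; lia.
  have E1 : E v 0 (y k) = 0.
    apply: (E0 _ _ (closing_config (t k) cm)) => i iN.
    by rewrite {1}/y iN; split=> //; rewrite ger0_norm // (le_trans (yD k i)) // ltW.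
  have E2 : E v 0 (fun=> 0) = 0.
    by apply: (E0 _ _ (closing_config s0 cm)) => i iN; rewrite subrr normr0 ltW.
  have nD : `|0 : R| < D k by rewrite normr0.
  have [_ H] := HK _ _ _ (fnorm_at nD) (D k) (lexx _) (ltW (D0 k)) (ltW k1).
  have [] := H (fun i _ => y k i) (fun _ _ => 0) (D k) (ltW (D0 k)).
  - by move=> i /=; rewrite ger0_norm.
  - by move=> i /=; rewrite normr0 ltW.
  - by move=> i /=; rewrite subr0 ger0_norm.
  rewrite /= E1 E2 subrr sub0r normrN => H1 _.
  have -> : cyc N P Q S v (fun i => y k i / D k) = (D k)^-1 * cyc N P Q S v (fun i => y k i - 0).
    by rewrite /cyc; ring.
  rewrite normrM gtr0_norm ?invr_gt0 // mulrC ler_pdivrMr //.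
  apply: (le_trans H1); apply: ler_wpM2r; first exact: ltW.
  move: k3; rewrite ltr_pdivlMr ?ltr_wpDl // => k3; apply: le_trans (ltW k3).
  by rewrite mulrC ler_wpM2l ?lerDl // ltW.
exists w; split=> //.
have wsum : \sum_(i < n) w i = 1.
  have L : (fun k => \sum_(i < n) y k i / D k) @ U --> \sum_(i < n) w i.
    by apply: cvg_sumr => i; exact: W.
  have L2 : (fun k => \sum_(i < n) y k i / D k) @ U --> (1 : R).
    apply: (@cvg_trans _ ((fun=> (1 : R)) @ U)); last exact: cvg_cst.
    apply: near_eq_cvg; apply: filterS filterT => k _.
    by rewrite /= -mulr_suml -/(D k) divff ?gt_eqF.
  exact: (cvg_unique _ L L2).
have step i : (i < n)%N -> w i = 0 -> w (i.+1 %% n)%N = 0.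
  move=> iN wi; have := cw i iN; rewrite /cyc wi mulr0 addr0.
  set a := w _; set b := w _ => H; have a0 : 0 <= a by exact: wge.
  have b0 : 0 <= b by exact: wge.
  have ps := PS i iN.
  have : (P i * S i) * a + S i ^+ 2 * b = 0.
    by have := congr1 (fun z => S i * z) H; rewrite mulr0 => <-; ring.
  have S0 : S i != 0 by apply/eqP => h; move: ps; rewrite h mulr0 ltxx.
  have h1 : 0 <= P i * S i * a by apply: mulr_ge0 => //; exact: ltW.
  have h2 : 0 <= S i ^+ 2 * b by apply: mulr_ge0 => //; exact: sqr_ge0.
  move/eqP; rewrite (paddr_eq0 h1 h2) => /andP[_].
  by rewrite mulf_eq0 sqrf_eq0 (negbTE S0) /= => /eqP.
move=> i iN; rewrite lt_neqAle wge andbT eq_sym; apply/eqP => wi.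
have all k : w ((i + k) %% n)%N = 0.
  elim: k => [|k IH]; first by rewrite addn0 modn_small.
  by have := step _ (ltn_pmod (i + k) (isT : (0 < n)%N)) IH; rewrite -(addn1 ((i + k) %% n)) modnDml addn1 -addnS.
have : \sum_(j < n) w j = 0.
  apply: big1 => j _; have := all (j + (n - i))%N.
  have -> : (i + (j + (n - i)) = j + n)%N by lia.
  by rewrite modnDr modn_small.
by rewrite wsum => /eqP; rewrite oner_eq0.
Unshelve. all: by end_near. Qed.

Let trunc (x : nat -> R) (i : nat) : R := if (i < n)%N then x i - X i else 0.

Lemma config_law0 e s x : config e s x -> forall v,
  law (gam e) (x (v + n.-1)%N) (x (v + n)%N) (x (v + n).+1) = 0.
Proof.
move=> [_ _ lx] v; rewrite -[RHS](lx (v + n.-1)%N).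
by have -> : (v + n.-1).+1 = (v + n)%N by rewrite /n; lia.
Qed.

Lemma chart_unique : exists t K : R, [/\ 0 < t, 0 <= K &
  forall (e : R) (x x' : nat -> R) (s s' : R), I e -> `|e - e0| < t -> config e s x -> config e s' x' ->
   (forall i, (i < n)%N -> `|x i - X i| <= t) -> (forall i, (i < n)%N -> `|x' i - X i| <= t) ->
   forall i, (i < n)%N -> `|x i - x' i| <= K * `|s - s'|].
Proof.
have [E [P [Q [S [del [d0 HE SD PS]]]]]] := chart_eqs.
have [w [w0 cw]] := positive_jacobi d0 HE SD PS.
have [M [M1 M2]] := cyc_inverse w0 PS cw.
have [||||rho [K [rho0 K0 HU]]] := @implicit_unique R N.+1 (fun j => E j.+1) (fun j => cyc N P Q S j.+1) M.
- by move=> j jN; apply: SD.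
- by move=> j x y; exact: cycD.
- by move=> j a x; exact: cycZ.
- exact: M1.
exists (Num.min rho del), K; split=> //; first by rewrite lt_min rho0.
move=> e x x' s s' Ie; rewrite lt_min => /andP[e1 e2] cx cx' hx hx' i iN.
have tr z sz : config e sz z -> (forall i, (i < n)%N -> `|z i - X i| <= Num.min rho del) ->
    (forall i, `|trunc z i| <= rho) /\ (forall j, (j < N.+1)%N -> E j.+1 (e - e0) (trunc z) = 0).
  move=> cz hz; split=> [k|j jN].
    rewrite /trunc; case: ifP => kN; last by rewrite normr0 ltW.
    by apply: le_trans (hz k kN) _; rewrite ge_min lexx.
  have [_ pz _] := cz.
  rewrite (HE j.+1 e z (trunc z) _ Ie (ltW e2) pz) ?(config_law0 cz) // => k kN.
  by rewrite /trunc kN; split=> //; apply: le_trans (hz k kN) _; rewrite ge_min lexx orbT.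
have [b1 E1] := tr x s cx hx; have [b2 E2] := tr x' s' cx' hx'.
have := HU (e - e0) (trunc x) (trunc x') e1 b1 b2 _ E1 E2 i.
rewrite /trunc iN /=; have [-> _ _] := cx; have [-> _ _] := cx'.
rewrite !opprB !addrA !subrK; apply.
by move=> k kN; rewrite ltnNge kN.
Qed.

Section LimitParameter.
Variables (U : set_system R) (Gf : R -> R -> R).
Hypothesis UU : UltraFilter U.
Hypothesis UI : U I.
Hypothesis Ue0 : id @ U --> e0.
Hypothesis Un : U [set e | e != e0].
Hypothesis UG : U [set e | closing_map (gam e) (T e) m n (Gf e)].
Hypothesis UL : forall s i, (fun e => iter i (Gf e) s) @ U --> iter i G s.

(** The implicit function theorem solves all the equations but one, with solutions
    analytic in [e]. Along the ultrafilter these solutions are the orbits of the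
    closing maps, so that the remaining equation has zeros that accumulate at
    [e0]. *)
Lemma chart_exists (theta : R) : 0 < theta -> exists2 d : R, 0 < d &
  forall e s : R, I e -> `|e - e0| < d -> `|s - s0| < d ->
    exists2 x, config e s x & forall i, (i < n)%N -> `|x i - X i| <= theta.
Proof.
move=> th0.
have [E [P [Q [S [del [d0 HE SD PS]]]]]] := chart_eqs.
have [w [w0 cw]] := positive_jacobi d0 HE SD PS.
have [M [M1 M2]] := cyc_inverse w0 PS cw.
have SD' j : (j < N.+1)%N -> strict_diff (E j.+1) 0 (cyc N P Q S j.+1) by move=> jN; apply: SD.
have [||||rho [K [rho0 K0 HU]]] := @implicit_unique R N.+1 (fun j => E j.+1) (fun j => cyc N P Q S j.+1) M => //.
- by move=> j x y; exact: cycD.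
- by move=> j a x; exact: cycZ.
have [||||rho2 rho20 HX] := @implicit_exists R N.+1 (fun j => E j.+1) (fun j => cyc N P Q S j.+1) M => //.
- by move=> j a x; exact: cycZ.
have [K3 [rho3 [K30 r30 _ HS0]]] := SD 0%N isT.
pose th := Num.min (Num.min theta rho) (Num.min (Num.min rho2 rho3) del).
have th_gt0 : 0 < th by rewrite !lt_min th0 rho0 rho20 r30 d0.
have [t1 t2 t3 t4 t5] : [/\ th <= theta, th <= rho, th <= rho2, th <= rho3 & th <= del].
  by rewrite /th; split; rewrite !ge_min lexx ?orbT.
have [del2 [d20 d2th HX2]] := HX th th_gt0 t3.
have [d3 d30 Hd3] : exists2 d, 0 < d & forall s i, (i < n)%N -> `|s - s0| < d -> `|iter i G s - X i| < th / 2.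
  have h2 : 0 < th / 2 by rewrite divr_gt0.
  have H i : exists d, 0 < d /\ forall s, `|s - s0| < d -> `|iter i G s - X i| < th / 2.
    by have [d dp Hd] := orbit_cont i h2; exists d.
  have [dd Hdd] := choice H.
  have [d dp Hd] := @common_del dd n (fun i => (Hdd i).1).
  by exists d => // s i iN sd; apply: (Hdd i).2; apply: lt_le_trans (Hd i iN).
exists (Num.min del2 d3); first by rewrite lt_min d20.
move=> e s Ie; rewrite !lt_min => /andP[e1 _] /andP[s1 s2].
have [y [yps y0 yN yE]] := HX2 (s - s0) (ltW s1).
have ev i h : `|h| < del2 -> `|y i h| <= th by move=> hd; exact: ps_ev (yps i) hd.
have G0 : forall h, `|h| < del2 -> E 0%N h (y^~ h) = 0.
  have pG : ps del2 (K3 * th) (fun h => E 0%N h (y^~ h)).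
    have [H _] := HS0 _ _ _ (fnorm_ps d20) th d2th (ltW th_gt0) t4.
    by apply: fn_ext (H y yps) => h; rewrite subr0.
  apply: (ps_zero (Z := fun=> True) d20 pG) => d dp.
  have m1 : 0 < Num.min d del2 by rewrite lt_min dp d20.
  have UX : U [set e | forall i : 'I_n, `|iter i (Gf e) s - iter i G s| < th / 2].
    have th2 : 0 < th / 2 by rewrite divr_gt0.
    have UXi (i : 'I_n) := cvg_dist (@UL s i) th2.
    exact: (@filter_forall _ _ (fun (i : 'I_n) e => `|iter i (Gf e) s - iter i G s| < th / 2) U _ UXi).
  have [e' [Ie' [/= ne [cm' [ed ex]]]]] := filter_ex (filterI UI (filterI Un (filterI UG (filterI (cvg_dist Ue0 m1) UX)))).
  move: ed => /=; rewrite lt_min => /andP[ed1 ed2].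
  exists (e' - e0); split=> //; first by rewrite subr_eq0.
  pose x i := iter i (Gf e') s.
  have cx : config e' s x by exact: closing_config.
  have hx i : (i < n)%N -> `|x i - X i| <= th.
    move=> iN; have h1 := ex (Ordinal iN); have h2 := Hd3 s i iN s2.
    have -> : x i - X i = (iter i (Gf e') s - iter i G s) + (iter i G s - X i) by rewrite /x; ring.
    apply: (le_trans (ler_normD _ _)); rewrite /= in h1; lra.
  have trb i : `|trunc x i| <= th.
    by rewrite /trunc; case: ifP => iN; [exact: hx | rewrite normr0 ltW].
  have Ex v : (v < n)%N -> E v (e' - e0) (trunc x) = 0.
    move=> vn; have [_ px _] := cx.
    rewrite (HE v e' x (trunc x) vn Ie' _ px) ?(config_law0 cx) //.
      by apply: le_trans (ltW ed2) _; apply: le_trans d2th t5.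
    move=> k kN; split; last exact: le_trans (trb k) t5.
    by rewrite /trunc kN.
  have eq i : y i (e' - e0) = trunc x i.
    apply/eqP; rewrite -subr_eq0 -normr_le0.
    have := HU (e' - e0) (y^~ (e' - e0)) (trunc x) _ _ _ _ _ _ i.
    rewrite y0 /trunc /= subrr normr0 mulr0; apply.
    - by apply: lt_le_trans ed2 _; apply: le_trans d2th t2.
    - by move=> k; apply: le_trans (ev k _ ed2) t2.
    - by move=> k; apply: le_trans (trb k) t2.
    - by move=> k kN; rewrite yN // ltnNge kN.
    - by move=> j jN; exact: yE.
    - by move=> j jN; exact: Ex.
  have -> : y^~ (e' - e0) = trunc x by apply/funext => i; exact: eq.
  exact: Ex.
pose h := e - e0.
pose x (i : nat) : R := X (i %% n)%N + y (i %% n)%N h + ((i %/ n)%:Z * m)%:~R * T e.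
have px i : x (i + n)%N = x i + m%:~R * T e.
  rewrite /x modnDr divnDr // divnn /= PoszD mulrDl mul1r intrD; ring.
have xs i : (i < n)%N -> x i = X i + y i h.
  by move=> iN; rewrite /x modn_small // divn_small // mul0r mulr0z mul0r addr0.
have Ev v : (v < n)%N -> law (gam e) (x (v + n.-1)%N) (x (v + n)%N) (x (v + n).+1) = 0.
  move=> vn; rewrite -(HE v e x (y^~ h) vn Ie _ px).
  - by case: v vn => [_|v vn]; [exact: G0 | exact: yE].
  - by apply: le_trans (ltW e1) _; apply: le_trans d2th t5.
  move=> i iN; rewrite xs // addrAC subrr add0r; split=> //.
  by apply: le_trans (ev i _ e1) t5.
exists x; last first.
  move=> i iN; rewrite xs // addrAC subrr add0r.
  by apply: le_trans (ev i _ e1) t1.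
split=> //; first by rewrite xs // y0 /X /=; ring.
move=> i; pose v := (i.+1 %% n)%N.
have vn : (v < n)%N by rewrite ltn_pmod.
have := Ev v vn; rewrite -(law_modn _ _ _ Ie px) -[in X in _ -> X](law_modn _ _ _ Ie px).
have -> : ((v + n.-1) %% n = i %% n)%N.
  have En : (i.+1 + n.-1 = i + n)%N by rewrite addSn -addnS.
  by rewrite /v modnDml En modnDr.
have -> : ((v + n) %% n = i.+1 %% n)%N by rewrite modnDr /v modn_mod.
have -> // : ((v + n).+1 %% n = i.+2 %% n)%N.
have -> : ((v + n).+1 = (v + 1) + n)%N by rewrite addn1 addSn.
by rewrite modnDr /v modnDml addn1.
Qed.

End LimitParameter.

End AtPoint.
End Chart.

(** * Closing maps near an accumulation point *)

Section Uniform.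
Context {R : realType}.

Lemma compact_unif (a b : R) (P : R -> R -> Prop) :
  (forall t t' s, 0 < t' -> t' <= t -> P t s -> P t' s) ->
  (forall s0, a <= s0 <= b -> exists2 d, 0 < d & forall s, `|s - s0| < d -> P d s) ->
  exists2 t, 0 < t & forall s, a <= s <= b -> P t s.
Proof.
move=> mon loc.
have /compact_near_coveringP cov : compact (`[a, b] : set R) by exact: segment_compact.
have H : \forall t \near (0 : R)^'+, (`[a, b] : set R) `<=` P t.
  apply: cov => s0 /= s0I.
  have [|d d0 Hd] := loc s0; first by rewrite in_itv in s0I.
  exists ([set s | `|s - s0| < d], [set t | 0 < t < d]).
    split=> /=; first exact: near_dist.
    near=> t; apply/andP; split; near: t; [exact: nbhs_right_gt | exact: nbhs_right_lt].
  by move=> [s t] /= [sd /andP[t0 td]]; exact: (mon _ _ _ t0 (ltW td) (Hd _ sd)).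
have [t [Ht t0]] : exists t, (`[a, b] : set R) `<=` P t /\ 0 < t.
  apply: (@filter_ex _ (0 : R)^'+); near=> t; split; near: t => //; exact: nbhs_right_gt.
by exists t => // s sI; apply: Ht; rewrite /= in_itv.
Unshelve. all: by end_near. Qed.

Lemma cont_inj_mono (g : R -> R) T : 0 < T -> continuous g -> injective g ->
  (forall s, g (s + T) = g s + T) -> forall x y, x < y -> g x < g y.
Proof.
move=> T0 gc gi per x y xy.
pose b := Num.max y (x + T).
have xb : x < b by rewrite lt_max xy.
have yb : y <= b by rewrite le_max lexx.
have Tb : x + T <= b by rewrite le_max lexx orbT.
have H : {in `[x, b] &, {mono g : u v / u <= v}}.
  apply: itv_continuous_inj_le; last by move=> ? ? _ _; exact: gi.
    exists x, (x + T); rewrite !in_itv /= !lexx Tb (ltW xb) per; split=> //; lra.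
  exact: continuous_subspaceT.
rewrite lt_neqAle H ?in_itv /= ?lexx ?(ltW xb) ?(ltW xy) ?yb // andbT.
by apply/eqP => /gi E; move: xy; rewrite E ltxx.
Qed.

End Uniform.

Section Local.
Context {R : realType}.
Variables (I : set R) (Omega : R -> set (R * R)) (gam : R -> R -> R * R) (T : R -> R).
Let f1 e s := (gam e s).1.
Let f2 e s := (gam e s).2.
Hypothesis S1 : family_series I f1.
Hypothesis S2 : family_series I f2.
Hypothesis cc : forall e, I e -> convex_curve (Omega e) (gam e) (T e).
Variables (m : int) (N : nat).
Let n := N.+2.
Let cfg := @config R gam T m N.

Section Unique.
Variables (e0 : R) (G : R -> R).
Hypothesis Ie0 : I e0.
Hypothesis cm : closing_map (gam e0) (T e0) m n G.

(** The same number [t] is used as a radius and, inverted, as a Lipschitz constant,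
    so that the property is monotone in [t] as [compact_unif] requires. *)
Definition unique_at (t s : R) := forall (e s' : R) (x x' : nat -> R), I e -> `|e - e0| < t ->
  `|s - s'| < t -> cfg e s x -> cfg e s' x' ->
  (forall i, (i < n)%N -> `|x i - iter i G s| <= t) ->
  (forall i, (i < n)%N -> `|x' i - iter i G s'| <= t) ->
  forall i, (i < n)%N -> `|x i - x' i| <= t^-1 * `|s - s'|.

Lemma unique_at_le t t' s : 0 < t' -> t' <= t -> unique_at t s -> unique_at t' s.
Proof.
move=> t0 tt H e s' x x' Ie he hs cx cx' hx hx' i iN.
apply: le_trans (H e s' x x' Ie (lt_le_trans he tt) (lt_le_trans hs tt) cx cx' _ _ i iN) _.
- by move=> k kN; apply: le_trans (hx k kN) tt.
- by move=> k kN; apply: le_trans (hx' k kN) tt.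
by rewrite ler_wpM2r // lef_pV2 ?posrE // (lt_le_trans t0).
Qed.

Lemma uniform_unique a b : exists2 t, 0 < t & forall s, a <= s <= b -> unique_at t s.
Proof.
apply: compact_unif; first exact: unique_at_le.
move=> s0 _.
have [t [K [t0 K0 HU]]] := chart_unique S1 S2 cc s0 Ie0 cm.
have [d2 d20 Hd2] : exists2 d, 0 < d & forall s i, (i < n)%N -> `|s - s0| < d ->
    `|iter i G s - iter i G s0| < t / 2.
  have h2 : 0 < t / 2 by rewrite divr_gt0.
  have H i : exists d, 0 < d /\ forall s, `|s - s0| < d -> `|iter i G s - iter i G s0| < t / 2.
    by have [d dp Hd] := orbit_cont s0 cm i h2; exists d.
  have [dd Hdd] := choice H.
  have [d dp Hd] := @common_del _ dd n (fun i => (Hdd i).1).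
  by exists d => // s i iN sd; apply: (Hdd i).2; apply: lt_le_trans (Hd i iN).
pose d := Num.min (Num.min (t / 2) (d2 / 2)) (K + 1)^-1.
have K1 : 0 < K + 1 by rewrite ltr_wpDl.
have d0 : 0 < d by rewrite !lt_min !divr_gt0 // invr_gt0.
have [l1 l2 l3] : [/\ d <= t / 2, d <= d2 / 2 & d <= (K + 1)^-1].
  by rewrite /d; split; rewrite !ge_min lexx ?orbT.
exists d => // s sd e s' x x' Ie he hs cx cx' hx hx' i iN.
have s'd : `|s' - s0| < d2.
  have -> : s' - s0 = (s - s0) - (s - s') by ring.
  apply: le_lt_trans (ler_normB _ _) _; lra.
have ss : `|s - s0| < d2 by lra.
have clo z r : `|r - s0| < d2 -> (forall i, (i < n)%N -> `|z i - iter i G r| <= d) ->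
    forall i, (i < n)%N -> `|z i - iter i G s0| <= t.
  move=> hr hz k kN; have := hz k kN; have := Hd2 r k kN hr => h1 h2.
  have -> : z k - iter k G s0 = (z k - iter k G r) + (iter k G r - iter k G s0) by ring.
  apply: le_trans (ler_normD _ _) _; lra.
apply: le_trans (HU e x x' s s' Ie _ cx cx' (clo _ _ ss hx) (clo _ _ s'd hx') i iN) _; first by lra.
rewrite ler_wpM2r //; have : (K + 1)%R <= d^-1.
  by rewrite -[leLHS]invrK lef_pV2 ?posrE ?invr_gt0.
lra.
Qed.

Lemma orbit_per i s (k : int) : iter i G (s + k%:~R * T e0) = iter i G s + k%:~R * T e0.
Proof. by elim: i => [|i IH] //=; rewrite IH (cm_per_int cm). Qed.

Lemma reduce_mod (p s : R) : 0 < p -> exists k : int, 0 <= s + k%:~R * p < p.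
Proof.
move=> p0; exists (- Num.floor (s / p)); have /andP[h1 h2] := floor_itv (s / p).
rewrite mulrNz mulNr; move: h1 h2; rewrite ler_pdivlMr // ltr_pdivrMr // intrD mulrDl mul1r.
by move=> h1 h2; apply/andP; split; lra.
Qed.

Lemma orbit_lip t : 0 < t -> (forall s, 0 <= s <= T e0 -> unique_at t s) ->
  forall s s' i, (i < n)%N -> `|s - s'| < t -> `|iter i G s - iter i G s'| <= t^-1 * `|s - s'|.
Proof.
move=> t0 H s s' i iN ss.
have [k /andP[k1 k2]] := reduce_mod s (T_pos cc Ie0).
have h1 : 0 <= s + k%:~R * T e0 <= T e0 by rewrite k1 ltW.
have E : s - s' = (s + k%:~R * T e0) - (s' + k%:~R * T e0) by ring.
have := H _ h1 e0 (s' + k%:~R * T e0) (fun i => iter i G (s + k%:~R * T e0))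
  (fun i => iter i G (s' + k%:~R * T e0)) Ie0.
rewrite subrr normr0 -E => /(_ t0 ss (closing_config _ cm) (closing_config _ cm)).
have z u : forall i, (i < n)%N -> `|iter i G u - iter i G u| <= t.
  by move=> j _; rewrite subrr normr0 ltW.
move=> /(_ (z _) (z _) i iN); rewrite !orbit_per.
by rewrite opprD addrACA subrr addr0.
Qed.

End Unique.

Lemma config_shift e s x (k : int) : I e -> cfg e s x ->
  cfg e (s + k%:~R * T e) (fun i => x i + k%:~R * T e).
Proof.
move=> Ie [x0 px lx]; split=> [|i|i]; first by rewrite x0.
  by rewrite px; ring.
by rewrite law_shift //; have [_ per _ _] := cc_par (cc Ie).
Qed.

Lemma config_tail e s x : cfg e s x -> cfg e (x 1%N) (fun i => x i.+1).
Proof. by move=> [x0 px lx]; split=> // i; exact: (px i.+1). Qed.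

Lemma config_ext e s s' x x' : cfg e s x -> cfg e s' x' -> (forall i, (i < n)%N -> x i = x' i) ->
  forall i, x i = x' i.
Proof.
move=> [_ px _] [_ px' _] H i.
by rewrite (config_modn px) (config_modn px') H // ltn_pmod.
Qed.

Hypothesis m0 : 0 < m.
Hypothesis mn : m < n%:Z.

(** [lra] works with all the inequalities of the context; the ones that matter are
    first moved to the goal. *)
Ltac forget_inequalities := repeat match goal with H : is_true _ |- _ =>
  first [constr_eq H m0; fail 1 | constr_eq H mn; fail 1 | clear H] end.

(** By [chart_exists] and compactness, each point starts a closed orbit close to its
    reference orbit. The reference orbits are rescaled from the period at [e0] to the
    period at [e]: closeness is then invariant under translation by periods, and
    uniqueness holds on the whole line. Uniqueness makes the second vertex a Lipschitz
    function of the first one, and makes its iterates the further vertices. *)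
Theorem closing_local e0 : I e0 ->
  (forall d, 0 < d -> exists2 e, `|e - e0| < d & [/\ e != e0, I e & closing (gam e) (T e) m n]) ->
  exists2 d, 0 < d & forall e, I e -> `|e - e0| < d -> closing (gam e) (T e) m n.
Proof.
move=> Ie0 acc.
have [U [UU UP Ue0]] := ultra_at acc.
have UI : U I by apply: filterS UP => e [].
have Un : U [set e | e != e0] by apply: filterS UP => e [].
have [Gf HGf] : {Gf : R -> R -> R & forall e, closing (gam e) (T e) m n -> closing_map (gam e) (T e) m n (Gf e)}.
  apply: (@choice _ _ (fun e g => closing (gam e) (T e) m n -> closing_map (gam e) (T e) m n g)) => e.
  have [[g Hg]|nc] := pselect (closing (gam e) (T e) m n); first by exists g.
  by exists id.
have UG : U [set e | closing_map (gam e) (T e) m n (Gf e)].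
  by apply: filterS UP => e [_ _ /HGf].
have [G [cm UL]] := limit_closing_map S1 S2 cc UU UI Ue0 Ie0 (isT : (0 < n)%N) m0 mn UG.
set T0 := T e0; have T0p : 0 < T0 := T_pos cc Ie0.
have [t1 t10 HU1] := uniform_unique Ie0 cm (- T0) (3 * T0).
have [kap kap0 Hkap] : exists2 k, 0 < k & forall s, 0 <= s <= T0 -> k <= G s - s /\ G s - s <= T0 - k.
  apply: compact_unif => [t t' s t0 tt [h1 h2]|s0 _]; first by split; lra.
  have /andP[h1 h2] := cm_twist cm s0.
  pose k := Num.min (G s0 - s0) (s0 + T0 - G s0) / 4.
  have k0 : 0 < k by rewrite divr_gt0 // lt_min !subr_gt0 h1.
  have l1 : 4 * k <= G s0 - s0 by rewrite /k mulrC divfK // ge_min lexx.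
  have l2 : 4 * k <= s0 + T0 - G s0 by rewrite /k mulrC divfK // ge_min lexx orbT.
  have [d d0 Hd] := orbit_cont s0 cm 1 k0.
  exists (Num.min d k); first by rewrite lt_min d0.
  move=> s; rewrite lt_min => /andP[sd sk].
  have ml : Num.min d k <= k by rewrite ge_min lexx orbT.
  have := Hd s sd; rewrite /= ltr_norml => /andP[g1 g2].
  move: sk; rewrite ltr_norml => /andP[s1 s2]; split; lra.
pose t := Num.min t1 (Num.min 1 T0).
have t0 : 0 < t by rewrite !lt_min t10 ltr01.
have [tt1 tt2 tt3] : [/\ t <= t1, t <= 1 & t <= T0] by rewrite /t; split; rewrite !ge_min lexx ?orbT.
clearbody t.
have HU s : - T0 <= s <= 3 * T0 -> unique_at e0 G t s.
  by move=> sI; apply: unique_at_le (HU1 s sI).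
have HU0 s : 0 <= s <= T e0 -> unique_at e0 G t s.
  by rewrite -/T0 => /andP[h1 h2]; apply: HU; apply/andP; split; lra.
have Lip := orbit_lip Ie0 cm t0 HU0.
pose th := Num.min (t * t / 8) (kap / 4).
have th0 : 0 < th by rewrite lt_min !divr_gt0 ?mulr_gt0.
have th1 : th <= t * t / 8 by rewrite ge_min lexx.
have th2 : th <= kap / 4 by rewrite ge_min lexx orbT.
have th3 : th <= t / 8.
  apply: le_trans th1 _; rewrite ler_wpM2r //; by rewrite ler_piMr // ltW.
clearbody th; have thh : 0 < th / 2 by rewrite divr_gt0.
have [d1 d10 HX] : exists2 d, 0 < d & forall s, 0 <= s <= 2 * T0 -> forall e, I e -> `|e - e0| < d ->
    exists2 x, cfg e s x & forall i, (i < n)%N -> `|x i - iter i G s| <= th / 2.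
  apply: (compact_unif (P := fun d s => forall e, I e -> `|e - e0| < d ->
    exists2 x, cfg e s x & forall i, (i < n)%N -> `|x i - iter i G s| <= th / 2)).
    by move=> d d' s d'0 dd H e Ie he; apply: H => //; exact: lt_le_trans dd.
  move=> s0 _; have th4 : 0 < th / 4 by rewrite divr_gt0.
  have [d dp Hd] := chart_exists S1 S2 cc s0 Ie0 cm UU UI Ue0 Un UG UL th4.
  exists (Num.min d (Num.min t (t * th / 4))).
    by rewrite !lt_min dp t0 divr_gt0 // mulr_gt0.
  move=> s; rewrite !lt_min => /and3P[sd st sth] e Ie; rewrite !lt_min => /andP[ed _].
  have [x cx hx] := Hd e s Ie ed sd; exists x => // i iN.
  have := hx i iN; have := Lip s0 s i iN _; rewrite distrC => /(_ st) h1 h2.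
  have -> : x i - iter i G s = (x i - iter i G s0) + (iter i G s0 - iter i G s) by ring.
  apply: le_trans (ler_normD _ _) _.
  have : t^-1 * `|s - s0| <= th / 4.
    rewrite ler_pdivrMl // ltW //; lra.
  lra.
(* [eps] bounds the relative change of the period, and [bd] the points of the
   orbits that start near the reference interval *)
pose bd := (10 + n%:R) * T0.
have bd0 : 0 < bd by rewrite mulr_gt0 // ltr_wpDr.
pose eps := t * th / (8 * bd).
have eps0 : 0 < eps by rewrite divr_gt0 ?mulr_gt0.
have m1 : 0 < Num.min (T0 / 2) (eps * T0) by rewrite lt_min divr_gt0 // mulr_gt0.
have epsbd : eps * bd = t * th / 8 by rewrite /eps; field; rewrite gt_eqF.
clearbody eps.
have [d2 d20 HT] := period_continuous S1 S2 cc Ie0 m1.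
exists (Num.min d1 (Num.min d2 t)); first by rewrite !lt_min d10 d20.
move=> e Ie; rewrite !lt_min => /and3P[e1 e2 e3].
have := HT e Ie e2; rewrite -/T0 lt_min => /andP[hT1 hT2].
pose lam := T e / T0.
have Tep := T_pos cc Ie.
have lam0 : 0 < lam by rewrite divr_gt0.
have lamT : lam * T0 = T e by rewrite /lam divfK // gt_eqF.
have laml : 1 / 2 <= lam.
  move: hT1; rewrite ltr_norml => /andP[h _]; rewrite /lam ler_pdivlMr //; lra.
have lamu : lam <= 3 / 2.
  move: hT1; rewrite ltr_norml => /andP[_ h]; rewrite /lam ler_pdivrMr //; lra.
have lam1 : `|lam - 1| <= eps.
  have -> : lam - 1 = (T e - T0) / T0 by rewrite /lam; field; rewrite gt_eqF.
  by rewrite normf_div (gtr0_norm T0p) ler_pdivrMr // ltW.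
pose S i s := lam * iter i G (s / lam).
have lamn : lam != 0 by rewrite gt_eqF.
have iterb i u : u <= iter i G u <= u + i%:R * T0.
  elim: i => [|i /andP[h1 h2]] /=; first by rewrite mul0r addr0 !lexx.
  have /andP[g1 g2] := cm_twist cm (iter i G u).
  by rewrite -natr1 mulrDl mul1r; rewrite -/T0 in g2; move: h1 h2 g1 g2; forget_inequalities => h1 h2 g1 g2; apply/andP; split; lra.
have clo s i : (i < n)%N -> - T0 <= s <= 3 * T0 -> `|S i s - iter i G s| <= th / 2.
  move=> iN /andP[s1 s2]; rewrite /S; set u := s / lam.
  have us : s = lam * u by rewrite /u mulrC divfK.
  have ub : `|u| <= 6 * T0.
    rewrite /u normf_div (gtr0_norm lam0) ler_pdivrMr //.
    have h1 : 6 * T0 * (1 / 2) <= 6 * T0 * lam by rewrite ler_wpM2l // mulr_ge0 // ltW.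
    have : `|s| <= 3 * T0 by rewrite ler_norml; move: s1 s2 T0p; forget_inequalities => s1 s2 T0p; apply/andP; split; lra.
    move=> hs; move: h1 hs; forget_inequalities => h1 hs; lra.
  have usd : `|u - s| <= eps * (6 * T0).
    have -> : u - s = (1 - lam) * u by rewrite us; ring.
    by rewrite normrM distrC ler_pM.
  have e6 : eps * (6 * T0) <= t * th / 8.
    have h : 6 * T0 <= bd by have h := mulr_ge0 (ler0n R n) (ltW T0p); rewrite /bd; move: h T0p; forget_inequalities => h T0p; lra.
    by rewrite -epsbd; apply: ler_wpM2l h; exact: ltW.
  have uts : `|u - s| < t.
    apply: le_lt_trans (le_trans usd e6) _.
    have : t * th <= t * 1 by rewrite ler_wpM2l ?(ltW t0) //; move: th3 tt2; forget_inequalities => th3 tt2; lra.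
    move=> hh; move: hh t0; forget_inequalities => hh t0; lra.
  have h1 : `|iter i G u - iter i G s| <= th / 8.
    apply: le_trans (Lip u s i iN uts) _; rewrite ler_pdivrMl //.
    by apply: (le_trans usd); apply: (le_trans e6); rewrite mulrA.
  have h2 : `|(lam - 1) * iter i G u| <= th / 8.
    have ib : `|iter i G u| <= bd.
      have /andP[i1 i2] := iterb i u.
      have : i%:R * T0 <= n%:R * T0 by rewrite ler_wpM2r ?(ltW T0p) // ler_nat ltnW.
      move: ub; rewrite !ler_norml /bd mulrDl => /andP[u1 u2] h3.
      by have h4 := mulr_ge0 (ler0n R n) (ltW T0p); move: h4 u1 u2 i1 i2 h3 T0p; forget_inequalities => h4 u1 u2 i1 i2 h3 T0p; apply/andP; split; lra.
    rewrite normrM; apply: le_trans (ler_pM (normr_ge0 _) (normr_ge0 _) lam1 ib) _.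
    rewrite epsbd; have := mulr_ge0 (ltW th0) (ltW t0); nra.
  have -> : lam * iter i G u - iter i G s = (lam - 1) * iter i G u + (iter i G u - iter i G s) by ring.
  apply: le_trans (ler_normD _ _) _; move: h1 h2 th0; forget_inequalities => h1 h2 th0; lra.
have Sper i s (k : int) : S i (s + k%:~R * T e) = S i s + k%:~R * T e.
  rewrite /S -lamT; have -> : (s + k%:~R * (lam * T0)) / lam = s / lam + k%:~R * T0 by field.
  rewrite (orbit_per cm) -/T0; ring.
have Sadd i s : S i (S 1%N s) = S i.+1 s.
  by rewrite /S /= [lam * G _]mulrC mulfK // -iterSr.
have Slip a b i : (i < n)%N -> `|a - b| < t / 2 -> `|S i a - S i b| <= t^-1 * `|a - b|.
  move=> iN ab; rewrite /S -mulrBr normrM (gtr0_norm lam0).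
  have E : `|a / lam - b / lam| = `|a - b| / lam by rewrite -mulrBl normf_div (gtr0_norm lam0).
  have ab' : `|a / lam - b / lam| < t by rewrite E ltr_pdivrMr //; nra.
  apply: le_trans (ler_wpM2l (ltW lam0) (Lip _ _ i iN ab')) _.
  rewrite E; have -> // : lam * (t^-1 * (`|a - b| / lam)) = t^-1 * `|a - b|.
  by field; rewrite lamn gt_eqF.
have ex s : exists x, cfg e s x /\ forall i, (i < n)%N -> `|x i - S i s| <= th.
  have [k /andP[k1 k2]] := reduce_mod s Tep.
  have T2 : T e <= 2 * T0 by rewrite -lamT ler_wpM2r ?(ltW T0p) //; lra.
  have [|x cx hx] := HX (s + k%:~R * T e) _ e Ie e1; first by move: k1 k2 T2; forget_inequalities => k1 k2 T2; apply/andP; split; lra.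
  exists (fun i => x i + (- k)%:~R * T e); split.
    have := config_shift (- k) Ie cx.
    by rewrite mulrNz mulNr addrK.
  move=> i iN; have h1 := hx i iN.
  have h2 : `|S i (s + k%:~R * T e) - iter i G (s + k%:~R * T e)| <= th / 2.
    apply: (clo _ _ iN); move: k1 k2 T2 T0p; forget_inequalities => k1 k2 T2 T0p; by apply/andP; split; lra.
  rewrite Sper in h2.
  have -> : x i + (- k)%:~R * T e - S i s = (x i - iter i G (s + k%:~R * T e)) - (S i s + k%:~R * T e - iter i G (s + k%:~R * T e)).
    by rewrite mulrNz; ring.
  apply: le_trans (ler_normB _ _) _; lra.
have uniq s s' x x' : `|s - s'| < t -> cfg e s x -> cfg e s' x' ->
    (forall i, (i < n)%N -> `|x i - S i s| <= t / 2) -> (forall i, (i < n)%N -> `|x' i - S i s'| <= t / 2) ->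
    forall i, (i < n)%N -> `|x i - x' i| <= t^-1 * `|s - s'|.
  move=> ss cx cx' hx hx' i iN.
  have [k /andP[k1 k2]] := reduce_mod s Tep.
  have T2 : T e <= 3 / 2 * T0 by rewrite -lamT ler_wpM2r ?(ltW T0p).
  have E : s - s' = (s + k%:~R * T e) - (s' + k%:~R * T e) by ring.
  have sI : - T0 <= s + k%:~R * T e <= 3 * T0 by move: k1 k2 T2 T0p; forget_inequalities => k1 k2 T2 T0p; apply/andP; split; lra.
  have s'I : - T0 <= s' + k%:~R * T e <= 3 * T0.
    by move: ss; rewrite ltr_norml => /andP[h1 h2]; move: k1 k2 T2 T0p h1 h2 tt3; forget_inequalities => k1 k2 T2 T0p h1 h2 tt3; apply/andP; split; lra.
  have tr z r : (forall i, (i < n)%N -> `|z i - S i r| <= t / 2) -> - T0 <= r + k%:~R * T e <= 3 * T0 ->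
     forall i, (i < n)%N -> `|z i + k%:~R * T e - iter i G (r + k%:~R * T e)| <= t.
    move=> hz rI j jN; have h1 := hz j jN; have := clo _ j jN rI; rewrite Sper => h2.
    have -> : z j + k%:~R * T e - iter j G (r + k%:~R * T e) =
       (z j - S j r) + (S j r + k%:~R * T e - iter j G (r + k%:~R * T e)) by ring.
    apply: le_trans (ler_normD _ _) _; move: h1 h2 th3 t0; forget_inequalities => h1 h2 th3 t0; lra.
  have := HU _ sI e (s' + k%:~R * T e) _ _ Ie e3 _ (config_shift k Ie cx) (config_shift k Ie cx')
    (tr _ _ hx sI) (tr _ _ hx' s'I) i iN.
  rewrite -E => /(_ ss); by rewrite opprD addrACA subrr addr0.
have [x Hx] := choice ex.
pose g s := x s 1%N.
have cx s : cfg e s (x s) by have [] := Hx s.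
have hx s i : (i < n)%N -> `|x s i - S i s| <= th by have [_] := Hx s; apply.
have th4 : th <= t / 2 by lra.
have eqx s y : cfg e s y -> (forall i, (i < n)%N -> `|y i - S i s| <= t / 2) -> forall i, y i = x s i.
  move=> cy hy; apply: (config_ext cy (cx s)) => i iN; apply/eqP; rewrite -subr_eq0 -normr_le0.
  have := uniq s s y (x s) _ cy (cx s) hy _ i iN; rewrite subrr normr0 mulr0; apply=> //.
  by move=> j jN; apply: le_trans (hx s j jN) th4.
have shift s i : x s i.+1 = x (g s) i.
  apply: (eqx (g s) (fun i => x s i.+1)); first exact: config_tail (cx s).
  move=> {}i iN.
  have h1 : `|x s i.+1 - S i.+1 s| <= th.
    have [iN1|iN1] := ltnP i.+1 n; first exact: hx.
    have -> : i.+1 = (0 + n)%N by apply/eqP; rewrite add0n eqn_leq iN1 andbT; exact: iN.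
    have [x0 px _] := cx s; rewrite px x0 /S add0n (cm_iter cm) -/T0.
    have -> : lam * (s / lam + m%:~R * T0) = s + m%:~R * T e by rewrite -lamT; field.
    by rewrite subrr normr0 ltW.
  have h2 : `|S 1%N s - g s| <= th by rewrite distrC; exact: hx.
  have h2' : `|S 1%N s - g s| < t / 2 by apply: (le_lt_trans h2); apply: (le_lt_trans th3); rewrite ltr_pM2l // ltf_pV2 ?posrE // ltr_nat.
  have h3 := Slip (S 1%N s) (g s) i iN h2'.
  rewrite Sadd in h3.
  have h4 : t^-1 * `|S 1%N s - g s| <= t / 8.
    rewrite ler_pdivrMl //; apply: le_trans h2 _; apply: le_trans th1 _; rewrite mulrA //.
  have -> : x s i.+1 - S i (g s) = (x s i.+1 - S i.+1 s) + (S i.+1 s - S i (g s)) by ring.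
  apply: le_trans (ler_normD _ _) _; move: h1 h2 h3 h4 th3 t0; forget_inequalities => h1 h2 h3 h4 th3 t0; lra.
have it k s : iter k g s = x s k.
  elim: k s => [|k IH] s; first by have [-> _ _] := cx s.
  by rewrite iterSr IH shift.
have gn s : iter n g s = s + m%:~R * T e.
  by rewrite it; have [x0 px _] := cx s; have := px 0%N; rewrite add0n x0.
have gper s : g (s + T e) = g s + T e.
  have c1 : cfg e (s + T e) (fun i => x s i + T e).
    by have := config_shift 1 Ie (cx s); rewrite mulr1z mul1r.
  have := eqx _ _ c1 _ 1%N; rewrite /g => <- // i iN.
  have := Sper i s 1; rewrite mulr1z mul1r => ->.
  by rewrite opprD addrACA subrr addr0; apply: le_trans (hx s i iN) th4.
have ginj : injective g.
  move=> a b E; have : iter n g a = iter n g b by rewrite -[n]/(N.+1.+1) !(iterSr N.+1) E.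
  by rewrite !gn => /addIr.
have gcont : continuous g.
  move=> s; apply/cvgrPdist_lt => eta eta0; apply/nearE_dist.
  exists (Num.min t (t * eta)) => [|s']; first by rewrite lt_min t0 mulr_gt0.
  rewrite distrC lt_min => /andP[h1 h2].
  have h3 := uniq s s' (x s) (x s') h1 (cx s) (cx s') _ _ 1%N isT.
  apply: le_lt_trans (h3 _ _) _; try by move=> j jN; apply: le_trans (hx _ j jN) th4.
  by rewrite ltr_pdivrMl.
exists g; split=> //.
- exact: cont_inj_mono Tep gcont ginj gper.
- move=> s; have := hx s 1%N isT; rewrite -/(g s) ler_norml => /andP[h1 h2].
  have [k /andP[k1 k2]] := reduce_mod (s / lam) T0p.
  have [|a1 a2] := Hkap (s / lam + k%:~R * T0); first by rewrite k1 ltW.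
  have Ga : G (s / lam + k%:~R * T0) = G (s / lam) + k%:~R * T0 by exact: (orbit_per cm 1).
  rewrite Ga in a1 a2.
  have E : S 1%N s - s = lam * (G (s / lam) - s / lam) by rewrite /S /=; field.
  have b1 : lam * kap <= S 1%N s - s by rewrite E ler_wpM2l ?(ltW lam0) //; move: a1; forget_inequalities => a1; lra.
  have b2 : S 1%N s - s <= lam * (T0 - kap) by rewrite E ler_wpM2l ?(ltW lam0) //; move: a2; forget_inequalities => a2; lra.
  have b3 : 1 / 2 * kap <= lam * kap by rewrite ler_wpM2r // ltW.
  by rewrite -lamT; move: h1 h2 b1 b2 b3 th2 kap0; forget_inequalities => h1 h2 b1 b2 b3 th2 kap0; apply/andP; split; lra.
move=> s; have [x0 _ lx] := cx s; have := lx 0%N.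
by rewrite x0 -/(g s) shift.
Qed.

End Local.

(** * From invariant curves to closing maps *)

Section BilliardStep.
Context {R : realType}.
Implicit Types (g : R -> R * R).

Lemma dot2_rotate (a : R) v : v.1 ^+ 2 + v.2 ^+ 2 = 1 -> dot2 v (rotate a v) = cos a.
Proof.
move=> v1; rewrite /dot2 /rotate /=.
have -> : v.1 * (cos a * v.1 - sin a * v.2) + v.2 * (sin a * v.1 + cos a * v.2) =
  cos a * (v.1 ^+ 2 + v.2 ^+ 2) by ring.
by rewrite v1 mulr1.
Qed.

Lemma det2_rotate (a : R) v : v.1 ^+ 2 + v.2 ^+ 2 = 1 -> det2 v (rotate a v) = sin a.
Proof.
move=> v1; rewrite /det2 /rotate /=.
have -> : v.1 * (sin a * v.1 + cos a * v.2) - v.2 * (cos a * v.1 - sin a * v.2) =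
  sin a * (v.1 ^+ 2 + v.2 ^+ 2) by ring.
by rewrite v1 mulr1.
Qed.

Section Arc.
Variables (A : set (R * R)) (g : R -> R * R) (L : R).
Hypothesis hA : strictly_convex_bounded_domain A.
Hypothesis arc : arclength_parametrization A g L.

Lemma arc_unit s : (velocity g s).1 ^+ 2 + (velocity g s).2 ^+ 2 = 1.
Proof. by have [_ _ u _] := arc. Qed.

Lemma arc_curve : convex_curve A g L.
Proof.
have [cp [d [c1 c2]] u side] := arc.
split=> //.
- by move=> s; have [h _] := d s; rewrite /velocity /= derive1E; exact: DeriveDef.
- by move=> s; have [_ h] := d s; rewrite /velocity /= derive1E; exact: DeriveDef.
- move=> s; apply/eqP => E; have := u s; rewrite E /= expr0n addr0 => /eqP.
  by rewrite eq_sym oner_eq0.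
Qed.

Lemma arc_side s p : A p -> 0 < 1 * det2 (velocity g s) (p - g s).
Proof. by rewrite mul1r; have [_ _ _] := arc; apply. Qed.

Let cc := arc_curve.
Let cp := cc_par cc.

Lemma chord_unique s a b (u : R * R) : s < a < s + L -> s < b < s + L ->
  det2 (g a - g s) u = 0 -> det2 (g b - g s) u = 0 -> u != 0 -> a = b.
Proof.
move=> ha hb ua ub u0; apply/eqP; apply/negPn/negP => ab.
have na := param_neq cp ha; have nb := param_neq cp hb.
have nab : g a != g b.
  have [h|h|h] := ltrgtP a b; last by rewrite h eqxx in ab.
    by apply: (param_neq cp); lra.
  by rewrite eq_sym; apply: (param_neq cp); lra.
have := bd_noncollinear hA (param_bd cp s) (param_bd cp a) (param_bd cp b) na nb nab.
move=> /negP; apply; apply/eqP.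
have [x Ex] : exists c, g a - g s = (c * u.1, c * u.2).
  by apply: (det2_param u0); move: ua; rewrite /det2; lra.
have [y Ey] : exists c, g b - g s = (c * u.1, c * u.2).
  by apply: (det2_param u0); move: ub; rewrite /det2; lra.
by rewrite Ex Ey /det2 /=; ring.
Qed.

Lemma angle_inj (a b : R) : 0 < a < pi -> 0 < b < pi -> - cos a = - cos b -> a = b.
Proof.
move=> /andP[a0 a1] /andP[b0 b1] /oppr_inj E; apply: cos_inj => //; rewrite in_itv /= !ltW //.
Qed.

Lemma billiard_step_unique p q q' : billiard_step g L p q -> billiard_step g L p q' -> q = q'.
Proof.
move=> [f [f1 /= [hf hf1 p2 q2 [hq [t Et] Eu]]]] [f' [f1' /= [hf' hf1' p2' q2' [hq' [t' Et'] Eu']]]].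
have ff : f' = f := angle_inj hf' hf (etrans (esym p2') p2).
rewrite ff in Et' Eu'; set u := rotate f _ in Et Et' Eu Eu'.
have uE : q.1 = q'.1.
  have u0 : u != 0.
    apply/eqP => E; have := dot2_rotate (- f1) (arc_unit q.1); have := det2_rotate (- f1) (arc_unit q.1).
    rewrite -Eu E /dot2 /det2 /= !mulr0 addr0 subr0 => /esym h1 /esym h2.
    by have := cos2Dsin2 (- f1); rewrite h1 h2 expr0n addr0 => /eqP; rewrite eq_sym oner_eq0.
  apply: (chord_unique hq hq' _ _ u0).
    by rewrite Et /det2 /=; ring.
  by rewrite Et' /det2 /=; ring.
rewrite [q]surjective_pairing [q']surjective_pairing uE; congr (_, _).
rewrite q2 q2' -(cosN f1) -(cosN f1') -(dot2_rotate (- f1) (arc_unit q.1)) -(dot2_rotate (- f1') (arc_unit q'.1)).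
by rewrite -Eu -Eu' uE.
Qed.

Lemma billiard_map_step p q : billiard_step g L p q -> billiard_map g L p = q.
Proof.
move=> st; apply: xget_unique => // q' st'; exact: billiard_step_unique st' st.
Qed.

Section FromCurve.
Variables (m : int) (n : nat) (eta : R -> R).
Hypothesis m0 : 0 < m.
Hypothesis n0 : (0 < n)%N.
Hypothesis pic : periodic_invariant_curve g L m n eta.

Let B := billiard_map g L.
Let G s := (B (s, eta s)).1.
Let L0 : 0 < L. Proof. by have [] := cp. Qed.

Lemma curve_map s : B (s, eta s) = (G s, eta (G s)).
Proof.
have [_ _ _ inv _] := pic.
have : graph eta (B (s, eta s)) by apply: inv; exists (s, eta s) => //; exists s.
by move=> [x _ E]; rewrite /G -E.
Qed.

Lemma curve_iter s k : iter k B (s, eta s) = (iter k G s, eta (iter k G s)).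
Proof. by elim: k => [|k IH] //=; rewrite IH curve_map. Qed.

Lemma curve_closing s : iter n G s = s + m%:~R * L.
Proof. by have [_ _ _ _ it] := pic; have := it s; rewrite curve_iter => -[]. Qed.

(** Where there is no billiard step the default value of [billiard_map] fixes the
    point, against the translation by [m] periods. *)
Lemma curve_step s : billiard_step g L (s, eta s) (G s, eta (G s)).
Proof.
rewrite -curve_map /B /billiard_map; case: xgetP => [//|nos].
have E : B (s, eta s) = (s, eta s) by rewrite /B /billiard_map; case: xgetP => // y _ /nos.
have : iter n G s = s.
  have := curve_iter s n; have -> : iter n B (s, eta s) = (s, eta s).
    by elim: (n) => [|k IH] //=; rewrite IH E.
  by move=> [].
rewrite curve_closing => /eqP; rewrite -[X in _ == X]addr0 (inj_eq (addrI _)).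
by rewrite mulf_eq0 (gt_eqF L0) orbF intr_eq0 gt_eqF.
Qed.

Lemma curve_twist s : s < G s < s + L.
Proof. by have [f [f1 /= [_ _ _ _ [h _ _]]]] := curve_step s. Qed.

Let S s := Num.sqrt (1 - eta s ^+ 2).

Lemma curve_relation s : 0 < S s /\
  dot2 (velocity g s) (g (G s) - g s) * S s + eta s * det2 (velocity g s) (g (G s) - g s) = 0.
Proof.
have [f [f1 /= [hf _ E _ [_ [t Et] _]]]] := curve_step s.
have sf : 0 < sin f by apply: sin_gt0_pi.
have SE : S s = sin f.
  rewrite /S E sqrrN; have -> : 1 - cos f ^+ 2 = sin f ^+ 2 by have := cos2Dsin2 f; lra.
  by rewrite sqrtr_sqr gtr0_norm.
have cE : g (G s) - g s = (t * (rotate f (velocity g s)).1, t * (rotate f (velocity g s)).2).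
  by rewrite Et; congr (_, _) => /=; ring.
split; first by rewrite SE.
have D1 := dot2_rotate f (arc_unit s); have D2 := det2_rotate f (arc_unit s).
have -> : dot2 (velocity g s) (g (G s) - g s) = t * dot2 (velocity g s) (rotate f (velocity g s)).
  by rewrite cE /dot2 /=; ring.
have -> : det2 (velocity g s) (g (G s) - g s) = t * det2 (velocity g s) (rotate f (velocity g s)).
  by rewrite cE /det2 /=; ring.
by rewrite D1 D2 SE E; ring.
Qed.

Lemma curve_law s : law g s (G s) (G (G s)) = 0.
Proof.
have [f [f1 /= [hf hf1 E1 E2 [_ [t Et] Eu]]]] := curve_step s.
have [f' [f1' /= [hf' hf1' E1' E2' [_ [t' Et'] Eu']]]] := curve_step (G s).
have ff : f' = f1 := angle_inj hf' hf1 (etrans (esym E1') E2).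
set v := velocity g (G s) in Eu Et'.
have {}Et : g (G s) = ((g s).1 + t * (rotate (- f1) v).1, (g s).2 + t * (rotate (- f1) v).2).
  by rewrite -Eu.
have {}Et' : g (G (G s)) = ((g (G s)).1 + t' * (rotate f1 v).1, (g (G s)).2 + t' * (rotate f1 v).2).
  by rewrite -ff.
have U := arc_unit (G s); rewrite -/v in U.
have aE : g s - g (G s) = (- t * (rotate (- f1) v).1, - t * (rotate (- f1) v).2).
  by rewrite Et; congr (_, _) => /=; ring.
have bE : g (G (G s)) - g (G s) = (t' * (rotate f1 v).1, t' * (rotate f1 v).2).
  by rewrite Et'; congr (_, _) => /=; ring.
have D1 := dot2_rotate (- f1) U; have D2 := det2_rotate (- f1) U.
have D3 := dot2_rotate f1 U; have D4 := det2_rotate f1 U.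
have -> : law g s (G s) (G (G s)) = - (t * t') * (dot2 v (rotate (- f1) v) * det2 v (rotate f1 v) +
   dot2 v (rotate f1 v) * det2 v (rotate (- f1) v)).
  by rewrite /law -/v aE bE /dot2 /det2 /=; ring.
by rewrite D1 D2 D3 D4 cosN sinN; ring.
Qed.

Let sandwich (a b y z e : R) : y - e <= a -> b <= y + e -> a < z -> z < b -> `|y - z| < e.
Proof. by move=> ????; rewrite ltr_norml; apply/andP; split; lra. Qed.

Lemma eta_cont : continuous eta.
Proof.
have [_ lip _ _ _] := pic.
have [M [M0 H]] : exists M : R, 0 < M /\ forall x y, `|eta x - eta y| <= M * `|x - y|.
  move: lip => [M0 [_ HM]]; exists (`|M0| + 1); split; first by rewrite ltr_wpDl.
  move=> x y; have lt : M0 < `|M0| + 1 by rewrite (le_lt_trans (ler_norm _)) // ltrDl.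
  by have := HM _ lt (x, y); apply.
move=> s; apply/cvgrPdist_lt => e e0; apply/nearE_dist.
exists (e / M); first exact: divr_gt0.
by move=> t; rewrite ltr_pdivlMr // => h; apply: (le_lt_trans (H s t)); rewrite mulrC distrC.
Qed.

Let k s := - eta s / S s.

Lemma k_cont : continuous k.
Proof.
move=> s; have [S0 _] := curve_relation s.
apply: cvgM; first by apply: cvgN; exact: eta_cont.
apply: cvgV; first by rewrite gt_eqF.
apply: (@cvg_comp _ _ _ (fun x => 1 - eta x ^+ 2) Num.sqrt _ (nbhs (1 - eta s ^+ 2))); last exact: sqrt_continuous.
by apply: cvgB; [exact: cvg_cst | rewrite expr2; apply: cvgM; exact: eta_cont].
Qed.

Let side : forall s p, A p -> 0 < 1 * det2 (velocity g s) (p - g s) := arc_side.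
Local Notation cot := (cotan g 1).

Lemma cotan_curve s : cot s (G s) = k s.
Proof.
have [S0 E] := curve_relation s; have tw := curve_twist s.
have D := chord_side cc side (param_neq cp tw); rewrite mul1r in D.
rewrite /cotan /k mul1r; apply/eqP; have n1 : S s != 0 by rewrite gt_eqF.
have n2 : det2 (velocity g s) (g (G s) - g s) != 0 by rewrite gt_eqF.
by rewrite (eqr_div _ _ n2 n1) mulNr -addr_eq0; apply/eqP; exact: E.
Qed.

Lemma cotan_lt s a b : s < a < s + L -> s < b < s + L -> cot s a < cot s b -> b < a.
Proof.
move=> /andP[a1 a2] /andP[b1 b2] lt; case: (ltrgtP a b) => // [ab|E].
  by have := cotan_decr cc side a1 ab b2; lra.
by move: lt; rewrite E ltxx.
Qed.

Lemma curve_per s : G (s + L) = G s + L.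
Proof.
have tw := curve_twist s; have tw' := curve_twist (s + L).
have [_ per _ _] := cp; have [pe _ _ _ _] := pic.
have E : cot (s + L) (G (s + L)) = cot (s + L) (G s + L).
  by rewrite cotan_curve /k /S pe -/(S s) -/(k s) -cotan_curve /cotan (velocity_shift _ per) !per.
have h : s + L < G s + L < s + L + L by rewrite !ltrD2r.
case: (ltrgtP (G (s + L)) (G s + L)) => // lt; [move: tw' h| move: h tw'] => /andP[a1 a2] /andP[b1 b2];
  by have := cotan_decr cc side a1 lt b2; rewrite E ltxx.
Qed.

Lemma cot_cont s a : s < a < s + L -> (fun x => cot x a) @ s --> cot s a.
Proof.
move=> tw; have D := chord_side cc side (param_neq cp tw).
have c1 : (fun x => (g x).1) @ s --> (g s).1 by exact: curve_cont1 cc s.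
have c2 : (fun x => (g x).2) @ s --> (g s).2 by exact: curve_cont2 cc s.
have v1 := cc_cont1 cc (x := s); have v2 := cc_cont2 cc (x := s).
have d1 : (fun x => (g a).1 - (g x).1) @ s --> (g a).1 - (g s).1 by apply: cvgB => //; exact: cvg_cst.
have d2 : (fun x => (g a).2 - (g x).2) @ s --> (g a).2 - (g s).2 by apply: cvgB => //; exact: cvg_cst.
apply: cvgM; first by apply: cvgD; apply: cvgM.
apply: cvgV; first by rewrite gt_eqF.
by apply: cvgM; [exact: cvg_cst | apply: cvgB; apply: cvgM].
Qed.

(** The cotangent of the exit angle is continuous along the curve; as the cotangent of
    a chord is decreasing in its endpoint, it locates the endpoint continuously. *)
Lemma curve_continuous : continuous G.
Proof.
move=> s; apply/cvgrPdist_lt => e e0.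
have /andP[t1 t2] := curve_twist s.
pose a := Num.max (G s - e) ((s + G s) / 2); pose b := Num.min (G s + e) ((s + L + G s) / 2).
have [a1 a2 a3] : [/\ G s - e <= a, s < a & a < G s].
  by rewrite /a; split; rewrite ?le_max ?lexx // ?lt_max ?gt_max; lra.
have [b1 b2 b3] : [/\ b <= G s + e, G s < b & b < s + L].
  by rewrite /b; split; rewrite ?ge_min ?lexx // ?gt_min ?lt_min; lra.
clearbody a b.
have ka : 0 < cot s a - k s by rewrite -cotan_curve subr_gt0; exact: (cotan_decr cc side a2 a3 t2).
have kb : cot s b - k s < 0 by rewrite -cotan_curve subr_lt0; exact: (cotan_decr cc side t1 b2 b3).
have ca : (fun x => cot x a - k x) @ s --> cot s a - k s.
  by apply: cvgB; [apply: cot_cont; lra | exact: k_cont].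
have cb : (fun x => cot x b - k x) @ s --> cot s b - k s.
  by apply: cvgB; [apply: cot_cont; lra | exact: k_cont].
have na := cvgr_gt _ ca 0 ka; have nb := cvgr_lt _ cb 0 kb.
have n1 : \forall x \near s, x < a by exact: lt_nbhsl.
have n2 : \forall x \near s, b - L < x by apply: lt_nbhsr; lra.
have key x : x < a -> b - L < x -> 0 < cot x a - k x -> cot x b - k x < 0 -> `|G s - G x| < e.
  move=> xa; rewrite ltrBlDr => bx ha hb; have twx := curve_twist x.
  have ab : a < b := lt_trans a3 b2.
  have ra : x < a < x + L by rewrite xa (lt_trans ab bx).
  have rb : x < b < x + L by rewrite bx (lt_trans xa ab).
  have h1 : a < G x by apply: (cotan_lt twx ra); rewrite cotan_curve -subr_gt0.
  have h2 : G x < b by apply: (cotan_lt rb twx); rewrite cotan_curve -subr_lt0.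
  exact: sandwich a1 b1 h1 h2.
near=> x; apply: key; near: x; [exact: n1|exact: n2|exact: na|exact: nb].
Unshelve. all: by end_near. Qed.

Lemma curve_closing_map : closing g L m n.
Proof.
exists G; split.
- apply: (cont_inj_mono L0 curve_continuous _ curve_per) => a b E.
  have := congr1 (iter n.-1 G) E; rewrite -!iterSr prednK // !curve_closing; exact: addIr.
- exact: curve_per.
- exact: curve_twist.
- exact: curve_closing.
exact: curve_law.
Qed.

End FromCurve.
End Arc.
End BilliardStep.

(** * Change of parametrization *)

Section Reparam.
Context {R : realType}.
Implicit Types (A : set (R * R)) (g h : R -> R * R).

Let param_clash A g T (t t' : R) : closed_parametrization A g T -> g t = g t' -> t < t' -> t' < t + T -> False.
Proof. by move=> cp E h1 h2; have := @param_neq _ _ _ _ cp t t'; rewrite E eqxx h1 h2 => /(_ isT). Qed.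

Section SameSide.
Variables (A : set (R * R)) (g h : R -> R * R) (T L o c : R).
Hypothesis cg : convex_curve A g T.
Hypothesis ch : convex_curve A h L.
Hypothesis og : forall s p, A p -> 0 < o * det2 (velocity g s) (p - g s).
Hypothesis oh : forall s p, A p -> 0 < o * det2 (velocity h s) (p - h s).
Hypothesis base : g c = h 0.
Let pg := cc_par cg.
Let ph := cc_par ch.
Let T0 : 0 < T. Proof. by have [] := pg. Qed.
Let L0 : 0 < L. Proof. by have [] := ph. Qed.

Let same (s t : R) := exists k : int,
  [/\ 0 <= s + k%:~R * L < L, c <= t + k%:~R * T < c + T & h s = g t].

Let same_total s : exists t, same s t.
Proof.
have [k ks] := reduce_mod s L0.
have : range g (h s) by have [_ _ _ ->] := pg; exact: (param_bd ph).
move=> [t0 _ gt0]; have [j jt] := reduce_mod (t0 - c) T0.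
exists (t0 + j%:~R * T - k%:~R * T), k; split=> //; first by move: jt; lra.
have := param_int pg t0 (j - k); rewrite intrB mulrBl addrA => ->.
by rewrite gt0.
Qed.

Let same_onto t : exists s, same s t.
Proof.
have [k kt] := reduce_mod (t - c) T0.
have : range h (g t) by have [_ _ _ ->] := ph; exact: (param_bd pg).
move=> [s0 _ hs0]; have [j js] := reduce_mod s0 L0.
exists (s0 + j%:~R * L - k%:~R * L), k; split=> //; [by rewrite subrK | by move: kt; lra | ].
have := param_int ph s0 (j - k); rewrite intrB mulrBl addrA => ->.
by rewrite hs0.
Qed.

Let index_le (s s' : R) (k k' : int) : 0 <= s + k%:~R * L < L -> 0 <= s' + k'%:~R * L < L ->
  s <= s' -> k' <= k.
Proof.
move=> /andP[h1 _] /andP[_ h2] ss.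
have : (k' - k)%:~R * L < 1 * L by rewrite intrB mulrBl; lra.
by rewrite ltr_pM2r // -[1]/(1%:~R) ltr_int; lia.
Qed.

Let same_fun s t t' : same s t -> same s t' -> t = t'.
Proof.
move=> [k [ks kt E]] [k' [ks' kt' E']].
have kk : k = k' by apply/eqP; rewrite eq_le !(index_le _ _ (lexx s)).
rewrite -kk in kt'.
case: (ltrgtP t t') => // lt.
  by exfalso; apply: (param_clash pg _ lt); [rewrite -E -E' | lra].
by exfalso; apply: (param_clash pg _ lt); [rewrite -E -E' | lra].
Qed.

(** Within one turn, the points of the boundary are ordered in the same way by the two
    parametrizations because [chord_order] gives a sign that depends on the
    orientation only. *)
Let same_mono s t s' t' : same s t -> same s' t' -> s < s' -> t < t'.
Proof.
move=> [k [ks kt E]] [k' [ks' kt' E']] ss.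
have kk := index_le ks ks' (ltW ss).
have [lt|] := ltP k' k.
  have : (k' + 1)%:~R * T <= k%:~R * T by rewrite ler_wpM2r ?(ltW T0) // ler_int; lia.
  rewrite intrD mulrDl mul1r; lra.
move=> kk'; have {}kk : k' = k by apply/eqP; rewrite eq_le kk kk'.
subst k'.
set x := s + _ in ks; set x' := s' + _ in ks'; set y := t + _ in kt; set y' := t' + _ in kt'.
have Ex : h x = g y by rewrite /x /y (param_int ph) (param_int pg).
have Ex' : h x' = g y' by rewrite /x' /y' (param_int ph) (param_int pg).
have xx : x < x' by rewrite /x /x' ltrD2r.
suff : y < y' by rewrite /y /y' ltrD2r.
rewrite ltNge; apply/negP => yy.
have nE : g y' != g y.
  rewrite -Ex -Ex' eq_sym; apply: (param_neq ph).
  by rewrite xx; move: ks ks' => /andP[? ?] /andP[? ?]; lra.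
have {}yy : y' < y.
  by rewrite lt_neqAle yy andbT; apply: contra nE => /eqP ->.
move: ks ks' kt kt' => /andP[k1 k2] /andP[k3 k4] /andP[k5 k6] /andP[k7 k8].
have cy' : c < y'.
  rewrite lt_neqAle k7 andbT; apply/eqP => cy.
  by apply: (@param_clash _ _ _ 0 x' ph); [rewrite Ex' -cy base | exact: le_lt_trans k1 xx | rewrite add0r].
have x0 : 0 < x.
  rewrite lt_neqAle k1 andbT; apply/eqP => x0.
  by apply: (@param_clash _ _ _ c y pg); [rewrite -Ex -x0 base | exact: lt_trans cy' yy |].
have o1 : 0 < o * det2 (h x - h 0) (h x' - h 0) by apply: (chord_order ch oh) => //; rewrite add0r.
have o2 : 0 < o * det2 (g y' - g c) (g y - g c) by apply: (chord_order cg og).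
by move: o1 o2; rewrite Ex Ex' base /det2; lra.
Qed.

Lemma reparametrization : exists psi psi' : R -> R,
  [/\ forall x y, x < y -> psi x < psi y, cancel psi psi', cancel psi' psi,
      forall s, psi (s + L) = psi s + T & forall s, h s = g (psi s)].
Proof.
have [psi H] := choice same_total; have [psi' H'] := choice same_onto.
exists psi, psi'; split.
- by move=> x y; apply: same_mono.
- move=> s; case: (ltrgtP (psi' (psi s)) s) => // lt.
    by have := same_mono (H' (psi s)) (H s) lt; rewrite ltxx.
  by have := same_mono (H s) (H' (psi s)) lt; rewrite ltxx.
- by move=> t; apply: same_fun (H _) (H' _).
- move=> s; apply: same_fun (H _) _; have [k [k1 k2 k3]] := H s.
  have [_ per _ _] := pg; have [_ per' _ _] := ph.
  exists (k - 1); rewrite intrB !mulrBl !mul1r; split; [by move: k1; lra | by move: k2; lra |].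
  by rewrite per per'.
by move=> s; have [k []] := H s.
Qed.

(** The whole curve lies on one side of the tangent of [h], so the distance to this
    line has a minimum along [g] at the point of contact. *)
Lemma velocity_parallel s t : h s = g t ->
  exists a, velocity h s = (a * (velocity g t).1, a * (velocity g t).2).
Proof.
move=> E; apply: (det2_param (cc_reg cg t)).
pose f x := o * det2 (velocity h s) (g x - g t).
have fge x : f t <= f x.
  have -> : f t = 0 by rewrite /f /det2 /= !subrr !mulr0 subrr mulr0.
  have : range h (g x) by have [_ _ _ ->] := ph; exact: (param_bd pg).
  move=> [s' _ hs']; rewrite /f -hs' -E.
  have [->|ne] := eqVneq (h s') (h s); first by rewrite /det2 /= !subrr !mulr0 subrr mulr0.
  by rewrite ltW // (chord_side ch oh) // eq_sym.
have df (x : R) : is_derive x 1 f (o * det2 (velocity h s) (velocity g x)).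
  have D1 := cc_der1 cg x; have D2 := cc_der2 cg x.
  rewrite /f /det2 /=; apply: is_derive_eq; rewrite !(scaler0, scale0r, subr0, addr0, add0r) //.
have t1 : t \in `]t - 1, t + 1[ by rewrite in_itv /=; apply/andP; split; lra.
have := derive1_at_min (f := f) (a := t - 1) (b := t + 1) (c := t).
move=> /(_ _ _ t1 _) H.
have {}H : is_derive t 1 f 0.
  apply: H; first lra.
    by move=> x _; exact: (@ex_derive _ _ _ _ _ _ _ (df x)).
  by move=> x _; exact: fge.
have := derive_val (is_derive := H); rewrite (derive_val (is_derive := df t)) => /eqP.
rewrite mulf_eq0 => /orP[/eqP o0|/eqP D].
  have [_ _ [p0 Ap0] _ _] := cc_dom cg; have := og 0 Ap0; by rewrite o0 mul0r ltxx.
by move: D; rewrite /det2; lra.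
Qed.

Lemma closing_same_side m n : closing g T m n -> closing h L m n.
Proof.
have [psi [psi' [mono K K' per E]]] := reparametrization.
apply: (closing_transport mono K K' per E) => s.
exact: velocity_parallel.
Qed.

End SameSide.

Lemma convex_reverse A g T : convex_curve A g T -> convex_curve A (reverse g) T.
Proof.
move=> cc; have [T0 per inj rg] := cc_par cc.
have d1 (s : R) : derivable (fst \o g) s 1 := @ex_derive _ _ _ _ _ _ _ (cc_der1 cc s).
have d2 (s : R) : derivable (snd \o g) s 1 := @ex_derive _ _ _ _ _ _ _ (cc_der2 cc s).
have V s := velocity_reverse s d1 d2.
have N (s : R) : is_derive s 1 (fun x : R => - x) (-1) by apply: is_derive_eq.
split.
- exact: (cc_dom cc).
- split=> //.
  + by move=> s; rewrite /reverse -(per (- (s + T))); congr g; ring.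
  + move=> x y; rewrite ?inE /= ?in_itv /= => /andP[x0 xT] /andP[y0 yT] E.
    rewrite !bnd_simp in x0 xT y0 yT; rewrite /reverse in E; case: (ltrgtP x y) => // lt; exfalso.
      by apply: (param_clash (cc_par cc) (esym E)); lra.
    by apply: (param_clash (cc_par cc) E); lra.
  + by rewrite -rg; apply/seteqP; split=> _ [s _ <-]; exists (- s); rewrite /reverse ?opprK.
- move=> s; rewrite V /= mulrC.
  exact: (is_derive1_comp (f := fst \o g) (g := fun x : R => - x) (x := s) (cc_der1 cc (- s)) (N s)).
- move=> s; rewrite V /= mulrC.
  exact: (is_derive1_comp (f := snd \o g) (g := fun x : R => - x) (x := s) (cc_der2 cc (- s)) (N s)).
- move=> s; under eq_fun do rewrite V /=.
  apply: cvgM; first exact: cvg_cst.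
  apply: (@cvg_comp _ _ _ (fun x : R => - x) (fun x => (velocity g x).1) _ (nbhs (- s))); last exact: (cc_cont1 cc).
  exact: opp_continuous.
- move=> s; under eq_fun do rewrite V /=.
  apply: cvgM; first exact: cvg_cst.
  apply: (@cvg_comp _ _ _ (fun x : R => - x) (fun x => (velocity g x).2) _ (nbhs (- s))); last exact: (cc_cont2 cc).
  exact: opp_continuous.
move=> s; rewrite V; apply/eqP => -[]; rewrite !mulN1r => /eqP; rewrite oppr_eq0 => /eqP e1 /eqP.
rewrite oppr_eq0 => /eqP e2; have := cc_reg cc (- s).
by rewrite /velocity e1 e2 eqxx.
Qed.

Lemma reverse_side A g T (o : R) : convex_curve A g T ->
  (forall s p, A p -> 0 < o * det2 (velocity g s) (p - g s)) ->
  forall s p, A p -> 0 < - o * det2 (velocity (reverse g) s) (p - reverse g s).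
Proof.
move=> cc H s p Ap.
have d1 (t : R) : derivable (fst \o g) t 1 := @ex_derive _ _ _ _ _ _ _ (cc_der1 cc t).
have d2 (t : R) : derivable (snd \o g) t 1 := @ex_derive _ _ _ _ _ _ _ (cc_der2 cc t).
by have := H (- s) p Ap; rewrite velocity_reverse // /reverse /det2 /=; lra.
Qed.

Lemma closing_reparam A g h (T L : R) m n : (0 < n)%N -> convex_curve A g T -> convex_curve A h L ->
  closing g T m n -> closing h L m n.
Proof.
move=> n0 cg ch cl.
have [og ogE Hg] := orientation cg; have [oh ohE Hh] := orientation ch.
have [E|E] := eqVneq og oh.
  have : range g (h 0) by have [_ _ _ ->] := cc_par cg; exact: (param_bd (cc_par ch)).
  move=> [c _ base]; rewrite E in Hg.
  exact: (closing_same_side cg ch Hg Hh base cl).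
have Hr := reverse_side cg Hg.
have {}E : - og = oh.
  by case: ogE E => ->; case: ohE => -> //; rewrite ?eqxx ?opprK.
rewrite E in Hr.
have cr := convex_reverse cg.
have : range (reverse g) (h 0) by have [_ _ _ ->] := cc_par cr; exact: (param_bd (cc_par ch)).
move=> [c _ base].
apply: (closing_same_side cr ch Hr Hh base).
apply: closing_reverse => // s.
  exact: (@ex_derive _ _ _ _ _ _ _ (cc_der1 cg s)).
exact: (@ex_derive _ _ _ _ _ _ _ (cc_der2 cg s)).
Qed.

End Reparam.

(** * Arc-length parametrization *)

Section Arclength.
Context {R : realType}.
Implicit Types (A : set (R * R)) (g h : R -> R * R).

(** The integrals from [- n] to [x], normalized to vanish at [0], agree where they
    are defined, and patch to a function on the whole line. *)
Lemma antiderivative (w : R -> R) : continuous w -> exists F : R -> R, forall x : R, is_derive x 1 F (w x).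
Proof.
move=> wc; pose mu := @lebesgue_measure R.
pose E (n x : R) : R := (\int[mu]_(t in `[- n, x]) w t)%R - (\int[mu]_(t in `[- n, 0%R]) w t)%R.
have dE (n x : R) : - n < x -> is_derive x 1 (E n) (w x).
  move=> nx.
  have int : mu.-integrable `[- n, x + 1] (EFin \o w).
    apply: continuous_compact_integrable; first exact: segment_compact.
    exact: continuous_subspaceT.
  have [|d1 d2] := continuous_FTC1_closed (x := x) _ int nx (wc x); first by rewrite ltrDl.
  have D : is_derive x 1 (fun y => (\int[mu]_(t in `[- n, y]) w t)%R) (w x).
    by rewrite -d2 derive1E; exact: DeriveDef.
  by rewrite /E; apply: is_derive_eq; rewrite subr0.
have E0 n : E n 0 = 0 by rewrite /E subrr.
have Eeq (n m x : R) : 0 < n -> 0 < m -> - n < x -> - m < x -> E n x = E m x.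
  move=> n0 m0 nx mx; pose D y := E n y - E m y.
  have dD (y : R) : - n < y -> - m < y -> is_derive y 1 D 0.
    by move=> h1 h2; have d1 := dE _ _ h1; have d2 := dE _ _ h2; apply: is_derive_eq; rewrite subrr.
  have cD (a b : R) : - n < a -> - m < a -> {within `[a, b], continuous D}.
    move=> h1 h2; apply: derivable_within_continuous => y; rewrite in_itv /= => /andP[ay _].
    apply: (@ex_derive _ _ _ _ _ _ _ (dD y _ _)); lra.
  suff : D x = 0 by rewrite /D; lra.
  have D0 : D 0 = 0 by rewrite /D !E0 subrr.
  case: (ltrgtP x 0) => [x0|x0|->] //.
    have [|c _] := MVT (f := D) (df := fun=> 0) x0 _ (cD x 0 nx mx).
      by move=> y; rewrite in_itv /= => /andP[xy _]; apply: dD; lra.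
    by rewrite mul0r D0; lra.
  have n0' : - n < 0 by lra.
  have m0' : - m < 0 by lra.
  have [|c _] := MVT (f := D) (df := fun=> 0) x0 _ (cD 0 x n0' m0').
    by move=> y; rewrite in_itv /= => /andP[xy _]; apply: dD; lra.
  by rewrite mul0r D0; lra.
exists (fun x => E (`|x| + 1) x) => x.
have pos (y : R) : 0 < `|y| + 1 by rewrite ltr_wpDl.
have neg (y : R) : - (`|y| + 1) < y by have := ler_norm (- y); rewrite normrN; lra.
have nx : - (`|x| + 2) < x by have := neg x; lra.
have D := dE _ _ nx.
apply: near_eq_is_derive D.
have key (y : R) : `|y - x| < 1 -> E (`|x| + 2) y = E (`|y| + 1) y.
  move=> h; apply: Eeq; [by have := pos x; lra | exact: pos | | exact: neg].
  have := neg x; move: h; rewrite ltr_norml; lra.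
by near=> y; apply: key; near: y; exact: near_dist.
Unshelve. all: by end_near. Qed.

Section Unit.
Variables (A : set (R * R)) (g : R -> R * R) (T : R).
Hypothesis cc : convex_curve A g T.
Hypothesis side : forall s p, A p -> 0 < det2 (velocity g s) (p - g s).
Let cp := cc_par cc.
Let T0 : 0 < T. Proof. by have [] := cp. Qed.

Let w s := Num.sqrt ((velocity g s).1 ^+ 2 + (velocity g s).2 ^+ 2).

Let w0 s : 0 < w s.
Proof. by rewrite sqrtr_gt0; exact: normsq_gt0 cc s. Qed.

Let w2 s : w s ^+ 2 = (velocity g s).1 ^+ 2 + (velocity g s).2 ^+ 2.
Proof. by rewrite sqr_sqrtr // ltW //; exact: normsq_gt0 cc s. Qed.

Let wc : continuous w.
Proof.
move=> s.
apply: (@cvg_comp _ _ _ (fun x => (velocity g x).1 ^+ 2 + (velocity g x).2 ^+ 2) Num.sqrt _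
  (nbhs ((velocity g s).1 ^+ 2 + (velocity g s).2 ^+ 2))); last exact: sqrt_continuous.
have v1 := cc_cont1 cc (x := s); have v2 := cc_cont2 cc (x := s).
by apply: cvgD; rewrite !expr2; apply: cvgM.
Qed.

Let wper s : w (s + T) = w s.
Proof. by have [_ per _ _] := cp; rewrite /w (velocity_shift _ per). Qed.

Lemma speed_lower_bound : exists2 t, 0 < t & forall s, t <= w s.
Proof.
have [t t0 H] : exists2 t, 0 < t & forall s, 0 <= s <= T -> t <= w s.
  apply: (compact_unif (P := fun t s => t <= w s)) => [t t' s _ tt|s0 _]; first exact: le_trans tt.
  have w20 : 0 < w s0 / 2 by rewrite divr_gt0.
  have /cvgrPdist_lt/(_ _ w20)/nearE_dist[d d0 Hd] := @wc s0.
  exists (Num.min d (w s0 / 2)) => [|s]; first by rewrite lt_min d0.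
  rewrite lt_min => /andP[h _]; have := Hd s h; rewrite ltr_norml ge_min => /andP[_ h2].
  by apply/orP; right; lra.
exists t => // s; have [k /andP[k1 k2]] := reduce_mod s T0.
by rewrite -(periodic_int wper s k); apply: H; rewrite k1 ltW.
Qed.

Lemma arclength_exists : exists (psi ell : R -> R) (L K : R),
  [/\ arclength_parametrization A (fun y => g (psi y)) L,
      [/\ forall x y, x < y -> psi x < psi y, cancel psi ell, cancel ell psi &
          forall s, psi (s + L) = psi s + T],
      0 < K /\ forall y y', `|psi y - psi y'| <= K * `|y - y'|
    & forall s, exists a, 0 < a /\ velocity (fun y => g (psi y)) s =
        (a * (velocity g (psi s)).1, a * (velocity g (psi s)).2)].
Proof.
have [ell dl] := antiderivative wc.
have lmvt x y : x < y -> exists xi, ell y - ell x = w xi * (y - x).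
  move=> xy; have [|xi _ E] := MVT xy (fun s _ => dl s).
    by apply: continuous_subspaceT; exact: (is_derive_continuous dl).
  by exists xi.
have lmono x y : x < y -> ell x < ell y.
  move=> xy; have [xi E] := lmvt x y xy; rewrite -subr_gt0 E mulr_gt0 // subr_gt0 //.
pose L := ell T - ell 0.
have L0 : 0 < L by rewrite subr_gt0; exact: lmono.
have lper s : ell (s + T) = ell s + L.
  pose D x := ell (x + T) - ell x.
  suff : D s = D 0 by rewrite /D add0r /L; lra.
  apply: is_derive_0_is_cst => x.
  have d1 := dl x.
  have d3 : is_derive x 1 (fun y : R => y + T) 1 by apply: is_derive_eq; rewrite addr0.
  have d2 := is_derive1_comp (f := ell) (g := fun y : R => y + T) (x := x) (dl (x + T)) d3.
  by apply: is_derive_eq; rewrite wper mulr1 subrr.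
have lperz s (k : int) : ell (s + k%:~R * T) = ell s + k%:~R * L.
  have P u : ell (u + T) - (u + T) * (L / T) = ell u - u * (L / T).
    by rewrite lper; field; rewrite gt_eqF.
  have := periodic_int (f := fun u => ell u - u * (L / T)) P s k.
  have -> : (s + k%:~R * T) * (L / T) = s * (L / T) + k%:~R * L by field; rewrite gt_eqF.
  lra.
have lsurj y : exists x, ell x = y.
  have [k /andP[k1 k2]] := reduce_mod (y - ell 0) L0.
  have [||c _ E] := @IVT _ ell 0 T (y + k%:~R * L) (ltW T0).
  - by apply: continuous_subspaceT; exact: (is_derive_continuous dl).
  - rewrite ge_min le_max; apply/andP; split; apply/orP; [left | right]; last rewrite -[ell T](subrK (ell 0)) -/L; lra.
  exists (c + (- k)%:~R * T); rewrite lperz E mulrNz; lra.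
have [psi lK] := choice lsurj.
have linj x y : ell x = ell y -> x = y.
  by move=> E; case: (ltrgtP x y) => // /lmono; rewrite E ltxx.
have K x : psi (ell x) = x by apply: linj; rewrite lK.
have pmono x y : x < y -> psi x < psi y.
  move=> xy; case: (ltrgtP (psi x) (psi y)) => // [/lmono|E]; first by rewrite !lK; lra.
  by move: (congr1 ell E); rewrite !lK; lra.
have pper y : psi (y + L) = psi y + T by apply: linj; rewrite lper !lK.
have dpsi (y : R) : is_derive y 1 psi (w (psi y))^-1.
  rewrite -{1}(lK y); apply: is_derive_inverse (dl (psi y)) _; last by rewrite gt_eqF.
    by near=> x; exact: K.
  by near=> x; exact: (is_derive_continuous dl).
have psic := is_derive_continuous dpsi.
pose h y := g (psi y).
have dh1 (y : R) : is_derive y 1 (fst \o h) ((velocity g (psi y)).1 / w (psi y)).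
  exact: (is_derive1_comp (f := fst \o g) (g := psi) (x := y) (cc_der1 cc (psi y)) (dpsi y)).
have dh2 (y : R) : is_derive y 1 (snd \o h) ((velocity g (psi y)).2 / w (psi y)).
  exact: (is_derive1_comp (f := snd \o g) (g := psi) (x := y) (cc_der2 cc (psi y)) (dpsi y)).
have E1 y : (fst \o h)^`()%classic y = (velocity g (psi y)).1 / w (psi y).
  by rewrite derive1E (derive_val (is_derive := dh1 y)).
have E2 y : (snd \o h)^`()%classic y = (velocity g (psi y)).2 / w (psi y).
  by rewrite derive1E (derive_val (is_derive := dh2 y)).
have V y : velocity h y = ((velocity g (psi y)).1 / w (psi y), (velocity g (psi y)).2 / w (psi y)).
  by rewrite /velocity E1 E2.
have [_ per inj rg] := cp.
exists psi, ell, L; have [t t0 wt] := speed_lower_bound.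
exists t^-1; split; last first.
- move=> y; exists (w (psi y))^-1; split; first by rewrite invr_gt0.
  by rewrite -/h V; congr (_, _); rewrite mulrC.
- split; first by rewrite invr_gt0.
  have lip (y y' : R) : y < y' -> `|psi y - psi y'| <= t^-1 * `|y - y'|.
    move=> yy; have [xi E] := lmvt _ _ (pmono _ _ yy).
    rewrite !lK in E; have pp := pmono _ _ yy.
    rewrite distrC (gtr0_norm (_ : 0 < psi y' - psi y)) ?subr_gt0 //.
    rewrite distrC (gtr0_norm (_ : 0 < y' - y)) ?subr_gt0 // E mulrA ler_peMl //; first by rewrite subr_ge0 ltW.
    by rewrite mulrC ler_pdivlMr // mul1r.
  move=> y y'; have [yy|yy|->] := ltgtP y y'; first exact: lip.
    by rewrite distrC (distrC y); exact: lip.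
  by rewrite !subrr normr0 mulr0.
- by split.
split.
- split=> //.
  + by move=> y; rewrite pper per.
  + move=> x y; rewrite ?inE /= ?in_itv /= => /andP[x0 xT] /andP[y0 yT] E.
    rewrite !bnd_simp in x0 xT y0 yT.
    have [k Ek] := param_eq cp E.
    have Eyx : y = x + k%:~R * L by rewrite -(lK y) Ek lperz lK.
    suff k0 : k = 0 by rewrite Eyx k0 mul0r addr0.
    have b1 : k%:~R * L < 1 * L by lra.
    have b2 : -1 * L < k%:~R * L by lra.
    move: b1 b2; rewrite !ltr_pM2r // -[1]/(1%:~R) -[-1]/((-1)%:~R) !ltr_int; lia.
  + rewrite -rg; apply/seteqP; split=> _ [s _ <-]; first by exists (psi s).
    by exists (ell s) => //=; rewrite K.
- split.
    by move=> s; split; [exact: (@ex_derive _ _ _ _ _ _ _ (dh1 s)) | exact: (@ex_derive _ _ _ _ _ _ _ (dh2 s))].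
  have cw s : (fun y => (w (psi y))^-1) @ s --> (w (psi s))^-1.
    apply: cvgV; first by rewrite gt_eqF.
    by apply: (@cvg_comp _ _ _ psi w _ (nbhs (psi s))); [exact: psic | exact: wc].
  split=> s.
    rewrite (funext E1); apply: cvgM; last exact: cw.
    by apply: (@cvg_comp _ _ _ psi (fun x => (velocity g x).1) _ (nbhs (psi s))); [exact: psic | exact: (cc_cont1 cc)].
  rewrite (funext E2); apply: cvgM; last exact: cw.
  by apply: (@cvg_comp _ _ _ psi (fun x => (velocity g x).2) _ (nbhs (psi s))); [exact: psic | exact: (cc_cont2 cc)].
- move=> s; rewrite -/h V /= !expr_div_n -mulrDl -w2 divff // expf_neq0 // gt_eqF //.
move=> s p Ap; rewrite -/h V.
have -> : det2 ((velocity g (psi s)).1 / w (psi s), (velocity g (psi s)).2 / w (psi s)) (p.1 - (h s).1, p.2 - (h s).2) =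
  det2 (velocity g (psi s)) (p - g (psi s)) / w (psi s) by rewrite /det2 /h /=; ring.
by rewrite divr_gt0 // side.
Unshelve. all: by end_near. Qed.

End Unit.
End Arclength.

(** * Regularity of the exit angle *)

Section LocallyLipschitz.
Context {R : realType}.
Variables (s0 t0 : R).
Implicit Types (F H : R -> R -> R) (f : R -> R).

(** Local boundedness is included, so that the property is stable under products. *)
Definition lip_at F := exists d K : R, [/\ 0 < d, 0 <= K &
  forall s s' t : R, `|s - s0| < d -> `|s' - s0| < d -> `|t - t0| < d ->
    `|F s t| <= K /\ `|F s t - F s' t| <= K * `|s - s'|].

Lemma lip_at_common F H : lip_at F -> lip_at H -> exists d K : R, [/\ 0 < d, 0 <= K &
  forall s s' t : R, `|s - s0| < d -> `|s' - s0| < d -> `|t - t0| < d ->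
    (`|F s t| <= K /\ `|F s t - F s' t| <= K * `|s - s'|) /\
    (`|H s t| <= K /\ `|H s t - H s' t| <= K * `|s - s'|)].
Proof.
move=> [d [K [d0 K0 HF]]] [d' [K' [d'0 K'0 HH]]].
exists (Num.min d d'), (K + K'); split; [by rewrite lt_min d0 | exact: addr_ge0 |].
move=> s s' t; rewrite !lt_min => /andP[a1 a2] /andP[b1 b2] /andP[c1 c2].
have [f1 f2] := HF s s' t a1 b1 c1; have [h1 h2] := HH s s' t a2 b2 c2.
have n0 := normr_ge0 (s - s').
have := mulr_ge0 K0 n0; have := mulr_ge0 K'0 n0.
by rewrite mulrDl; split; split; lra.
Qed.

Lemma lip_at_add F H : lip_at F -> lip_at H -> lip_at (fun s t => F s t + H s t).
Proof.
move=> LF LH; have [d [K [d0 K0 E]]] := lip_at_common LF LH.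
exists d, (K + K); split; [exact: d0 | exact: addr_ge0 |] => s s' t a b c.
have [[f1 f2] [h1 h2]] := E s s' t a b c.
split; first by apply: (le_trans (ler_normD _ _)); lra.
rewrite opprD addrACA mulrDl; apply: (le_trans (ler_normD _ _)); lra.
Qed.

Lemma lip_at_opp F : lip_at F -> lip_at (fun s t => - F s t).
Proof.
move=> [d [K [d0 K0 E]]]; exists d, K; split=> // s s' t a b c.
by rewrite normrN -opprD normrN; exact: E.
Qed.

Lemma lip_at_mul F H : lip_at F -> lip_at H -> lip_at (fun s t => F s t * H s t).
Proof.
move=> LF LH; have [d [K [d0 K0 E]]] := lip_at_common LF LH.
exists d, (K * K + K * K); split; [exact: d0 | by rewrite addr_ge0 // mulr_ge0 |] => s s' t a b c.
have [[f1 f2] [h1 h2]] := E s s' t a b c; have [[f1' _] _] := E s' s t b a c.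
split.
  rewrite normrM; apply: (le_trans (ler_pM (normr_ge0 _) (normr_ge0 _) f1 h1)).
  by rewrite lerDl mulr_ge0.
have -> : F s t * H s t - F s' t * H s' t = (F s t - F s' t) * H s t + F s' t * (H s t - H s' t) by ring.
apply: (le_trans (ler_normD _ _)); rewrite !normrM mulrDl; apply: lerD.
  by apply: (le_trans (ler_pM (normr_ge0 _) (normr_ge0 _) f2 h1)); rewrite mulrAC.
by apply: (le_trans (ler_pM (normr_ge0 _) (normr_ge0 _) f1' h2)); rewrite mulrA.
Qed.

Lemma lip_at_C1 f f' : (forall s : R, is_derive s 1 f (f' s)) -> continuous f' -> lip_at (fun s _ => f s).
Proof.
move=> df cf'; have cf := is_derive_continuous df.
have /cvgrPdist_lt/(_ _ ltr01)/nearE_dist[d1 d10 H1] := cf' s0.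
have /cvgrPdist_lt/(_ _ ltr01)/nearE_dist[d2 d20 H2] := cf s0.
exists (Num.min d1 d2), (`|f s0| + `|f' s0| + 1); split.
- by rewrite lt_min d10.
- by rewrite !addr_ge0.
move=> s s' t; rewrite !lt_min => /andP[a1 a2] /andP[b1 b2] _.
have B (x y : R) : `|x - y| < 1 -> `|y| <= `|x| + 1.
  move=> h; have -> : y = x - (x - y) by ring.
  by apply: (le_trans (ler_normB _ _)); lra.
have n1 := normr_ge0 (f s0); have n2 := normr_ge0 (f' s0).
split; first by have := B _ _ (H2 s a2); lra.
have M (x y : R) : `|x - s0| < d1 -> `|y - s0| < d1 -> x < y ->
    `|f x - f y| <= (`|f s0| + `|f' s0| + 1) * `|x - y|.
  move=> hx hy xy; have [|c] := MVT xy (fun s _ => df s).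
    by apply: continuous_subspaceT.
  rewrite in_itv /= => /andP[xc cy] E.
  rewrite distrC E normrM [`|x - y|]distrC ler_wpM2r //.
  have hc : `|c - s0| < d1.
    by move: hx hy; rewrite !ltr_norml => /andP[? ?] /andP[? ?]; apply/andP; split; lra.
  by have := B _ _ (H1 c hc); lra.
have [ss|ss|->] := ltgtP s s'; first exact: M.
  by rewrite distrC [`|s - s'|]distrC; exact: M.
by rewrite !subrr normr0 mulr0.
Qed.

Lemma lip_at_cont f : continuous f -> lip_at (fun _ t => f t).
Proof.
move=> cf; have /cvgrPdist_lt/(_ _ ltr01)/nearE_dist[d d0 H] := cf t0.
exists d, (`|f t0| + 1); split; [exact: d0 | by rewrite addr_ge0 |].
move=> s s' t _ _ ht; split; last by rewrite subrr normr0 mulr_ge0 ?addr_ge0.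
have -> : f t = f t0 - (f t0 - f t) by ring.
by apply: (le_trans (ler_normB _ _)); have := H t ht; lra.
Qed.

Lemma lip_at_inv F : lip_at F -> continuous (F s0) -> 0 < F s0 t0 -> lip_at (fun s t => (F s t)^-1).
Proof.
move=> [d [K [d0 K0 E]]] cF p; set c := F s0 t0 in p.
have c4 : 0 < c / 4 by rewrite divr_gt0.
have /cvgrPdist_lt/(_ _ c4)/nearE_dist[d1 d10 H1] := cF t0.
have K1 : 0 < K + 1 by rewrite ltr_wpDl.
pose e := c / 4 / (K + 1).
have e0 : 0 < e by rewrite divr_gt0.
have eE : (K + 1) * e = c / 4 by rewrite /e mulrC divfK // gt_eqF.
clearbody e.
have low s t : `|s - s0| < Num.min d (Num.min d1 e) ->
    `|t - t0| < Num.min d (Num.min d1 e) -> c / 2 <= F s t.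
  rewrite !lt_min => /and3P[a1 a2 a3] /and3P[b1 b2 b3].
  have a0 : `|s0 - s0| < d by rewrite subrr normr0.
  have [_ h] := E s s0 t a1 a0 b1.
  have h1 := H1 t b2; rewrite -/c in h1.
  have h2 : K * `|s - s0| <= c / 4.
    rewrite -eE; apply: ler_pM => //; [by rewrite lerDl | exact: ltW].
  move: h1; rewrite ltr_norml => /andP[h1 h3].
  have := le_trans h h2; rewrite ler_norml => /andP[h4 h5]; lra.
have c20 : 0 <= 2 / c by rewrite divr_ge0 // ltW.
exists (Num.min d (Num.min d1 e)), (2 / c + K * (2 / c) * (2 / c)); split.
- by rewrite !lt_min d0 d10.
- exact: addr_ge0 c20 (mulr_ge0 (mulr_ge0 K0 c20) c20).
move=> s s' t a b b'; have l1 := low s t a b'; have l2 := low s' t b b'.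
have p1 : 0 < F s t by apply: lt_le_trans l1; rewrite divr_gt0.
have p2 : 0 < F s' t by apply: lt_le_trans l2; rewrite divr_gt0.
have i1 : (F s t)^-1 <= 2 / c by rewrite -invf_div lef_pV2 // posrE divr_gt0.
have i2 : (F s' t)^-1 <= 2 / c by rewrite -invf_div lef_pV2 // posrE divr_gt0.
split.
  by rewrite gtr0_norm ?invr_gt0 // (le_trans i1) // lerDl; exact: mulr_ge0 (mulr_ge0 K0 c20) c20.
have -> : (F s t)^-1 - (F s' t)^-1 = - (F s t - F s' t) * (F s t)^-1 * (F s' t)^-1.
  by field; rewrite !gt_eqF.
move: a b b'; rewrite !lt_min => /and3P[a _ _] /and3P[b _ _] /and3P[b' _ _].
have [_ h] := E s s' t a b b'.
rewrite !normrM normrN (gtr0_norm (_ : 0 < (F s t)^-1)) ?invr_gt0 // (gtr0_norm (_ : 0 < (F s' t)^-1)) ?invr_gt0 //.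
have n0 := normr_ge0 (s - s').
have i1' : 0 <= (F s t)^-1 by rewrite invr_ge0 ltW.
have i2' : 0 <= (F s' t)^-1 by rewrite invr_ge0 ltW.
apply: (@le_trans _ _ (K * `|s - s'| * (2 / c) * (2 / c))).
  by apply: ler_pM => //; [rewrite mulr_ge0 | apply: ler_pM].
have -> : K * `|s - s'| * (2 / c) * (2 / c) = K * (2 / c) * (2 / c) * `|s - s'| by ring.
by rewrite ler_wpM2r // lerDr.
Qed.

End LocallyLipschitz.

Section Backward.
Context {R : realType}.
Implicit Types (A : set (R * R)) (g : R -> R * R).

Definition C1_velocity g := exists a1 a2 : R -> R,
  [/\ forall s : R, is_derive s 1 (fun x => (velocity g x).1) (a1 s), continuous a1,
      forall s : R, is_derive s 1 (fun x => (velocity g x).2) (a2 s) & continuous a2].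

Section Cotan.
Variables (A : set (R * R)) (g : R -> R * R) (T : R).
Hypothesis cc : convex_curve A g T.
Hypothesis side : forall s p, A p -> 0 < 1 * det2 (velocity g s) (p - g s).
Hypothesis C2 : C1_velocity g.
Let cp := cc_par cc.
Let T0 : 0 < T. Proof. by have [] := cp. Qed.
Local Notation cot := (cotan g 1).

Lemma lip_at_cotan (s0 t0 : R) : g s0 != g t0 -> lip_at s0 t0 cot.
Proof.
move=> ne; have [a1 [a2 [d1 c1 d2 c2]]] := C2.
have V1 : lip_at s0 t0 (fun s _ => (velocity g s).1) by exact: (lip_at_C1 _ _ d1 c1).
have V2 : lip_at s0 t0 (fun s _ => (velocity g s).2) by exact: (lip_at_C1 _ _ d2 c2).
have X1 : lip_at s0 t0 (fun s t => (g t).1 - (g s).1).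
  apply: lip_at_add; first exact: lip_at_cont _ _ (curve_cont1 cc).
  by apply: lip_at_opp; exact: (lip_at_C1 _ _ (cc_der1 cc) (cc_cont1 cc)).
have X2 : lip_at s0 t0 (fun s t => (g t).2 - (g s).2).
  apply: lip_at_add; first exact: lip_at_cont _ _ (curve_cont2 cc).
  by apply: lip_at_opp; exact: (lip_at_C1 _ _ (cc_der2 cc) (cc_cont2 cc)).
have D : lip_at s0 t0 (fun s t => 1 * ((velocity g s).1 * ((g t).2 - (g s).2) - (velocity g s).2 * ((g t).1 - (g s).1))).
  under eq_fun do under eq_fun do rewrite mul1r.
  apply: lip_at_add; first exact: lip_at_mul.
  by apply: lip_at_opp; exact: lip_at_mul.
apply: (@lip_at_mul _ _ _ (fun s t => dot2 (velocity g s) (g t - g s)) (fun s t => (1 * det2 (velocity g s) (g t - g s))^-1)).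
  by apply: lip_at_add; apply: lip_at_mul.
apply: (lip_at_inv D); last exact: (chord_side cc side ne).
move=> t; apply: cvgM; first exact: cvg_cst.
apply: cvgB; apply: cvgM; try exact: cvg_cst.
  by apply: cvgB; [exact: curve_cont2 cc t | exact: cvg_cst].
by apply: cvgB; [exact: curve_cont1 cc t | exact: cvg_cst].
Qed.

Variables (m : int) (n : nat) (G : R -> R).
Hypothesis n0 : (0 < n)%N.
Hypothesis cm : closing_map g T m n G.
Let H := cm_inv T m n G.

Let H_twist s : H s < s < H s + T.
Proof. by have := cm_twist cm (H s); rewrite (cm_invK n0 cm). Qed.

Let H_cont : continuous H.
Proof.
have it k : continuous (iter k G).
  elim: k => [|k IH] s; first exact: cvg_id.
  by apply: (@cvg_comp _ _ _ (iter k G) G _ (nbhs (iter k G s))); [exact: IH | exact: (cm_continuous n0 cm)].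
move=> s; apply: (@cvg_comp _ _ _ (fun x => x - m%:~R * T) (iter n.-1 G) _ (nbhs (s - m%:~R * T))); last exact: it.
by apply: cvgB; [exact: cvg_id | exact: cvg_cst].
Qed.

Let k s := cot s (G s).

(** The incoming chord at [s] makes the same angle as the outgoing one. *)
Lemma exit_cotan s : k s = - cot s (H s).
Proof.
have h := H_twist s; have tw := cm_twist cm s.
have l : law g (H s) s (G s) = 0 by have := cm_law cm (H s); rewrite (cm_invK n0 cm).
have n1 : g s != g (H s) by rewrite eq_sym; exact: (param_neq cp).
have n2 : g s != g (G s) by exact: (param_neq cp).
by have := (law_cotan cc side n1 n2).1 l; rewrite /k; lra.
Qed.

(** [G] is increasing, so along the graph both the outgoing and the incoming
    chord turn the right way: one bounds the increments of [k] from above,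
    the other one from below. *)
Lemma exit_cotan_step (s s' : R) : s < s' -> s' < G s -> G s' < s' + T -> G s < s' + T -> s' < H s + T ->
  cot s (H s) - cot s' (H s) <= k s' - k s <= cot s' (G s) - cot s (G s).
Proof.
move=> ss sG Gs Gs2 sH.
have GG := cm_mono cm ss; have HH := cm_inv_mono cm ss; rewrite -/H in HH.
have h' := H_twist s'; have /andP[h1 h2] := h'.
apply/andP; split; last first.
  by have := cotan_decr cc side sG GG Gs; rewrite /k; lra.
rewrite !exit_cotan; have := cotan_decr cc side (x := s') (t := H s + T) (t' := H s' + T) sH.
rewrite !(cotan_per 1 cc) !ltrD2r => /(_ HH h1); lra.
Qed.

Lemma exit_cotan_local (s0 : R) : exists2 d : R, 0 < d & forall s, `|s - s0| < d ->
  forall s', `|s - s'| < d -> `|k s - k s'| <= d^-1 * `|s - s'|.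
Proof.
have /andP[g1 g2] := cm_twist cm s0; have /andP[h1 h2] := H_twist s0.
have [d1 [K1 [d10 K10 L1]]] : lip_at s0 (G s0) cot by apply: lip_at_cotan; apply: (param_neq cp); rewrite g1.
have [d2 [K2 [d20 K20 L2]]] : lip_at s0 (H s0) cot.
  by apply: lip_at_cotan; rewrite eq_sym; apply: (param_neq cp); rewrite h1.
pose r := Num.min (Num.min (G s0 - s0) (s0 + T - G s0)) (H s0 + T - s0) / 4.
have [r1 r2 r3 r0] : [/\ 4 * r <= G s0 - s0, 4 * r <= s0 + T - G s0, 4 * r <= H s0 + T - s0 & 0 < r].
  have E : 4 * r = Num.min (Num.min (G s0 - s0) (s0 + T - G s0)) (H s0 + T - s0).
    by rewrite /r mulrC divfK.
  rewrite E !ge_min !lexx ?orbT; split=> //.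
  by rewrite divr_gt0 // !lt_min; apply/andP; split; [apply/andP; split|]; lra.
clearbody r.
have e1 : 0 < Num.min d1 r by rewrite lt_min d10.
have e2 : 0 < Num.min d2 r by rewrite lt_min d20.
have /cvgrPdist_lt/(_ _ e1)/nearE_dist[d3 d30 C1] := @cm_continuous _ _ _ _ _ _ n0 cm s0.
have /cvgrPdist_lt/(_ _ e2)/nearE_dist[d4 d40 C3] := @H_cont s0.
pose q := Num.min (Num.min d1 d2) (Num.min (Num.min d3 d4) r).
have q0 : 0 < q by rewrite !lt_min d10 d20 d30 d40.
have KK : 0 < K1 + K2 + 1 by rewrite ltr_wpDl // addr_ge0.
pose d := Num.min (q / 2) (K1 + K2 + 1)^-1.
have d0 : 0 < d by rewrite lt_min divr_gt0 // invr_gt0.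
have dq : d <= q / 2 by rewrite ge_min lexx.
have dK : K1 + K2 + 1 <= d^-1.
  by rewrite -[X in X <= _]invrK lef_pV2 ?posrE ?invr_gt0 // ge_min lexx orbT.
clearbody d.
have M (s s' : R) : `|s - s0| < q -> `|s' - s0| < q -> s < s' -> `|k s - k s'| <= d^-1 * `|s - s'|.
  rewrite /q !lt_min => /andP[/andP[a1 a2] /andP[/andP[a3 a4] a5]] /andP[/andP[b1 b2] /andP[/andP[b3 b4] b5]] ss.
  have := C1 s a3; rewrite lt_min distrC => /andP[u1 u2].
  have := C1 s' b3; rewrite lt_min distrC => /andP[u1' u2'].
  have := C3 s a4; rewrite lt_min distrC => /andP[w1 w2].
  have [_ x1] := L1 s s' _ a1 b1 u1; have [_ x2] := L2 s s' _ a2 b2 w1.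
  have : cot s (H s) - cot s' (H s) <= k s' - k s <= cot s' (G s) - cot s (G s).
    move: a5 b5 u2 u2' w2; rewrite !ltr_norml => /andP[? ?] /andP[? ?] /andP[? ?] /andP[? ?] /andP[? ?].
    by apply: exit_cotan_step => //; lra.
  move=> /andP[y1 y2].
  have n1 := normr_ge0 (s - s').
  apply: (@le_trans _ _ ((K1 + K2 + 1) * `|s - s'|)); last by rewrite ler_wpM2r.
  have := mulr_ge0 K10 n1; have := mulr_ge0 K20 n1.
  move: x1 x2; rewrite !mulrDl mul1r; set z := `|s - s'| in n1 *.
  by rewrite !ler_norml => /andP[? ?] /andP[? ?] ? ?; apply/andP; split; lra.
exists d => // s hs s' hs'.
have hq : `|s - s0| < q by lra.
have hq' : `|s' - s0| < q.
  have -> : s' - s0 = (s - s0) - (s - s') by ring.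
  by apply: (le_lt_trans (ler_normB _ _)); lra.
have [ss|ss|->] := ltgtP s s'; first exact: M.
  by rewrite distrC [`|s - s'|]distrC; exact: M.
by rewrite !subrr normr0 mulr0.
Qed.

Lemma exit_cotan_per s : k (s + T) = k s.
Proof.
have [_ per _ _] := cp.
by rewrite /k (cm_per cm) (cotan_per 1 cc) /cotan (velocity_shift _ per) per.
Qed.

(** By compactness and periodicity the local Lipschitz constants are bounded. *)
Lemma exit_cotan_lipschitz : exists2 d : R, 0 < d &
  forall s s', `|s - s'| < d -> `|k s - k s'| <= d^-1 * `|s - s'|.
Proof.
pose P (d s : R) := forall s', `|s - s'| < d -> `|k s - k s'| <= d^-1 * `|s - s'|.
have Pdecr (t t' s : R) : 0 < t' -> t' <= t -> P t s -> P t' s.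
  move=> t'0 tt h s' hs; apply: (le_trans (h s' (lt_le_trans hs tt))).
  by rewrite ler_wpM2r // lef_pV2 ?posrE // (lt_le_trans t'0).
have [d d0 Hd] := compact_unif (a := 0) (b := T) Pdecr (fun s0 _ => exit_cotan_local s0).
exists d => // s s' ss.
have [j /andP[j1 j2]] := reduce_mod s T0.
have := Hd (s + j%:~R * T) _ (s' + j%:~R * T); rewrite !(periodic_int exit_cotan_per) opprD addrACA subrr addr0; apply=> //.
by rewrite j1 ltW.
Qed.

End Cotan.
End Backward.

(** * From closing maps to invariant curves *)

Section CosineOfCotangent.
Context {R : realType}.
Implicit Types (k : R).

Definition cos_of_cot k := k / Num.sqrt (1 + k ^+ 2).

Let r k := Num.sqrt (1 + k ^+ 2).
Let r2 k : r k ^+ 2 = 1 + k ^+ 2.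
Proof. by rewrite sqr_sqrtr // addr_ge0 // sqr_ge0. Qed.
Let r0 k : 0 < r k.
Proof. by rewrite sqrtr_gt0 ltr_pwDl // sqr_ge0. Qed.
Let r1 k : 1 <= r k.
Proof. by rewrite -sqrtr1 ler_wsqrtr // lerDl sqr_ge0. Qed.
Let rk k : `|k| <= r k.
Proof. by rewrite -sqrtr_sqr ler_wsqrtr // lerDr. Qed.

Lemma cos_of_cot_itv k : -1 < cos_of_cot k < 1.
Proof.
have : `|cos_of_cot k| < 1.
  rewrite /cos_of_cot normf_div (gtr0_norm (r0 k)) ltr_pdivrMr // mul1r -sqrtr_sqr ltr_sqrt.
    by rewrite ltrDr.
  by rewrite ltr_pwDl // sqr_ge0.
by rewrite ltr_norml.
Qed.

Definition angle_of_cot k := acos (cos_of_cot k).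

Lemma angle_of_cot_itv k : 0 < angle_of_cot k < pi.
Proof.
have /andP[h1 h2] := cos_of_cot_itv k.
by rewrite /angle_of_cot acos_gt0 ?acos_ltpi //; apply/andP; split=> //; exact: ltW.
Qed.

Lemma cos_angle_of_cot k : cos (angle_of_cot k) = k / r k.
Proof.
have /andP[h1 h2] := cos_of_cot_itv k.
by rewrite /angle_of_cot acosK // in_itv /=; apply/andP; split; exact: ltW.
Qed.

Lemma sin_angle_of_cot k : sin (angle_of_cot k) = (r k)^-1.
Proof.
have /andP[h1 h2] := cos_of_cot_itv k.
rewrite /angle_of_cot sin_acos; last by apply/andP; split; exact: ltW.
have -> : 1 - cos_of_cot k ^+ 2 = (r k)^-1 ^+ 2.
  by rewrite /cos_of_cot -/(r k) expr_div_n exprVn r2; field; rewrite -r2 expf_neq0 // gt_eqF.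
by rewrite sqrtr_sqr gtr0_norm // invr_gt0.
Qed.

Lemma cos_of_cot_lipschitz k k' : `|cos_of_cot k - cos_of_cot k'| <= 2 * `|k - k'|.
Proof.
have -> : cos_of_cot k - cos_of_cot k' = (k - k') / r k + k' / r k' * ((r k' - r k) / r k).
  by rewrite /cos_of_cot -/(r k) -/(r k'); field; rewrite !gt_eqF.
have n0 := normr_ge0 (k - k').
have i1 : (r k)^-1 <= 1 by rewrite invf_le1.
have h1 : `|(k - k') / r k| <= `|k - k'|.
  by rewrite normf_div (gtr0_norm (r0 k)) ler_pdivrMr // ler_peMr.
have h2 : `|k' / r k'| <= 1 by rewrite normf_div (gtr0_norm (r0 k')) ler_pdivrMr // mul1r.
have h3 : `|r k' - r k| <= `|k - k'|.
  have s0 : 0 < r k' + r k by rewrite addr_gt0.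
  rewrite -(ler_pM2r s0) -{1}(gtr0_norm s0) -normrM.
  have -> : (r k' - r k) * (r k' + r k) = - ((k - k') * (k + k')).
    by have := r2 k; have := r2 k'; lra.
  rewrite normrN normrM ler_wpM2l // (le_trans (ler_normD _ _)) // addrC lerD //.
have h4 : `|(r k' - r k) / r k| <= `|k - k'|.
  by rewrite normf_div (gtr0_norm (r0 k)) ler_pdivrMr // (le_trans h3) // ler_peMr.
apply: (le_trans (ler_normD _ _)); rewrite [`|k' / _ * _|]normrM.
have := ler_pM (normr_ge0 _) (normr_ge0 _) h2 h4; lra.
Qed.

Lemma unit_rotate (v u : R * R) (phi : R) : v.1 ^+ 2 + v.2 ^+ 2 = 1 ->
  dot2 v u = cos phi -> det2 v u = sin phi -> u = rotate phi v.
Proof.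
move=> v1 hd he; rewrite [u]surjective_pairing /rotate -hd -he /dot2 /det2; congr (_, _).
  have -> : (v.1 * u.1 + v.2 * u.2) * v.1 - (v.1 * u.2 - v.2 * u.1) * v.2 = u.1 * (v.1 ^+ 2 + v.2 ^+ 2) by ring.
  by rewrite v1 mulr1.
have -> : (v.1 * u.2 - v.2 * u.1) * v.1 + (v.1 * u.1 + v.2 * u.2) * v.2 = u.2 * (v.1 ^+ 2 + v.2 ^+ 2) by ring.
by rewrite v1 mulr1.
Qed.

End CosineOfCotangent.

Section InvariantCurve.
Context {R : realType}.
Implicit Types (A : set (R * R)) (g : R -> R * R).

Section Step.
Variables (A : set (R * R)) (g : R -> R * R) (L : R) (m : int) (n : nat) (G : R -> R).
Hypothesis hA : strictly_convex_bounded_domain A.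
Hypothesis arc : arclength_parametrization A g L.
Hypothesis n0 : (0 < n)%N.
Hypothesis cm : closing_map g L m n G.
Let cc := arc_curve hA arc.
Let k s := cotan g 1 s (G s).
Let phi s := angle_of_cot (k s).

Let dot_out s : dot2 (velocity g s) (g (G s) - g s) = k s * det2 (velocity g s) (g (G s) - g s).
Proof.
have D := chord_side cc (arc_side arc) (param_neq (cc_par cc) (cm_twist cm s)).
by rewrite /k /cotan mul1r divfK // -[X in X != _]mul1r gt_eqF.
Qed.

Let dot_in s : dot2 (velocity g (G s)) (g s - g (G s)) = - k (G s) * det2 (velocity g (G s)) (g s - g (G s)).
Proof.
have ne : g (G s) != g s by rewrite eq_sym; exact: (param_neq (cc_par cc) (cm_twist cm s)).
have D := chord_side cc (arc_side arc) ne.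
have E := exit_cotan cc (arc_side arc) n0 cm (G s).
rewrite /= (cm_Kinv n0 cm) in E.
by rewrite /k E opprK /cotan mul1r divfK // -[X in X != _]mul1r gt_eqF.
Qed.

Lemma closing_billiard_step s :
  billiard_step g L (s, - cos (phi s)) (G s, - cos (phi (G s))).
Proof.
set v := velocity g s; set v1 := velocity g (G s).
set c := g (G s) - g s.
have U := arc_unit arc s; rewrite -/v in U.
have U1 := arc_unit arc (G s); rewrite -/v1 in U1.
have D0 : 0 < det2 v c.
  by have := chord_side cc (arc_side arc) (param_neq (cc_par cc) (cm_twist cm s)); rewrite mul1r.
have D1 : 0 < - det2 v1 c.
  have ne : g (G s) != g s by rewrite eq_sym; exact: (param_neq (cc_par cc) (cm_twist cm s)).
  have := chord_side cc (arc_side arc) ne; rewrite -/v1 /c /det2 /=; lra.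
have hd := dot_out s; rewrite -/v -/c in hd.
have hd1 : dot2 v1 c = - k (G s) * det2 v1 c.
  by have := dot_in s; rewrite -/v1 /c /dot2 /det2 /=; lra.
pose r x := Num.sqrt (1 + x ^+ 2 : R).
have r0 x : 0 < r x by rewrite sqrtr_gt0 ltr_pwDl // sqr_ge0.
have r2 x : r x ^+ 2 = 1 + x ^+ 2 by rewrite sqr_sqrtr // addr_ge0 // sqr_ge0.
pose t := det2 v c * r (k s).
have t0 : 0 < t by rewrite mulr_gt0.
have tn : t != 0 by rewrite gt_eqF.
have uE : (c.1 / t, c.2 / t) = rotate (phi s) v.
  apply: unit_rotate => //.
    rewrite cos_angle_of_cot -/(r (k s)); have -> : dot2 v (c.1 / t, c.2 / t) = dot2 v c / t by rewrite /dot2 /=; ring.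
    by rewrite hd /t; field; rewrite !gt_eqF.
  rewrite sin_angle_of_cot -/(r (k s)); have -> : det2 v (c.1 / t, c.2 / t) = det2 v c / t by rewrite /det2 /=; ring.
  by rewrite /t; field; rewrite !gt_eqF.
have uu : (c.1 / t) ^+ 2 + (c.2 / t) ^+ 2 = 1.
  have -> : c.1 / t = (rotate (phi s) v).1 by rewrite -uE.
  have -> : c.2 / t = (rotate (phi s) v).2 by rewrite -uE.
  have -> : (rotate (phi s) v).1 ^+ 2 + (rotate (phi s) v).2 ^+ 2 =
    (cos (phi s) ^+ 2 + sin (phi s) ^+ 2) * (v.1 ^+ 2 + v.2 ^+ 2) by rewrite /rotate /=; ring.
  by rewrite cos2Dsin2 U mulr1.
pose y := det2 v1 (c.1 / t, c.2 / t).
have yE : y = det2 v1 c / t by rewrite /y /det2 /=; ring.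
have y0 : y < 0 by rewrite yE pmulr_llt0 ?invr_gt0 //; lra.
have xE : dot2 v1 (c.1 / t, c.2 / t) = - k (G s) * y.
  by rewrite yE mulrA -hd1 /dot2 /=; ring.
have yr : y = - (r (k (G s)))^-1.
  have E : (y * r (k (G s))) ^+ 2 = 1.
    rewrite exprMn r2.
    have -> : y ^+ 2 * (1 + k (G s) ^+ 2) = (- k (G s) * y) ^+ 2 + y ^+ 2 by ring.
    rewrite -xE.
    have -> : dot2 v1 (c.1 / t, c.2 / t) ^+ 2 + y ^+ 2 =
      (v1.1 ^+ 2 + v1.2 ^+ 2) * ((c.1 / t) ^+ 2 + (c.2 / t) ^+ 2) by rewrite /y /dot2 /det2 /=; ring.
    by rewrite U1 uu mulr1.
  have neg : y * r (k (G s)) < 0 by rewrite pmulr_llt0.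
  have E1 : y * r (k (G s)) = -1.
    move: E => /eqP; rewrite -subr_eq0 subr_sqr_1 mulf_eq0 => /orP[]; last by rewrite addr_eq0 => /eqP.
    by rewrite subr_eq0 => /eqP E1; move: neg; rewrite E1 ltr10.
  by rewrite -[LHS](mulfK (_ : r (k (G s)) != 0)) ?E1 ?mulN1r // gt_eqF.
have uE1 : (c.1 / t, c.2 / t) = rotate (- phi (G s)) v1.
  apply: unit_rotate => //.
    by rewrite cosN cos_angle_of_cot -/(r _) xE yr mulrNN.
  by rewrite sinN sin_angle_of_cot -/(r _) -/y yr.
exists (phi s), (phi (G s)); rewrite /=.
split; [exact: angle_of_cot_itv | exact: angle_of_cot_itv | by [] | by [] |].
split; [exact: cm_twist cm s | | by rewrite -/v -uE -uE1].
exists t; rewrite -/v -[cos _ * _ - _](_ : (rotate (phi s) v).1 = _) // -[sin _ * _ + _](_ : (rotate (phi s) v).2 = _) // -uE /=.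
rewrite [g (G s)]surjective_pairing; congr (_, _); rewrite /c /=; field; exact: tn.
Qed.

End Step.

Lemma lipschitz_of_bound (f : R -> R) (M : R) : (forall x y, `|f x - f y| <= M * `|x - y|) ->
  lipschitz (f : R^o -> R^o).
Proof.
move=> H; exists M; split; first exact: num_real.
move=> M' MM' [x y] _ /=; apply: (le_trans (H x y)); by rewrite ler_wpM2r // ltW.
Qed.

Lemma closing_invariant_curve A g T m n : (0 < n)%N -> convex_curve A g T ->
  (forall s p, A p -> 0 < 1 * det2 (velocity g s) (p - g s)) -> C1_velocity g ->
  closing g T m n -> has_periodic_invariant_curve A m n.
Proof.
move=> n0 cc side C2 [G cm]; have hA := cc_dom cc.
have side1 s p : A p -> 0 < det2 (velocity g s) (p - g s) by move=> Ap; have := side s p Ap; rewrite mul1r.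
have [psi [ell [L [K [arc [mono psiK ellK per] [K0 lip] vel]]]]] := arclength_exists cc side1.
pose h y := g (psi y).
pose G0 y := ell (G (psi y)).
have cm0 : closing_map h L m n G0.
  apply: (closing_map_transport mono psiK ellK per _ _ cm) => // s.
  by have [a [_ ->]] := vel s; exists a.
have ch := arc_curve hA arc.
pose k y := cotan h 1 y (G0 y).
have kE y : k y = cotan g 1 (psi y) (G (psi y)).
  have [a [a0 V]] := vel y; rewrite /k /cotan /h V /G0 ellK /dot2 /det2 /=.
  have D := chord_side cc side (param_neq (cc_par cc) (cm_twist cm (psi y))); rewrite /det2 mul1r in D.
  rewrite !mul1r -!mulrA -mulrDr -mulrBr -mulf_div divff ?mul1r // gt_eqF //.
pose eta y := - cos (angle_of_cot (k y)).
have eE y : eta y = - cos_of_cot (k y) by rewrite /eta cos_angle_of_cot.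
have eper y : eta (y + L) = eta y.
  by rewrite /eta; congr (- cos (angle_of_cot _)); exact: (exit_cotan_per ch cm0).
have estep y : billiard_map h L (y, eta y) = (G0 y, eta (G0 y)).
  exact: (billiard_map_step hA arc (closing_billiard_step hA arc n0 cm0 y)).
exists h, L, eta; split; first exact: arc.
split.
- exact: eper.
- have [d d0 Hd] := exit_cotan_lipschitz cc side C2 n0 cm.
  apply: (@lipschitz_of_bound _ (2 * (d^-1 * K))) => x y.
  rewrite !eE -opprD normrN.
  have px := lip x y.
  have i0 : 0 < d^-1 by rewrite invr_gt0.
  have [lt|ge] := ltP `|psi x - psi y| d.
    apply: (le_trans (cos_of_cot_lipschitz _ _)); rewrite -mulrA ler_pM2l //.
    rewrite !kE; apply: (le_trans (Hd _ _ lt)); by rewrite -mulrA ler_pM2l.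
  have : 1 <= d^-1 * K * `|x - y|.
    by rewrite -mulrA mulrC ler_pdivlMr // mul1r (le_trans ge).
  have /andP[c1 c2] := cos_of_cot_itv (k x); have /andP[c3 c4] := cos_of_cot_itv (k y).
  move=> h1; rewrite ler_norml -mulrA; apply/andP; split; lra.
- by move=> y; rewrite eE ltrN2 ltrNl andbC; exact: cos_of_cot_itv.
- by move=> _ [_ [y _ <-] <-]; rewrite estep; exists (G0 y).
move=> y; have it j : iter j (billiard_map h L) (y, eta y) = (iter j G0 y, eta (iter j G0 y)).
  by elim: j => [|j IH] //=; rewrite IH estep.
by rewrite it (cm_iter cm0) (periodic_int eper).
Qed.

Lemma C1_velocity_reverse A g T : convex_curve A g T -> C1_velocity g -> C1_velocity (reverse g).
Proof.
move=> cc [a1 [a2 [d1 c1 d2 c2]]].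
have e1 (s : R) : derivable (fst \o g) s 1 := @ex_derive _ _ _ _ _ _ _ (cc_der1 cc s).
have e2 (s : R) : derivable (snd \o g) s 1 := @ex_derive _ _ _ _ _ _ _ (cc_der2 cc s).
have V s := velocity_reverse s e1 e2.
have N (s : R) : is_derive s 1 (fun x : R => - x) (-1) by apply: is_derive_eq.
have D (f f' : R -> R) : (forall s : R, is_derive s 1 f (f' s)) ->
    forall s : R, is_derive s 1 (fun x => -1 * f (- x)) (f' (- s)).
  move=> df s; have h := is_derive1_comp (f := f) (g := fun x : R => - x) (x := s) (df (- s)) (N s).
  have := @is_deriveZ _ _ _ (f \o (fun x : R => - x)) (-1) s 1 _ h; rewrite /GRing.scale /= => h2.
  by apply: is_derive_eq h2 _; ring.
exists (fun s => a1 (- s)), (fun s => a2 (- s)); split.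
- by under eq_fun do rewrite V /=; exact: D.
- by move=> s; apply: (@cvg_comp _ _ _ (fun x : R => - x) a1 _ (nbhs (- s))); [exact: opp_continuous | exact: c1].
- by under eq_fun do rewrite V /=; exact: D.
by move=> s; apply: (@cvg_comp _ _ _ (fun x : R => - x) a2 _ (nbhs (- s))); [exact: opp_continuous | exact: c2].
Qed.

Theorem invariant_curve_closing A g T m n : 0 < m -> (0 < n)%N -> convex_curve A g T -> C1_velocity g ->
  has_periodic_invariant_curve A m n <-> closing g T m n.
Proof.
move=> m0 n0 cc C2; split.
  move=> [h [L [eta [arc pic]]]]; have hA := cc_dom cc.
  exact: closing_reparam n0 (arc_curve hA arc) cc (curve_closing_map hA arc m0 n0 pic).
move=> cl; have [ o oE Ho] := orientation cc.
case: oE => oE; rewrite oE in Ho; first exact: closing_invariant_curve n0 cc Ho C2 cl.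
have Hr := reverse_side cc Ho; rewrite opprK in Hr.
apply: (closing_invariant_curve n0 (convex_reverse cc) Hr (C1_velocity_reverse cc C2)).
apply: closing_reverse cl => // s.
  exact: (@ex_derive _ _ _ _ _ _ _ (cc_der1 cc s)).
exact: (@ex_derive _ _ _ _ _ _ _ (cc_der2 cc s)).
Qed.

End InvariantCurve.

(** * Limit points of subsets of an interval *)

Section Family.
Context {R : realType}.

Lemma family_continuous (I : set R) (f : R -> R -> R) (e : R) : family_series I f -> I e -> continuous (f e).
Proof. by move=> Sf Ie; exact: (is_derive_continuous (fun s => family_derive s Sf Ie)). Qed.

Lemma family_C1_velocity (I : set R) (g : R -> R -> R * R) (e : R) :
  family_series I (fun e s => (g e s).1) -> family_series I (fun e s => (g e s).2) -> I e ->
  C1_velocity (g e).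
Proof.
move=> S1 S2 Ie; have D1 := family_dpar S1; have D2 := family_dpar S2.
exists (dpar (dpar (fun e s => (g e s).1)) e), (dpar (dpar (fun e s => (g e s).2)) e); split.
- by move=> s; exact: family_derive s D1 Ie.
- exact: family_continuous (family_dpar D1) Ie.
- by move=> s; exact: family_derive s D2 Ie.
exact: family_continuous (family_dpar D2) Ie.
Qed.

Lemma family_convex_curve (I : set R) (A : set (R * R)) (g : R -> R -> R * R) (e T : R) :
  family_series I (fun e s => (g e s).1) -> family_series I (fun e s => (g e s).2) -> I e ->
  strictly_convex_bounded_domain A -> closed_parametrization A (g e) T ->
  (forall s, velocity (g e) s != 0) -> convex_curve A (g e) T.
Proof.
move=> S1 S2 Ie hA cp reg; split=> //.
- by move=> s; exact: family_derive s S1 Ie.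
- by move=> s; exact: family_derive s S2 Ie.
- exact: family_continuous (family_dpar S1) Ie.
exact: family_continuous (family_dpar S2) Ie.
Qed.

(** The interior points of [S] relative to [I] form an open and closed part of the
    connected set [I]. *)
Lemma discrete_or_full (I S : set R) : is_interval I -> S `<=` I ->
  (forall e0, I e0 ->
     (forall d : R, 0 < d -> exists2 e : R, `|e - e0| < d & e != e0 /\ S e) ->
     exists2 d : R, 0 < d & forall e, I e -> `|e - e0| < d -> S e) ->
  discrete_set S \/ S = I.
Proof.
move=> itvI SI loc.
have [disc|ndisc] := pselect (discrete_set S); [by left | right].
have [e0 Ie0 acc0] : exists2 e0, I e0 &
    forall d : R, 0 < d -> exists2 e : R, `|e - e0| < d & e != e0 /\ S e.
  apply: contrapT => none; apply: ndisc => x Sx; split; first by rewrite inE.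
  apply: contrapT => niso; apply: none; exists x; first exact: SI.
  move=> d d0; apply: contrapT => far; apply: niso.
  exists (ball x d); first exact: nbhsx_ballx.
  apply/seteqP; split=> [y [/= yx Sy]|y ->]; last by split=> //; exact: ballxx.
  apply: contrapT => nyx; apply: far; exists y; last by split=> //; apply/eqP.
  by rewrite distrC.
pose C := [set e : R | exists2 d : R, 0 < d & forall e', I e' -> `|e' - e| < d -> S e'].
have CI e : I e -> C e -> S e.
  by move=> Ie [d d0 H]; apply: H => //; rewrite subrr normr0.
suff CI' : I `&` C = I.
  apply/seteqP; split=> // e Ie; apply: CI => //.
  by have [] : (I `&` C) e by rewrite CI'.
have cI : connected I by apply/connected_intervalP.
apply: cI.
- by exists e0; split=> //; exact: loc.
- exists C => //; rewrite openE => e [d d0 H]; apply/nearE_dist.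
  exists (d / 2) => [|e' h]; first exact: divr_gt0.
  exists (d / 2); first exact: divr_gt0.
  move=> e'' Ie'' h'; apply: H => //.
  have -> : e'' - e = (e'' - e') + (e' - e) by ring.
  by apply: (le_lt_trans (ler_normD _ _)); lra.
exists (closure (I `&` C)); first exact: closed_closure.
apply/seteqP; split=> [e [Ie Ce]|e [Ie cle]]; first by split=> //; apply: subset_closure.
split=> //; apply: contrapT => nC; apply: (nC); apply: loc => // d d0.
have [b [[Ib Cb] be]] := cle (ball e d) (nbhsx_ballx e d d0).
exists b; first by rewrite distrC.
split; last exact: CI.
by apply/eqP => E; apply: nC; rewrite -E.
Qed.

End Family.

Theorem theorem15 (R : realType) (I : set R) (Omega : R -> set (R * R))
    (m : int) (n : nat) :
  is_interval I ->
  analytic_family I Omega ->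
  (0 < n)%N ->
  coprimez m n%:Z ->
  0 < m%:~R / n%:R :> rat ->
  m%:~R / n%:R < 1 :> rat ->
  discrete_set [set e | I e /\ has_periodic_invariant_curve (Omega e) m n] \/
  [set e | I e /\ has_periodic_invariant_curve (Omega e) m n] = I.
Proof.
move=> itvI [dom [g [an1 an2 Hg]]] n0 _ r0 r1.
have n0' : 0 < n%:R :> rat by rewrite ltr0n.
have m0 : 0 < m by move: r0; rewrite pmulr_lgt0 ?invr_gt0 // ltr0z.
have mn : m < n%:Z by move: r1; rewrite ltr_pdivrMr // mul1r -[n%:R]/(n%:Z%:~R) ltr_int.
have {n0' r0 r1} [N nE] : exists N, n = N.+2.
  by clear - n0 m0 mn; case: n n0 mn => [|[|N]] // _ mn; [lia | exists N].
subst n.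
have S1 : family_series I (fun e s => (g e s).1) by exact: analytic_series.
have S2 : family_series I (fun e s => (g e s).2) by exact: analytic_series.
have exT e : exists T : R, I e -> closed_parametrization (Omega e) (g e) T.
  have [Ie|nI] := pselect (I e); last by exists 0.
  by have [[T cp] _] := Hg e Ie; exists T.
have [T cp] := choice exT.
have cc e : I e -> convex_curve (Omega e) (g e) (T e).
  by move=> Ie; apply: (family_convex_curve S1 S2 Ie (dom e Ie) (cp e Ie)); have [] := Hg e Ie.
have equiv e : I e -> has_periodic_invariant_curve (Omega e) m N.+2 <-> closing (g e) (T e) m N.+2.
  by move=> Ie; apply: invariant_curve_closing (cc e Ie) (family_C1_velocity S1 S2 Ie).
apply: discrete_or_full => // [e []//|e0 Ie0 acc].
have [|d d0 H] := closing_local S1 S2 cc m0 mn Ie0.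
  move=> d d0; have [e ed [ne [Ie pic]]] := acc d d0.
  by exists e => //; split=> //; exact: (equiv e Ie).1 pic.
by exists d => // e Ie ed; split=> //; apply: (equiv e Ie).2; exact: H.
Qed.
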